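(* Let $0<\delta<1$, let $H(\delta)=\{z\in\mathbb{C}\mid \mathrm{Re}(z)\ge-\delta\}$, let $g(z)$ be analytic on the half-plane $H(\delta)$, and let $h(z)$ be meromorphic with simple poles at the non-positive integers. Let $\phi(z)$ denote the analytic continuation of $\sin(\pi z)h(-z)$ to the non-negative integers. Assume that there are real constants $C,P,A$ with $A<\pi$ such that $g$ satisfies the growth condition $$|g(v+iw)|<\frac{Ce^{Pv+A|w|}}{|\phi(v+iw)|}$$ for all $z=v+iw\in H(\delta)$ ($v,w\in\mathbb{R}$), and that $$\lim_{k\to\infty}\left|\frac{\mathrm{Res}_{z=-k}(h(z))}{\phi(k)}\right|^{1/k}=L\ge 1.$$ Then $$\int_0^\infty x^{s-1}\sum_{k=0}^\infty \mathrm{Res}_{z=-k}\left(h(z)\right)\,g(k)\,x^k\,dx=h(s)g(-s)$$ holds for all $0<\mathrm{Re}(s)<\delta$.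
   Context: $\mathrm{Res}_{z=-k}(h(z))$ denotes the residue of $h$ at $z=-k$. The function $\sin(\pi z)h(-z)$ has removable singularities at the non-negative integers (the simple poles of $h(-z)$ there are cancelled by the zeros of $\sin(\pi z)$); $\phi$ is the function obtained by removing these singularities.
   Formalization: The series under the integral is replaced by its analytic continuation along (0,∞), since it may diverge for large x (e.g. h=π/sin(πz), g=1, where it diverges for x≥1); the growth condition is read as including that φ has no poles in H(δ). *)

(* Defs.v *)
(* Stdlib world: Stdlib's reals and Coquelicot. *)
From Stdlib Require Import Reals.
From Coquelicot Require Import Coquelicot.
Open Scope R_scope.

Definition Cexp (z : C) : C := (exp (Re z) * cos (Im z), exp (Re z) * sin (Im z)).

Definition Csin (z : C) : C := ((Cexp (Ci * z) - Cexp (- (Ci * z))) / (2 * Ci))%C.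

(* x ^ w for x > 0, on the principal branch. *)
Definition RCpow (x : R) (w : C) : C := Cexp (w * RtoC (ln x))%C.

(* Complex differentiability on a neighbourhood of p; being analytic on a
   closed set means being analytic at each of its points. *)
Definition analytic_at (f : C -> C) (p : C) : Prop :=
  locally p (fun z : C => ex_derive f z).

(* On a punctured neighbourhood of p, h is the sum of the principal part
   c 0 / (z - p) + ... + c n / (z - p) ^ (n + 1) and of a function analytic
   at p.  The value of the total function h at p itself is unconstrained. *)
Definition laurent_at (h : C -> C) (p : C) (n : nat) (c : nat -> C) : Prop :=
  exists u : C -> C, analytic_at u p /\
    locally' p (fun z : C =>
      h z = (sum_n (fun j : nat => c j / (z - p) ^ S j) n + u z)%C).

(* A pole of order exactly n + 1. *)
Definition pole_at (h : C -> C) (p : C) (n : nat) : Prop :=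
  exists c : nat -> C, laurent_at h p n c /\ c n <> RtoC 0.

Definition simple_pole_at (h : C -> C) (p : C) : Prop := pole_at h p 0.

(* Meromorphic on the whole plane. *)
Definition meromorphic (h : C -> C) : Prop :=
  forall p : C, analytic_at h p \/ exists n : nat, pole_at h p n.

Definition is_residue (h : C -> C) (p r : C) : Prop :=
  exists (n : nat) (c : nat -> C), laurent_at h p n c /\ r = c 0%nat.

(* The residue is unique where it exists, so iota selects it at every pole. *)
Definition Residue (h : C -> C) (p : C) : C :=
  @iota C_CompleteNormedModule (is_residue h p).

(* phi is z |-> sin (pi z) h (- z) with the singularities at 0, 1, 2, ...
   removed; it is determined by h at every point where h (- z) is. *)
Definition removes_singularities (h phi : C -> C) : Prop :=
  (forall z : C, (forall k : nat, z <> RtoC (INR k)) ->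
     phi z = (Csin (RtoC PI * z) * h (- z))%C) /\
  (forall k : nat, analytic_at phi (RtoC (INR k))).

(* The half-plane H(delta). *)
Definition half_plane (delta : R) (z : C) : Prop := - delta <= Re z.

(* The quotient on the right is read in [0, +oo]: the bound says nothing at a
   zero of phi (where 1 / |phi| = +oo) and fails at a pole of phi (where
   1 / |phi| = 0), so phi has no pole in H(delta).  As functions are total,
   both conventions have to be spelled out. *)
Definition growth_condition (delta C0 P A : R) (g phi : C -> C) : Prop :=
  forall z : C, half_plane delta z ->
    analytic_at phi z /\
    (phi z <> RtoC 0 ->
     Cmod (g z) < C0 * exp (P * Re z + A * Rabs (Im z)) / Cmod (phi z)).

(* F is the function defined on (0, +oo) by the power series with coefficients
   a: its sum below the radius of convergence rho, required to be positive, and the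
   analytic continuation of that sum along the half-line beyond rho.  By the identity
   theorem this determines F on (0, +oo).  A continuation is unavoidable:
   coefficients (-1) ^ k stand for 1 / (1 + x) on the whole half-line. *)
Definition power_series_on_half_line (a : nat -> C) (F : C -> C) : Prop :=
  let rho := CV_radius (fun k => Cmod (a k)) in
  Rbar_lt 0 rho /\
  (forall x : R, 0 < x -> Rbar_lt x rho ->
     is_series (fun k => (a k * RtoC x ^ k)%C) (F (RtoC x))) /\
  (forall x : R, 0 < x -> analytic_at F (RtoC x)).

(* Main.v *)
(** This is Ramanujan's master theorem in disguise.  The residue of h at -k is
    - (-1)^k phi(k) / pi, so with psi = phi g the power series has coefficients
    - (-1)^k psi(k) / pi; these are minus the residues of q(z) e^(zy) at z = k, where
    q(z) = psi(z) / sin(pi z) and x = e^y.  The function F(e^y) is the integral of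
    q(z) e^(zy) / (2 pi) along Re z = -c with respect to Im z, for any 0 < c < delta.
    Since |q| decays like e^((A - pi) |Im z|), it is holomorphic for |Im y| < pi - A.
    Moving the line to Re z = N + 1/2 gives the power series when Re y < -P, and the
    identity theorem carries the equality up to the radius of convergence.

    No Fubini argument is needed for the Mellin transform: the integral K_c(y) of
    q(z) e^((z+s)y) / (2 pi (z+s)) along Re z = -c is an antiderivative of e^(sy) F(e^y).
    It tends to 0 at -oo if c < Re s and at +oo if c > Re s, and the two versions differ
    by the residue q(-s) = h(s) g(-s) at z = -s. *)

Require Import Defs.
From Stdlib Require Import Reals Lra Lia Psatz IndefiniteDescription.
From Coquelicot Require Import Coquelicot.
Open Scope R_scope.

(** * Complex derivatives *)

Local Notation is_Cderive f z d := (@is_derive C_AbsRing C_NormedModule f z d).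
Local Notation ex_Cderive f z := (@ex_derive C_AbsRing C_NormedModule f z).

(** Holomorphy always means that a complex derivative exists at each point; continuity of the
    derivative is not assumed, hence the quartering argument for rectangles, the only contours used.
    A residue enters as the limit r of (z - p) f(z) rather than through a Laurent series, so the
    same lemma also covers a regular point, with r = 0. Decay in |Im z| removes the horizontal
    sides, and each shift of a vertical line costs one residue. The obstacle is the factor e^(P Re
    z): it allows the lines to be pushed to the right only for Re y < -P, although the series may
    converge much further. Replacing x by a complex y in a strip gives the room needed to propagate
    the equality, by a chain of overlapping discs along the real axis. Differentiability in y, for
    integrals and for series, rests on one estimate: the quadratic Taylor remainder of the
    exponential, summed or integrated uniformly in the truncation. The growth condition turns into a
    bound on psi = phi g that holds at the zeros of phi too, since psi vanishes there. *)

Lemma Cmod_minus_sym (z w : C) : Cmod (z - w) = Cmod (w - z).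
Proof. rewrite <- Cmod_opp. f_equal. ring. Qed.

Lemma Cmod_le_Rabs (z : C) : Cmod z <= Rabs (fst z) + Rabs (snd z).
Proof.
  destruct z as [x y]; simpl.
  replace ((x, y) : C) with (RtoC x + Ci * RtoC y)%C.
  2:{ unfold RtoC, Ci, Cplus, Cmult; simpl. f_equal; ring. }
  eapply Rle_trans; [apply Cmod_triangle|].
  rewrite Cmod_mult, Cmod_Ci, !Cmod_R. lra.
Qed.

Lemma Rabs_fst_le_Cmod (z : C) : Rabs (fst z) <= Cmod z.
Proof. apply (re_le_Cmod z). Qed.

Lemma Rabs_snd_le_Cmod (z : C) : Rabs (snd z) <= Cmod z.
Proof.
  eapply Rle_trans; [|apply (Rmax_Cmod z)]. apply Rmax_r.
Qed.

Lemma Cmod_triangle_minus (z w : C) : Cmod z - Cmod w <= Cmod (z - w).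
Proof.
  assert (H := Cmod_triangle (z - w) w).
  replace (z - w + w)%C with z in H by ring. lra.
Qed.

(** The balls of [C_UniformSpace] are those of a product, that is, open squares; a square of
    half-side e / 2 fits into the disc of radius e. This is the bridge between filters and estimates
    on [Cmod]. *)
Lemma locally_Cmod (p : C) (P : C -> Prop) :
  locally (T := C_UniformSpace) p P <->
  exists e, 0 < e /\ forall z, Cmod (z - p) < e -> P z.
Proof.
  split.
  - intros [e He]. exists e. split; [apply cond_pos|].
    intros z Hz. apply He. split.
    + eapply Rle_lt_trans; [|apply Hz].
      apply (Rabs_fst_le_Cmod (z - p)).
    + eapply Rle_lt_trans; [|apply Hz].
      apply (Rabs_snd_le_Cmod (z - p)).
  - intros (e & He & H).
    assert (He2 : 0 < e / 2) by lra.
    exists (mkposreal _ He2). intros z [H1 H2]. apply H.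
    eapply Rle_lt_trans; [apply Cmod_le_Rabs|].
    change (Rabs (fst z - fst p) < e / 2) in H1.
    change (Rabs (snd z - snd p) < e / 2) in H2.
    change (Rabs (fst z - fst p) + Rabs (snd z - snd p) < e). lra.
Qed.

(** Over [C_AbsRing] the neighbourhoods are discs for [Cmod], so the definition unfolds to an
    epsilon-delta statement; all estimates of derivatives below are made in this form. *)
Lemma is_Cderive_eps (f : C -> C) (z d : C) :
  is_Cderive f z d <->
  forall eps, 0 < eps -> exists del, 0 < del /\
    forall w, Cmod (w - z) < del ->
      Cmod (f w - f z - d * (w - z)) <= eps * Cmod (w - z).
Proof.
  split.
  - intros [_ H] eps Heps.
    destruct (H z (fun P HP => HP) (mkposreal _ Heps)) as [del Hdel].
    exists del. split; [apply cond_pos|].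
    intros w Hw. specialize (Hdel w Hw). simpl in Hdel.
    replace (d * (w - z))%C with ((w - z) * d)%C by ring. exact Hdel.
  - intros H. split.
    + apply (is_linear_scal_l (V := C_NormedModule) d).
    + intros x Hx eps.
      assert (Hx' : z = x) by exact (is_filter_lim_locally_unique (V := AbsRing_NormedModule C_AbsRing) z x Hx).
      subst x.
      destruct (H eps (cond_pos eps)) as (del & Hdel & H').
      exists (mkposreal _ Hdel). intros w Hw.
      specialize (H' w Hw).
      replace (d * (w - z))%C with ((w - z) * d)%C in H' by ring.
      exact H'.
Qed.

Lemma ex_Cderive_continuous (f : C -> C) (z : C) : ex_Cderive f z ->
  forall eps, 0 < eps -> exists del, 0 < del /\
    forall w, Cmod (w - z) < del -> Cmod (f w - f z) < eps.
Proof.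
  intros [d Hd] eps Heps.
  rewrite is_Cderive_eps in Hd.
  destruct (Hd 1 Rlt_0_1) as (del & Hdel & H).
  assert (Hd0 := Cmod_ge_0 d).
  assert (Hq : 0 < eps / (Cmod d + 2)) by (apply Rdiv_lt_0_compat; lra).
  exists (Rmin del (eps / (Cmod d + 2))). split; [apply Rmin_pos; lra|].
  intros w Hw.
  assert (H1 := Rmin_l del (eps / (Cmod d + 2))).
  assert (H2 := Rmin_r del (eps / (Cmod d + 2))).
  specialize (H w (Rlt_le_trans _ _ _ Hw H1)).
  assert (H3 : Cmod (w - z) < eps / (Cmod d + 2)) by lra.
  replace (f w - f z)%C with ((f w - f z - d * (w - z)) + d * (w - z))%C by ring.
  eapply Rle_lt_trans; [apply Cmod_triangle|]. rewrite Cmod_mult.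
  assert (H4 := Cmod_ge_0 (w - z)).
  apply (Rmult_lt_compat_r (Cmod d + 2)) in H3; [|lra].
  unfold Rdiv in H3. rewrite Rmult_assoc, Rinv_l in H3; nra.
Qed.

Lemma is_Cderive_ext_loc (f g : C -> C) (z d : C) (e : R) : 0 < e ->
  (forall w, Cmod (w - z) < e -> f w = g w) -> is_Cderive f z d -> is_Cderive g z d.
Proof.
  intros He Hfg. rewrite !is_Cderive_eps. intros H eps Heps.
  destruct (H eps Heps) as (del & Hdel & H').
  exists (Rmin del e). split; [apply Rmin_pos; lra|].
  intros w Hw.
  assert (H1 := Rmin_l del e). assert (H2 := Rmin_r del e).
  rewrite <- !Hfg.
  - apply H'; lra.
  - replace (z - z)%C with (RtoC 0) by ring. now rewrite Cmod_0.
  - lra.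
Qed.

Lemma is_Cderive_const (a z : C) : is_Cderive (fun _ => a) z (RtoC 0).
Proof. apply (is_derive_const (V := C_NormedModule)). Qed.

Lemma is_Cderive_id (z : C) : is_Cderive (fun w => w) z (RtoC 1).
Proof.
  apply is_Cderive_eps. intros eps Heps. exists 1. split; [lra|]. intros w _.
  replace (w - z - 1 * (w - z))%C with (RtoC 0) by ring. rewrite Cmod_0.
  apply Rmult_le_pos; [lra|apply Cmod_ge_0].
Qed.

Lemma is_Cderive_plus (f g : C -> C) (z a b : C) :
  is_Cderive f z a -> is_Cderive g z b ->
  is_Cderive (fun w => f w + g w)%C z (a + b)%C.
Proof. apply (is_derive_plus (V := C_NormedModule)). Qed.

Lemma is_Cderive_minus (f g : C -> C) (z a b : C) :
  is_Cderive f z a -> is_Cderive g z b ->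
  is_Cderive (fun w => f w - g w)%C z (a - b)%C.
Proof. apply (is_derive_minus (V := C_NormedModule)). Qed.

Lemma is_Cderive_mult (f g : C -> C) (z a b : C) :
  is_Cderive f z a -> is_Cderive g z b ->
  is_Cderive (fun w => f w * g w)%C z (a * g z + f z * b)%C.
Proof.
  intros Hf Hg.
  assert (Hc := ex_Cderive_continuous g z (ex_intro _ b Hg)).
  rewrite is_Cderive_eps in *. intros eps Heps.
  assert (Ha := Cmod_ge_0 a). assert (Hgz := Cmod_ge_0 (g z)).
  assert (Hfz := Cmod_ge_0 (f z)).
  set (e1 := eps / 3 / (Cmod (g z) + 1)).
  set (e2 := eps / 3 / (Cmod (f z) + 1)).
  (* The bound 1 keeps [g w] within [Cmod (g z) + 1]; the other bound controls the cross term a (w -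
     z) (g w - g z). *)
  set (e3 := Rmin 1 (eps / 3 / (Cmod a + 1))).
  assert (E1 : e1 * (Cmod (g z) + 1) = eps / 3) by (unfold e1; field; lra).
  assert (E2 : e2 * (Cmod (f z) + 1) = eps / 3) by (unfold e2; field; lra).
  assert (P1 : 0 < e1) by (unfold e1; apply Rdiv_lt_0_compat; lra).
  assert (P2 : 0 < e2) by (unfold e2; apply Rdiv_lt_0_compat; lra).
  assert (P3 : 0 < e3).
  { unfold e3; apply Rmin_pos; [lra|]; apply Rdiv_lt_0_compat; lra. }
  assert (E3 : e3 * (Cmod a + 1) <= eps / 3).
  { replace (eps / 3) with (eps / 3 / (Cmod a + 1) * (Cmod a + 1)) by (field; lra).
    apply Rmult_le_compat_r; [lra|]. apply Rmin_r. }
  assert (E3' : e3 <= 1) by apply Rmin_l.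
  destruct (Hf e1 P1) as (d1 & D1 & F1).
  destruct (Hg e2 P2) as (d2 & D2 & F2).
  destruct (Hc e3 P3) as (d3 & D3 & F3).
  exists (Rmin d1 (Rmin d2 d3)). split; [repeat apply Rmin_pos; lra|].
  intros w Hw.
  assert (M1 := Rmin_l d1 (Rmin d2 d3)). assert (M2 := Rmin_r d1 (Rmin d2 d3)).
  assert (M3 := Rmin_l d2 d3). assert (M4 := Rmin_r d2 d3).
  specialize (F1 w ltac:(lra)). specialize (F2 w ltac:(lra)).
  specialize (F3 w ltac:(lra)).
  replace (f w * g w - f z * g z - (a * g z + f z * b) * (w - z))%C
    with ((f w - f z - a * (w - z)) * g w + f z * (g w - g z - b * (w - z))
          + a * (w - z) * (g w - g z))%C by ring.
  eapply Rle_trans; [apply Cmod_triangle|].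
  eapply Rle_trans; [apply Rplus_le_compat_r, Cmod_triangle|].
  rewrite !Cmod_mult.
  assert (G : Cmod (g w) <= Cmod (g z) + 1).
  { assert (H := Cmod_triangle_minus (g w) (g z)). lra. }
  assert (W := Cmod_ge_0 (w - z)). assert (Gw := Cmod_ge_0 (g w)).
  assert (G3 := Cmod_ge_0 (g w - g z)).
  set (t := Cmod (w - z)) in *.
  assert (T1 : Cmod (f w - f z - a * (w - z)) * Cmod (g w) <= eps / 3 * t).
  { rewrite <- E1. replace (e1 * (Cmod (g z) + 1) * t) with (e1 * t * (Cmod (g z) + 1)) by ring.
    apply Rmult_le_compat; try apply Cmod_ge_0; lra. }
  assert (T2 : Cmod (f z) * Cmod (g w - g z - b * (w - z)) <= eps / 3 * t).
  { rewrite <- E2. replace (e2 * (Cmod (f z) + 1) * t) with ((Cmod (f z) + 1) * (e2 * t)) by ring.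
    apply Rmult_le_compat; try apply Cmod_ge_0; lra. }
  assert (T3 : Cmod a * t * Cmod (g w - g z) <= eps / 3 * t).
  { apply Rle_trans with (t * (e3 * (Cmod a + 1))); [|nra].
    replace (Cmod a * t * Cmod (g w - g z)) with (t * (Cmod (g w - g z) * Cmod a)) by ring.
    apply Rmult_le_compat_l; [lra|]. apply Rmult_le_compat; lra. }
  lra.
Qed.

Lemma is_Cderive_linear (k z : C) : is_Cderive (fun w => k * w)%C z k.
Proof.
  assert (D := is_Cderive_mult (fun _ => k) (fun w => w) z _ _ (is_Cderive_const k z) (is_Cderive_id z)).
  simpl in D. replace (0 * z + k * 1)%C with k in D by ring. exact D.
Qed.

Lemma is_Cderive_comp (f g : C -> C) (z a b : C) :
  is_Cderive f (g z) a -> is_Cderive g z b ->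
  is_Cderive (fun w => f (g w)) z (a * b)%C.
Proof.
  intros Hf Hg.
  assert (Hc := ex_Cderive_continuous g z (ex_intro _ b Hg)).
  rewrite is_Cderive_eps in *. intros eps Heps.
  assert (Ha := Cmod_ge_0 a). assert (Hb := Cmod_ge_0 b).
  set (e1 := eps / 2 / (Cmod b + 1)).
  set (e2 := Rmin 1 (eps / 2 / (Cmod a + 1))).
  assert (E1 : e1 * (Cmod b + 1) = eps / 2) by (unfold e1; field; lra).
  assert (P1 : 0 < e1) by (unfold e1; apply Rdiv_lt_0_compat; lra).
  assert (P2 : 0 < e2).
  { unfold e2; apply Rmin_pos; [lra|]; apply Rdiv_lt_0_compat; lra. }
  assert (E2 : e2 * (Cmod a + 1) <= eps / 2).
  { replace (eps / 2) with (eps / 2 / (Cmod a + 1) * (Cmod a + 1)) by (field; lra).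
    apply Rmult_le_compat_r; [lra|]. apply Rmin_r. }
  assert (E2' : e2 <= 1) by apply Rmin_l.
  destruct (Hf e1 P1) as (d1 & D1 & F1).
  destruct (Hg e2 P2) as (d2 & D2 & F2).
  destruct (Hc d1 D1) as (d3 & D3 & F3).
  exists (Rmin d2 d3). split; [apply Rmin_pos; lra|].
  intros w Hw.
  assert (M3 := Rmin_l d2 d3). assert (M4 := Rmin_r d2 d3).
  specialize (F2 w ltac:(lra)). specialize (F3 w ltac:(lra)).
  specialize (F1 (g w) F3).
  replace (f (g w) - f (g z) - a * b * (w - z))%C
    with ((f (g w) - f (g z) - a * (g w - g z)) + a * (g w - g z - b * (w - z)))%C by ring.
  eapply Rle_trans; [apply Cmod_triangle|]. rewrite Cmod_mult.
  assert (W := Cmod_ge_0 (w - z)).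
  assert (G : Cmod (g w - g z) <= (Cmod b + 1) * Cmod (w - z)).
  { replace (g w - g z)%C with ((g w - g z - b * (w - z)) + b * (w - z))%C by ring.
    eapply Rle_trans; [apply Cmod_triangle|]. rewrite Cmod_mult. nra. }
  set (t := Cmod (w - z)) in *.
  assert (T1 : e1 * Cmod (g w - g z) <= eps / 2 * t).
  { rewrite <- E1, Rmult_assoc. apply Rmult_le_compat_l; lra. }
  assert (T2 : Cmod a * Cmod (g w - g z - b * (w - z)) <= eps / 2 * t).
  { apply Rle_trans with (Cmod a * (e2 * t)); [apply Rmult_le_compat_l; lra|].
    assert (0 <= e2 * t) by (apply Rmult_le_pos; lra).
    apply Rle_trans with (e2 * (Cmod a + 1) * t); nra. }
  lra.
Qed.

Lemma is_Cderive_inv (z : C) : z <> RtoC 0 ->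
  is_Cderive (fun w => / w)%C z (- / (z * z))%C.
Proof.
  intros Hz. apply is_Cderive_eps. intros eps Heps.
  assert (Hm : 0 < Cmod z) by now apply Cmod_gt_0.
  set (m := Cmod z) in *.
  (* The remainder is (w - z)^2 / (w z^2). The first radius ensures |w| >= m / 2, the second makes
     |w - z| at most eps m^3 / 2. *)
  exists (Rmin (m / 2) (eps * (m * m * m) / 2)).
  assert (Hm3 : 0 < m * m * m) by (repeat apply Rmult_lt_0_compat; lra).
  split; [apply Rmin_pos; nra|].
  intros w Hw.
  assert (M1 := Rmin_l (m / 2) (eps * (m * m * m) / 2)).
  assert (M2 := Rmin_r (m / 2) (eps * (m * m * m) / 2)).
  assert (Hw2 : m / 2 <= Cmod w).
  { assert (H := Cmod_triangle_minus z w). rewrite Cmod_minus_sym in H. fold m in H. lra. }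
  assert (Hw0 : w <> RtoC 0) by (apply Cmod_gt_0; lra).
  replace (/ w - / z - - / (z * z) * (w - z))%C
    with ((w - z) * ((w - z) / (w * (z * z))))%C by (field; auto).
  rewrite Cmod_mult, Rmult_comm. apply Rmult_le_compat_r; [apply Cmod_ge_0|].
  rewrite Cmod_div, !Cmod_mult by (repeat apply Cmult_neq_0; auto). fold m.
  apply Rle_div_l; [nra|].
  apply Rle_trans with (eps * (m / 2 * (m * m))); [nra|].
  apply Rmult_le_compat_l; [lra|]. apply Rmult_le_compat_r; [nra|lra].
Qed.

Lemma ex_Cderive_const (a z : C) : ex_Cderive (fun _ => a) z.
Proof. eexists. apply is_Cderive_const. Qed.

Lemma ex_Cderive_id (z : C) : ex_Cderive (fun w => w) z.
Proof. eexists. apply is_Cderive_id. Qed.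

Lemma ex_Cderive_plus (f g : C -> C) (z : C) :
  ex_Cderive f z -> ex_Cderive g z -> ex_Cderive (fun w => f w + g w)%C z.
Proof. intros [a Ha] [b Hb]. eexists. apply is_Cderive_plus; eassumption. Qed.

Lemma ex_Cderive_minus (f g : C -> C) (z : C) :
  ex_Cderive f z -> ex_Cderive g z -> ex_Cderive (fun w => f w - g w)%C z.
Proof. intros [a Ha] [b Hb]. eexists. apply is_Cderive_minus; eassumption. Qed.

Lemma ex_Cderive_mult (f g : C -> C) (z : C) :
  ex_Cderive f z -> ex_Cderive g z -> ex_Cderive (fun w => f w * g w)%C z.
Proof. intros [a Ha] [b Hb]. eexists. apply is_Cderive_mult; eassumption. Qed.

Lemma ex_Cderive_comp (f g : C -> C) (z : C) :
  ex_Cderive f (g z) -> ex_Cderive g z -> ex_Cderive (fun w => f (g w)) z.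
Proof. intros [a Ha] [b Hb]. eexists. apply is_Cderive_comp; eassumption. Qed.

Lemma ex_Cderive_div (f g : C -> C) (z : C) : g z <> RtoC 0 ->
  ex_Cderive f z -> ex_Cderive g z -> ex_Cderive (fun w => f w / g w)%C z.
Proof.
  intros H0 Hf Hg. apply ex_Cderive_mult; [exact Hf|].
  apply (ex_Cderive_comp (fun w => / w)%C g); [|exact Hg].
  eexists. now apply is_Cderive_inv.
Qed.

Lemma ex_Cderive_pow (f : C -> C) (n : nat) (z : C) :
  ex_Cderive f z -> ex_Cderive (fun w => f w ^ n)%C z.
Proof.
  intros Hf. induction n as [|n IH]; simpl.
  - apply ex_Cderive_const.
  - now apply ex_Cderive_mult.
Qed.

Lemma analytic_at_ex_Cderive (f : C -> C) (p : C) : analytic_at f p -> ex_Cderive f p.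
Proof. intros H. exact (locally_singleton (T := C_UniformSpace) p _ H). Qed.

(** * Integrals of complex functions of a real variable *)

Local Notation Ccontinuous f x := (@continuous R_UniformSpace C_UniformSpace f x).

Lemma Ccontinuous_eps (f : R -> C) (x : R) :
  Ccontinuous f x <->
  forall eps, 0 < eps -> exists del, 0 < del /\
    forall t, Rabs (t - x) < del -> Cmod (f t - f x) < eps.
Proof.
  split.
  - intros H eps Heps.
    assert (HP : locally (T := C_UniformSpace) (f x) (fun z => Cmod (z - f x) < eps)).
    { apply locally_Cmod. exists eps; auto. }
    destruct (H _ HP) as [del Hdel].
    exists del. split; [apply cond_pos|]. intros t Ht. apply (Hdel t Ht).
  - intros H P HP. apply locally_Cmod in HP. destruct HP as (e & He & HP).
    destruct (H e He) as (del & Hdel & H').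
    exists (mkposreal _ Hdel). intros t Ht. apply HP, H', Ht.
Qed.

Lemma Ccontinuous_comp (f : C -> C) (g : R -> C) (x : R) :
  ex_Cderive f (g x) -> Ccontinuous g x -> Ccontinuous (fun t => f (g t)) x.
Proof.
  intros Hf Hg. rewrite Ccontinuous_eps in *. intros eps Heps.
  destruct (ex_Cderive_continuous f (g x) Hf eps Heps) as (d & Hd & H).
  destruct (Hg d Hd) as (d' & Hd' & H').
  exists d'. split; auto.
Qed.

Lemma Ccontinuous_affine (p q : C) (x : R) : Ccontinuous (fun t => p + q * RtoC t)%C x.
Proof.
  apply Ccontinuous_eps. intros eps Heps.
  assert (Hq := Cmod_ge_0 q).
  assert (He : 0 < eps / (Cmod q + 1)) by (apply Rdiv_lt_0_compat; lra).
  exists (eps / (Cmod q + 1)). split; [exact He|].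
  intros t Ht.
  replace (p + q * t - (p + q * x))%C with (q * RtoC (t - x))%C by (rewrite RtoC_minus; ring).
  rewrite Cmod_mult, Cmod_R.
  apply Rle_lt_trans with (Cmod q * (eps / (Cmod q + 1))).
  - apply Rmult_le_compat_l; lra.
  - replace (Cmod q * (eps / (Cmod q + 1))) with (eps - eps / (Cmod q + 1)) by (field; lra). lra.
Qed.

Lemma Ccontinuous_vertical (f : C -> C) (c x : R) :
  ex_Cderive f (c, x) -> Ccontinuous (fun t => f (c, t)) x.
Proof.
  intros H. apply (Ccontinuous_comp f (fun t => (c, t))); [exact H|].
  apply (continuous_ext (T := R_UniformSpace) (U := C_UniformSpace) (fun t : R => RtoC c + Ci * RtoC t)%C).
  - intros t. unfold Ci, RtoC, Cplus, Cmult; simpl. f_equal; ring.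
  - apply Ccontinuous_affine.
Qed.

Lemma Ccontinuous_horizontal (f : C -> C) (c x : R) :
  ex_Cderive f (x, c) -> Ccontinuous (fun t => f (t, c)) x.
Proof.
  intros H. apply (Ccontinuous_comp f (fun t => (t, c))); [exact H|].
  apply (continuous_ext (T := R_UniformSpace) (U := C_UniformSpace) (fun t : R => (0, c) + 1 * RtoC t)%C).
  - intros t. unfold Ci, RtoC, Cplus, Cmult; simpl. f_equal; ring.
  - apply Ccontinuous_affine.
Qed.

(** The passage from [C] as a module over itself, where holomorphy is stated, to [C] as a real
    module, where integrals are taken. The sides of a rectangle are the cases q = 1 and q = i. *)
Lemma is_derive_path (F : C -> C) (p q d : C) (x : R) :
  is_Cderive F (p + q * RtoC x)%C d ->
  is_derive (V := C_R_NormedModule) (fun t : R => F (p + q * RtoC t)%C) x (q * d)%C.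
Proof.
  intros H. rewrite is_Cderive_eps in H.
  split; [apply (is_linear_scal_l (V := C_R_NormedModule))|].
  intros y Hy eps.
  assert (E : x = y) by exact (is_filter_lim_locally_unique (V := R_NormedModule) x y Hy).
  subst y.
  assert (Hq := Cmod_ge_0 q).
  assert (He : 0 < eps / (Cmod q + 1)) by (apply Rdiv_lt_0_compat; [apply cond_pos|lra]).
  destruct (H _ He) as (del & Hdel & H').
  assert (Hdel' : 0 < del / (Cmod q + 1)) by (apply Rdiv_lt_0_compat; lra).
  exists (mkposreal _ Hdel'). intros t Ht.
  change (Rabs (t - x) < del / (Cmod q + 1)) in Ht.
  assert (E : (p + q * t - (p + q * x) = q * RtoC (t - x))%C) by (rewrite RtoC_minus; ring).
  assert (Hc : Cmod (p + q * t - (p + q * x)) <= Rabs (t - x) * (Cmod q + 1)).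
  { rewrite E, Cmod_mult, Cmod_R. assert (Ha := Rabs_pos (t - x)). nra. }
  assert (Hl : Cmod (p + q * t - (p + q * x)) < del).
  { eapply Rle_lt_trans; [exact Hc|]. apply Rlt_div_r; [lra|exact Ht]. }
  specialize (H' _ Hl).
  rewrite <- Cmod_norm.
  change (norm (minus t x)) with (Rabs (t - x)).
  match goal with |- Cmod ?u <= _ =>
    replace u with (F (p + q * t) - F (p + q * x) - d * (p + q * t - (p + q * x)))%C end.
  - eapply Rle_trans; [exact H'|].
    apply Rle_trans with (eps / (Cmod q + 1) * (Rabs (t - x) * (Cmod q + 1))).
    + apply Rmult_le_compat_l; lra.
    + apply Req_le. field. lra.
  - rewrite E.
    change (F (p + q * t) - F (p + q * x) - d * (q * RtoC (t - x)) =
            (F (p + q * t) - F (p + q * x)) - ((t - x) * fst (q * d)%C, (t - x) * snd (q * d)%C)%R)%C.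
    f_equal. f_equal. unfold RtoC, Cmult; simpl. f_equal; ring.
Qed.

Definition CInt (f : R -> C) (a b : R) : C := RInt (V := C_R_CompleteNormedModule) f a b.

Lemma ex_CInt (f : R -> C) (a b : R) : a <= b ->
  (forall x, a <= x <= b -> Ccontinuous f x) ->
  ex_RInt (V := C_R_CompleteNormedModule) f a b.
Proof.
  intros Hab H. apply (ex_RInt_continuous (V := C_R_CompleteNormedModule)).
  rewrite Rmin_left, Rmax_right by lra. exact H.
Qed.

Lemma CInt_correct (f : R -> C) (a b : R) : a <= b ->
  (forall x, a <= x <= b -> Ccontinuous f x) ->
  is_RInt (V := C_R_NormedModule) f a b (CInt f a b).
Proof.
  intros Hab H. apply (RInt_correct (V := C_R_CompleteNormedModule)). now apply ex_CInt.
Qed.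

Lemma CInt_unique (f : R -> C) (a b : R) (l : C) :
  is_RInt (V := C_R_NormedModule) f a b l -> CInt f a b = l.
Proof. apply (is_RInt_unique (V := C_R_CompleteNormedModule)). Qed.

Lemma CInt_ext (f g : R -> C) (a b : R) : a <= b ->
  (forall x, a <= x <= b -> f x = g x) -> CInt f a b = CInt g a b.
Proof.
  intros Hab H. apply (RInt_ext (V := C_R_CompleteNormedModule)).
  rewrite Rmin_left, Rmax_right by lra. intros x Hx. apply H. lra.
Qed.

Lemma CInt_minus (f g : R -> C) (a b : R) : a <= b ->
  (forall x, a <= x <= b -> Ccontinuous f x) ->
  (forall x, a <= x <= b -> Ccontinuous g x) ->
  CInt (fun x => f x - g x)%C a b = (CInt f a b - CInt g a b)%C.
Proof.
  intros Hab Hf Hg. apply (RInt_minus (V := C_R_CompleteNormedModule)); now apply ex_CInt.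
Qed.

(** Integration is linear over the reals only, so a complex factor is treated through the real and
    imaginary parts. *)
Lemma is_RInt_Cmult (f : R -> C) (k l : C) (a b : R) :
  is_RInt (V := C_R_NormedModule) f a b l ->
  is_RInt (V := C_R_NormedModule) (fun x => k * f x)%C a b (k * l)%C.
Proof.
  intros H.
  assert (H1 := is_RInt_fct_extend_fst (U := R_NormedModule) (V := R_NormedModule) f a b l H).
  assert (H2 := is_RInt_fct_extend_snd (U := R_NormedModule) (V := R_NormedModule) f a b l H).
  apply (is_RInt_fct_extend_pair (U := R_NormedModule) (V := R_NormedModule)).
  - apply (is_RInt_minus (V := R_NormedModule)); now apply (is_RInt_scal (V := R_NormedModule)).
  - apply (is_RInt_plus (V := R_NormedModule)); now apply (is_RInt_scal (V := R_NormedModule)).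
Qed.

Lemma CInt_mult (f : R -> C) (k : C) (a b : R) : a <= b ->
  (forall x, a <= x <= b -> Ccontinuous f x) ->
  CInt (fun x => k * f x)%C a b = (k * CInt f a b)%C.
Proof.
  intros Hab Hf. apply CInt_unique, is_RInt_Cmult. now apply CInt_correct.
Qed.

Lemma CInt_Chasles (f : R -> C) (a b c : R) : a <= b -> b <= c ->
  (forall x, a <= x <= c -> Ccontinuous f x) ->
  (CInt f a b + CInt f b c)%C = CInt f a c.
Proof.
  intros Hab Hbc Hf. apply (RInt_Chasles (V := C_R_CompleteNormedModule));
  apply ex_CInt; auto; intros x Hx; apply Hf; lra.
Qed.

Lemma Cmod_CInt_le (f : R -> C) (g : R -> R) (a b lg : R) : a <= b ->
  (forall x, a <= x <= b -> Ccontinuous f x) ->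
  (forall x, a <= x <= b -> Cmod (f x) <= g x) ->
  is_RInt g a b lg -> Cmod (CInt f a b) <= lg.
Proof.
  intros Hab Hf Hg Hl. rewrite Cmod_norm.
  apply (norm_RInt_le (V := C_R_NormedModule) f g a b); auto.
  - intros x Hx. rewrite <- Cmod_norm. now apply Hg.
  - now apply CInt_correct.
Qed.

Lemma Cmod_CInt_le_const (f : R -> C) (a b M : R) : a <= b ->
  (forall x, a <= x <= b -> Ccontinuous f x) ->
  (forall x, a <= x <= b -> Cmod (f x) <= M) ->
  Cmod (CInt f a b) <= (b - a) * M.
Proof.
  intros Hab Hf Hg. rewrite Cmod_norm.
  apply (norm_RInt_le_const (V := C_R_NormedModule) f a b); auto.
  - intros x Hx. rewrite <- Cmod_norm. now apply Hg.
  - now apply CInt_correct.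
Qed.

Lemma CInt_derive (F f : R -> C) (a b : R) : a <= b ->
  (forall x, a <= x <= b -> is_derive (V := C_R_NormedModule) F x (f x)) ->
  (forall x, a <= x <= b -> Ccontinuous f x) ->
  CInt f a b = (F b - F a)%C.
Proof.
  intros Hab HF Hf. apply CInt_unique.
  apply (is_RInt_derive (V := C_R_CompleteNormedModule));
  rewrite Rmin_left, Rmax_right by lra; assumption.
Qed.

Lemma CInt_vertical (F f : C -> C) (c a b : R) : a <= b ->
  (forall x, a <= x <= b -> is_Cderive F (c, x) (f (c, x))) ->
  (forall x, a <= x <= b -> ex_Cderive f (c, x)) ->
  (Ci * CInt (fun t => f (c, t)) a b = F (c, b) - F (c, a))%C.
Proof.
  intros Hab HF Hf.
  rewrite <- CInt_mult; [|exact Hab|intros; now apply Ccontinuous_vertical, Hf].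
  apply (CInt_derive (fun t => F (c, t))); auto.
  - intros x Hx.
    assert (E : forall t : R, (c, t) = (RtoC c + Ci * RtoC t)%C).
    { intros t. unfold Ci, RtoC, Cplus, Cmult; simpl. f_equal; ring. }
    apply (is_derive_ext (V := C_R_NormedModule) (fun t : R => F (RtoC c + Ci * RtoC t)%C)).
    + intros t. now rewrite <- E.
    + apply is_derive_path. rewrite <- E. now apply HF.
  - intros x Hx.
    apply (Ccontinuous_vertical (fun z => Ci * f z)%C).
    apply ex_Cderive_mult; [apply ex_Cderive_const|now apply Hf].
Qed.

Lemma CInt_horizontal (F f : C -> C) (c a b : R) : a <= b ->
  (forall x, a <= x <= b -> is_Cderive F (x, c) (f (x, c))) ->
  (forall x, a <= x <= b -> ex_Cderive f (x, c)) ->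
  (CInt (fun t => f (t, c)) a b = F (b, c) - F (a, c))%C.
Proof.
  intros Hab HF Hf.
  apply (CInt_derive (fun t => F (t, c))); auto.
  - intros x Hx.
    assert (E : forall t : R, (t, c) = ((0, c) + 1 * RtoC t)%C).
    { intros t. unfold Ci, RtoC, Cplus, Cmult; simpl. f_equal; ring. }
    apply (is_derive_ext (V := C_R_NormedModule) (fun t : R => F ((0, c) + 1 * RtoC t)%C)).
    + intros t. now rewrite <- E.
    + replace (f (x, c)) with (1 * f (x, c))%C by ring.
      apply is_derive_path. rewrite <- E. now apply HF.
  - intros x Hx. now apply Ccontinuous_horizontal, Hf.
Qed.

(** * The Cauchy-Goursat theorem on rectangles *)

Definition in_rect (a b c d : R) (z : C) : Prop := a <= fst z <= b /\ c <= snd z <= d.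

Definition on_rect (a b c d : R) (z : C) : Prop :=
  in_rect a b c d z /\ (fst z = a \/ fst z = b \/ snd z = c \/ snd z = d).

(** The contour integral along the boundary, counterclockwise from the lower left corner; dz = i dt
    gives the factor [Ci] on the vertical sides. *)
Definition rect_int (f : C -> C) (a b c d : R) : C :=
  (CInt (fun t => f (t, c)) a b + Ci * CInt (fun t => f (b, t)) c d
   - CInt (fun t => f (t, d)) a b - Ci * CInt (fun t => f (a, t)) c d)%C.

Ltac on_rect := unfold on_rect, in_rect in *; simpl in *; intuition lra.

Lemma rect_int_split_fst (f : C -> C) (a m b c d : R) : a <= m <= b -> c <= d ->
  (forall z, on_rect a b c d z -> ex_Cderive f z) ->
  rect_int f a b c d = (rect_int f a m c d + rect_int f m b c d)%C.
Proof.
  intros Hm Hcd Hf. unfold rect_int.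
  rewrite <- (CInt_Chasles (fun t => f (t, c)) a m b), <- (CInt_Chasles (fun t => f (t, d)) a m b);
    try lra; try (intros x Hx; apply Ccontinuous_horizontal, Hf; on_rect).
  ring.
Qed.

Lemma rect_int_split_snd (f : C -> C) (a b c m d : R) : a <= b -> c <= m <= d ->
  (forall z, on_rect a b c d z -> ex_Cderive f z) ->
  rect_int f a b c d = (rect_int f a b c m + rect_int f a b m d)%C.
Proof.
  intros Hab Hm Hf. unfold rect_int.
  rewrite <- (CInt_Chasles (fun t => f (a, t)) c m d), <- (CInt_Chasles (fun t => f (b, t)) c m d);
    try lra; try (intros x Hx; apply Ccontinuous_vertical, Hf; on_rect).
  ring.
Qed.

Lemma rect_int_minus (f g : C -> C) (a b c d : R) : a <= b -> c <= d ->
  (forall z, on_rect a b c d z -> ex_Cderive f z) ->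
  (forall z, on_rect a b c d z -> ex_Cderive g z) ->
  rect_int (fun z => f z - g z)%C a b c d = (rect_int f a b c d - rect_int g a b c d)%C.
Proof.
  intros Hab Hcd Hf Hg. unfold rect_int.
  rewrite !CInt_minus; try lra;
  try (intros x Hx; (apply Ccontinuous_vertical || apply Ccontinuous_horizontal); apply Hf; on_rect);
  try (intros x Hx; (apply Ccontinuous_vertical || apply Ccontinuous_horizontal); apply Hg; on_rect).
  ring.
Qed.

Lemma rect_int_mult (f : C -> C) (k : C) (a b c d : R) : a <= b -> c <= d ->
  (forall z, on_rect a b c d z -> ex_Cderive f z) ->
  rect_int (fun z => k * f z)%C a b c d = (k * rect_int f a b c d)%C.
Proof.
  intros Hab Hcd Hf. unfold rect_int.
  rewrite !CInt_mult; try lra;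
  try (intros x Hx; (apply Ccontinuous_vertical || apply Ccontinuous_horizontal); apply Hf; on_rect).
  ring.
Qed.

Lemma Cmod_rect_int_le (f : C -> C) (a b c d M : R) : a <= b -> c <= d ->
  (forall z, on_rect a b c d z -> ex_Cderive f z) ->
  (forall z, on_rect a b c d z -> Cmod (f z) <= M) ->
  Cmod (rect_int f a b c d) <= 2 * ((b - a) + (d - c)) * M.
Proof.
  intros Hab Hcd Hf HM. unfold rect_int, Cminus.
  eapply Rle_trans; [apply Cmod_triangle|].
  eapply Rle_trans; [apply Rplus_le_compat_r, Cmod_triangle|].
  eapply Rle_trans; [apply Rplus_le_compat_r, Rplus_le_compat_r, Cmod_triangle|].
  rewrite !Cmod_opp, !Cmod_mult, Cmod_Ci.
  assert (H1 : Cmod (CInt (fun t => f (t, c)) a b) <= (b - a) * M).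
  { apply Cmod_CInt_le_const; [lra|intros; apply Ccontinuous_horizontal, Hf; on_rect|
      intros; apply HM; on_rect]. }
  assert (H2 : Cmod (CInt (fun t => f (t, d)) a b) <= (b - a) * M).
  { apply Cmod_CInt_le_const; [lra|intros; apply Ccontinuous_horizontal, Hf; on_rect|
      intros; apply HM; on_rect]. }
  assert (H3 : Cmod (CInt (fun t => f (a, t)) c d) <= (d - c) * M).
  { apply Cmod_CInt_le_const; [lra|intros; apply Ccontinuous_vertical, Hf; on_rect|
      intros; apply HM; on_rect]. }
  assert (H4 : Cmod (CInt (fun t => f (b, t)) c d) <= (d - c) * M).
  { apply Cmod_CInt_le_const; [lra|intros; apply Ccontinuous_vertical, Hf; on_rect|
      intros; apply HM; on_rect]. }
  lra.
Qed.

Lemma rect_int_derive (F f : C -> C) (a b c d : R) : a <= b -> c <= d ->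
  (forall z, on_rect a b c d z -> is_Cderive F z (f z)) ->
  (forall z, on_rect a b c d z -> ex_Cderive f z) ->
  rect_int f a b c d = RtoC 0.
Proof.
  intros Hab Hcd HF Hf. unfold rect_int.
  rewrite (CInt_horizontal F f c), (CInt_horizontal F f d), (CInt_vertical F f a), (CInt_vertical F f b);
  try lra; try (intros; apply HF; on_rect); try (intros; apply Hf; on_rect).
  ring.
Qed.

(** Affine functions have a primitive. This disposes of the linear approximation that [goursat]
    subtracts. *)
Lemma rect_int_affine (w k l : C) (a b c d : R) : a <= b -> c <= d ->
  rect_int (fun z => k + l * (z - w))%C a b c d = RtoC 0.
Proof.
  intros Hab Hcd.
  apply (rect_int_derive (fun z => k * z + l * / 2 * ((z - w) * (z - w)))%C); auto; intros z _.
  - assert (H2 : RtoC 2 <> RtoC 0) by (intros E; apply RtoC_inj in E; lra).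
    assert (E : (k + l * (z - w) = (0 * z + k * 1) +
      (0 * ((z - w) * (z - w)) + l * / 2 * ((1 - 0) * (z - w) + (z - w) * (1 - 0))))%C)
      by (field; exact H2).
    rewrite E.
    assert (D : is_Cderive (fun z => z - w)%C z (1 - 0)%C)
      by (apply is_Cderive_minus; [apply is_Cderive_id|apply is_Cderive_const]).
    apply (is_Cderive_plus (fun z => k * z)%C (fun z => l * / 2 * ((z - w) * (z - w)))%C).
    + apply (is_Cderive_mult (fun _ => k)); [apply is_Cderive_const|apply is_Cderive_id].
    + apply (is_Cderive_mult (fun _ => l * / 2)%C (fun z => (z - w) * (z - w))%C); [apply is_Cderive_const|].
      now apply (is_Cderive_mult (fun z => z - w)%C (fun z => z - w)%C).
  - apply ex_Cderive_plus; [apply ex_Cderive_const|].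
    apply ex_Cderive_mult; [apply ex_Cderive_const|].
    apply ex_Cderive_minus; [apply ex_Cderive_id|apply ex_Cderive_const].
Qed.

(** The successor is chosen on all pairs (n, s) at once; where the invariant [Q] fails any value
    will do, hence the classical case distinction. It produces the nested rectangles of
    [goursat]. *)
Lemma dependent_choice_nat {T : Type} (Q : nat -> T -> Prop) (Rel : nat -> T -> T -> Prop) (s0 : T) :
  Q 0%nat s0 ->
  (forall n s, Q n s -> exists s', Q (S n) s' /\ Rel n s s') ->
  exists u : nat -> T, forall n, Q n (u n) /\ Rel n (u n) (u (S n)).
Proof.
  intros H0 HS.
  assert (H : forall p : nat * T, exists s', Q (fst p) (snd p) ->
              Q (S (fst p)) s' /\ Rel (fst p) (snd p) s').
  { intros [n s]. simpl.
    destruct (Classical_Prop.classic (Q n s)) as [Hq|Hq].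
    - destruct (HS n s Hq) as [s' Hs']. now exists s'.
    - exists s. intros H. contradiction. }
  destruct (functional_choice _ H) as [g Hg].
  set (u := fix u (n : nat) : T := match n with O => s0 | S m => g (m, u m) end).
  assert (Hu : forall n, Q n (u n)).
  { induction n as [|n IH]; [exact H0|]. exact (proj1 (Hg (n, u n) IH)). }
  exists u. intros n. split; [apply Hu|]. exact (proj2 (Hg (n, u n) (Hu n))).
Qed.

(** The common point is the supremum of the left ends. Applied to each coordinate, it locates the
    point on which nested rectangles close in. *)
Lemma nested_intervals (x w : nat -> R) :
  (forall n, 0 <= w n) ->
  (forall n, x n <= x (S n) /\ x (S n) + w (S n) <= x n + w n) ->
  exists X, forall n, x n <= X <= x n + w n.
Proof.
  intros Hw Hx.
  assert (Hup : forall k n, x n <= x (k + n)%nat).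
  { induction k as [|k IH]; intros n; simpl; [lra|].
    eapply Rle_trans; [apply IH|]. apply Hx. }
  assert (Hdn : forall k n, x (k + n)%nat + w (k + n)%nat <= x n + w n).
  { induction k as [|k IH]; intros n; simpl; [lra|].
    eapply Rle_trans; [apply Hx|]. apply IH. }
  assert (Hall : forall n m, x m <= x n + w n).
  { intros n m.
    apply Rle_trans with (x (n + m)%nat); [apply Hup|].
    specialize (Hdn m n). rewrite Nat.add_comm in Hdn. specialize (Hw (n + m)%nat). lra. }
  destruct (completeness (fun r => exists n, r = x n)) as [X [HX1 HX2]].
  - exists (x 0%nat + w 0%nat). intros r [n ->]. apply Hall.
  - exists (x 0%nat). now exists 0%nat.
  - exists X. intros n. split; [apply HX1; now exists n|].
    apply HX2. intros r [m ->]. apply Hall.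
Qed.

(** The integrals over the four quarters add up to the whole, so they cannot all have modulus below
    M / 4. *)
Lemma rect_int_quarter (f : C -> C) (x y w h M : R) : 0 <= w -> 0 <= h ->
  (forall z, in_rect x (x + w) y (y + h) z -> ex_Cderive f z) ->
  M <= Cmod (rect_int f x (x + w) y (y + h)) ->
  exists x' y', x <= x' <= x + w / 2 /\ y <= y' <= y + h / 2 /\
    M / 4 <= Cmod (rect_int f x' (x' + w / 2) y' (y' + h / 2)).
Proof.
  intros Hw Hh Hf HM.
  assert (E : rect_int f x (x + w) y (y + h) =
    (rect_int f x (x + w / 2) y (y + h / 2) + rect_int f x (x + w / 2) (y + h / 2) (y + h / 2 + h / 2)
    + (rect_int f (x + w / 2) (x + w / 2 + w / 2) y (y + h / 2)
    + rect_int f (x + w / 2) (x + w / 2 + w / 2) (y + h / 2) (y + h / 2 + h / 2)))%C).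
  { replace (x + w) with (x + w / 2 + w / 2) by lra.
    replace (y + h) with (y + h / 2 + h / 2) by lra.
    rewrite (rect_int_split_fst f x (x + w / 2)) by (try lra; intros; apply Hf; on_rect).
    f_equal; apply rect_int_split_snd; try lra; intros; apply Hf; on_rect. }
  rewrite E in HM.
  destruct (Rle_dec (M / 4) (Cmod (rect_int f x (x + w / 2) y (y + h / 2)))) as [H1|H1];
    [exists x, y; split; [lra|split; [lra|exact H1]]|].
  destruct (Rle_dec (M / 4) (Cmod (rect_int f x (x + w / 2) (y + h / 2) (y + h / 2 + h / 2)))) as [H2|H2];
    [exists x, (y + h / 2); split; [lra|split; [lra|exact H2]]|].
  destruct (Rle_dec (M / 4) (Cmod (rect_int f (x + w / 2) (x + w / 2 + w / 2) y (y + h / 2)))) as [H3|H3];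
    [exists (x + w / 2), y; split; [lra|split; [lra|exact H3]]|].
  exists (x + w / 2), (y + h / 2). split; [lra|split; [lra|]].
  apply Rnot_lt_le. intros H4.
  apply (Rle_not_lt _ _ HM).
  eapply Rle_lt_trans; [apply Cmod_triangle|].
  eapply Rle_lt_trans; [apply Rplus_le_compat; apply Cmod_triangle|]. lra.
Qed.

(** If the integral had modulus M > 0, repeated quartering would give rectangles with integral at
    least M / 4^n closing in on a point. Near that point f is affine up to eta |z - p|; the affine
    part integrates to 0, and the rest is at most perimeter times eta times diameter, also of order
    4^(-n) but with a factor eta as small as desired. *)
Lemma goursat (f : C -> C) (a b c d : R) : a <= b -> c <= d ->
  (forall z, in_rect a b c d z -> ex_Cderive f z) ->
  rect_int f a b c d = RtoC 0.
Proof.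
  intros Hab Hcd Hf.
  apply Cmod_eq_0.
  destruct (Req_dec (Cmod (rect_int f a b c d)) 0) as [H0|H0]; [exact H0|exfalso].
  set (M := Cmod (rect_int f a b c d)) in *.
  assert (HM : 0 < M).
  { assert (H := Cmod_ge_0 (rect_int f a b c d)). fold M in H. lra. }
  set (w := fun n => (b - a) / 2 ^ n). set (h := fun n => (d - c) / 2 ^ n).
  assert (H2n : forall n, 0 < 2 ^ n) by (intros; apply pow_lt; lra).
  assert (Hw : forall n, 0 <= w n).
  { intros n. unfold w. apply Rdiv_le_0_compat; [lra|apply H2n]. }
  assert (Hh : forall n, 0 <= h n).
  { intros n. unfold h. apply Rdiv_le_0_compat; [lra|apply H2n]. }
  assert (HwS : forall n, w (S n) = w n / 2).
  { intros n. unfold w. simpl. field. apply Rgt_not_eq, H2n. }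
  assert (HhS : forall n, h (S n) = h n / 2).
  { intros n. unfold h. simpl. field. apply Rgt_not_eq, H2n. }
  destruct (dependent_choice_nat
    (fun n (s : R * R) => (a <= fst s /\ fst s + w n <= b /\ c <= snd s /\ snd s + h n <= d) /\
      M / 4 ^ n <= Cmod (rect_int f (fst s) (fst s + w n) (snd s) (snd s + h n)))
    (fun n s s' => (fst s <= fst s' /\ fst s' + w (S n) <= fst s + w n) /\
                   (snd s <= snd s' /\ snd s' + h (S n) <= snd s + h n))
    (a, c)) as [u Hu].
  - assert (W0 : w 0%nat = b - a) by (unfold w; simpl; field).
    assert (H0' : h 0%nat = d - c) by (unfold h; simpl; field).
    simpl. rewrite W0, H0'.
    replace (a + (b - a)) with b by lra. replace (c + (d - c)) with d by lra.
    split; [lra|]. fold M. lra.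
  - intros n [x y] [Hin HMn]. simpl in *.
    destruct (rect_int_quarter f x y (w n) (h n) (M / 4 ^ n)) as (x' & y' & Hx' & Hy' & HM');
      auto.
    { intros z Hz. apply Hf. destruct Hz. split; lra. }
    exists (x', y'). simpl. rewrite HwS, HhS. split; [|lra].
    split; [lra|].
    replace (M / (4 * 4 ^ n)) with (M / 4 ^ n / 4) by (field; apply pow_nonzero; lra).
    exact HM'.
  - destruct (nested_intervals (fun n => fst (u n)) w Hw (fun n => proj1 (proj2 (Hu n)))) as [X HX].
    destruct (nested_intervals (fun n => snd (u n)) h Hh (fun n => proj2 (proj2 (Hu n)))) as [Y HY].
    assert (Hin : in_rect a b c d (X, Y)).
    { destruct (Hu 0%nat) as [[Hq _] _]. specialize (HX 0%nat). specialize (HY 0%nat).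
      split; simpl; lra. }
    destruct (Hf _ Hin) as [l Hl]. rewrite is_Cderive_eps in Hl.
    (* [D] is half the perimeter and bounds the diameter, so at stage n the error is at most 2 D^2
       eta / 4^n. With eta = M / (2 D^2 + 1) this is less than M / 4^n; the added 1 makes the
       inequality strict and covers D = 0. *)
    set (D := (b - a) + (d - c)).
    assert (HD : 0 <= D) by (unfold D; lra).
    assert (Heta : 0 < M / (2 * (D * D) + 1)) by (apply Rdiv_lt_0_compat; nra).
    destruct (Hl _ Heta) as (del & Hdel & Hlin).
    assert (Hex : exists n, D / 2 ^ n < del).
    { destruct (pow_lt_1_zero (/ 2)) with (y := del / (D + 1)) as [N HN].
      - rewrite Rabs_pos_eq; lra.
      - apply Rdiv_lt_0_compat; lra.
      - exists N. specialize (HN N (Nat.le_refl _)).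
        rewrite Rabs_pos_eq in HN by (apply pow_le; lra).
        apply (Rmult_lt_compat_r (D + 1)) in HN; [|lra].
        unfold Rdiv in HN. rewrite Rmult_assoc, Rinv_l in HN by lra.
        rewrite pow_inv in HN. unfold Rdiv.
        assert (0 < / 2 ^ N) by (apply Rinv_0_lt_compat, H2n). nra. }
    destruct Hex as [n Hn].
    destruct (Hu n) as [[Hq HMn] _]. specialize (HX n). specialize (HY n). simpl in HX, HY.
    set (x := fst (u n)) in *. set (y := snd (u n)) in *.
    assert (HDn : w n + h n = D / 2 ^ n).
    { unfold w, h, D. field. apply Rgt_not_eq, H2n. }
    set (g := fun z => (f (X, Y) + l * (z - (X, Y)))%C).
    assert (Hg : forall z, ex_Cderive g z).
    { intros z. apply ex_Cderive_plus; [apply ex_Cderive_const|].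
      apply ex_Cderive_mult; [apply ex_Cderive_const|].
      apply ex_Cderive_minus; [apply ex_Cderive_id|apply ex_Cderive_const]. }
    assert (Hfr : forall z, on_rect x (x + w n) y (y + h n) z -> ex_Cderive f z).
    { intros z [[Hz1 Hz2] _]. apply Hf. split; lra. }
    specialize (Hw n). specialize (Hh n).
    assert (E : rect_int (fun z => f z - g z)%C x (x + w n) y (y + h n)
                = rect_int f x (x + w n) y (y + h n)).
    { rewrite rect_int_minus; try lra; auto.
      unfold g. rewrite rect_int_affine by lra. ring. }
    rewrite <- E in HMn.
    assert (B := Cmod_rect_int_le (fun z => f z - g z)%C x (x + w n) y (y + h n)
       (M / (2 * (D * D) + 1) * (D / 2 ^ n)) ltac:(lra) ltac:(lra)).
    assert (B' := Rle_trans _ _ _ HMn (B ltac:(intros z Hz; apply ex_Cderive_minus; auto)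
      ltac:(intros z [[Hz1 Hz2] _];
        assert (Hzd : Cmod (z - (X, Y)) <= D / 2 ^ n);
        [ rewrite <- HDn; eapply Rle_trans; [apply Cmod_le_Rabs|]; simpl;
          apply Rplus_le_compat; apply Rabs_le; lra
        | unfold g; replace (f z - (f (X, Y) + l * (z - (X, Y))))%C with
            (f z - f (X, Y) - l * (z - (X, Y)))%C by ring;
          eapply Rle_trans; [apply Hlin; lra|]; apply Rmult_le_compat_l; lra ]))).
    replace (x + w n - x + (y + h n - y)) with (D / 2 ^ n) in B' by lra.
    assert (H4 : 4 ^ n = 2 ^ n * 2 ^ n) by (rewrite <- Rpow_mult_distr; f_equal; lra).
    rewrite H4 in B'. specialize (H2n n).
    assert (B2 : M * (2 * (D * D) + 1) <= 2 * (D * D) * M).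
    { apply (Rmult_le_compat_r (2 ^ n * 2 ^ n * (2 * (D * D) + 1))) in B'; [|nra].
      replace (M / (2 ^ n * 2 ^ n) * (2 ^ n * 2 ^ n * (2 * (D * D) + 1)))
        with (M * (2 * (D * D) + 1)) in B' by (field; lra).
      replace (2 * (D / 2 ^ n) * (M / (2 * (D * D) + 1) * (D / 2 ^ n)) *
        (2 ^ n * 2 ^ n * (2 * (D * D) + 1))) with (2 * (D * D) * M) in B'
        by (field; split; nra).
      exact B'. }
    lra.
Qed.

(** * Exponential and logarithm *)

Lemma Cexp_plus (z w : C) : Cexp (z + w) = (Cexp z * Cexp w)%C.
Proof.
  destruct z as [a b], w as [c d]. unfold Cexp, Cmult, Cplus; simpl.
  rewrite exp_plus, cos_plus, sin_plus. f_equal; ring.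
Qed.

Lemma Cexp_RtoC (x : R) : Cexp (RtoC x) = RtoC (exp x).
Proof. unfold Cexp, RtoC; simpl. rewrite cos_0, sin_0. f_equal; ring. Qed.

Lemma Cexp_0 : Cexp (RtoC 0) = RtoC 1.
Proof. now rewrite Cexp_RtoC, exp_0. Qed.

Lemma Cmod_Cexp (z : C) : Cmod (Cexp z) = exp (fst z).
Proof.
  destruct z as [a b]. unfold Cexp, Cmod; simpl.
  replace (exp a * cos b * (exp a * cos b * 1) + exp a * sin b * (exp a * sin b * 1))
    with ((exp a) ^ 2 * ((sin b)² + (cos b)²)) by (unfold Rsqr; ring).
  rewrite sin2_cos2, Rmult_1_r.
  replace (exp a ^ 2) with ((exp a)²) by (unfold Rsqr; ring).
  apply sqrt_Rsqr, Rlt_le, exp_pos.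
Qed.

(** The integral of z e^(tz) over [0, 1]. Both bounds on e^z that follow, of first and of second
    order, come from it without a power series. *)
Lemma is_RInt_Cexp (z : C) :
  is_RInt (V := C_R_NormedModule) (fun t : R => z * Cexp (RtoC t * z))%C 0 1 (Cexp z - 1)%C.
Proof.
  destruct z as [a b].
  replace (Cexp (a, b) - 1)%C with
    ((exp (1 * a) * cos (1 * b) - exp (0 * a) * cos (0 * b),
      exp (1 * a) * sin (1 * b) - exp (0 * a) * sin (0 * b)) : C).
  2:{ unfold Cexp, Cminus, Cplus, Copp, RtoC; simpl.
      rewrite !Rmult_0_l, !Rmult_1_l, exp_0, cos_0, sin_0. f_equal; ring. }
  apply (is_RInt_fct_extend_pair (U := R_NormedModule) (V := R_NormedModule)).
  - apply (is_RInt_derive (V := R_CompleteNormedModule) (fun t => exp (t * a) * cos (t * b))).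
    + intros t _. auto_derive; [trivial|].
      unfold Cexp, RtoC, Cmult; simpl. replace (t * a - 0 * b) with (t * a) by ring.
      replace (t * b + 0 * a) with (t * b) by ring. ring.
    + intros t _. apply (ex_derive_continuous (V := R_NormedModule)).
      unfold Cexp, RtoC, Cmult; simpl. auto_derive; trivial.
  - apply (is_RInt_derive (V := R_CompleteNormedModule) (fun t => exp (t * a) * sin (t * b))).
    + intros t _. auto_derive; [trivial|].
      unfold Cexp, RtoC, Cmult; simpl. replace (t * a - 0 * b) with (t * a) by ring.
      replace (t * b + 0 * a) with (t * b) by ring. ring.
    + intros t _. apply (ex_derive_continuous (V := R_NormedModule)).
      unfold Cexp, RtoC, Cmult; simpl. auto_derive; trivial.
Qed.

Lemma exp_le (x y : R) : x <= y -> exp x <= exp y.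
Proof. intros [H|H]; [now apply Rlt_le, exp_increasing|subst; lra]. Qed.

Lemma Cmod_RtoC_mult_le (t : R) (z : C) : 0 <= t <= 1 -> Cmod (RtoC t * z) <= Cmod z.
Proof.
  intros Ht. rewrite Cmod_mult, Cmod_R, Rabs_pos_eq by lra.
  assert (H := Cmod_ge_0 z). nra.
Qed.

Lemma fst_le_Cmod (z : C) : fst z <= Cmod z.
Proof. eapply Rle_trans; [apply Rle_abs|apply Rabs_fst_le_Cmod]. Qed.

Lemma Cmod_Cexp_minus_1_le (z : C) : Cmod (Cexp z - 1) <= Cmod z * exp (Cmod z).
Proof.
  rewrite (Cmod_norm (Cexp z - 1)).
  replace (Cmod z * exp (Cmod z)) with ((1 - 0) * (Cmod z * exp (Cmod z))) by ring.
  eapply (norm_RInt_le_const (V := C_R_NormedModule)); [lra| |apply is_RInt_Cexp].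
  intros t Ht. rewrite <- Cmod_norm, Cmod_mult, Cmod_Cexp.
  apply Rmult_le_compat_l; [apply Cmod_ge_0|].
  apply exp_le. eapply Rle_trans; [apply fst_le_Cmod|now apply Cmod_RtoC_mult_le].
Qed.

Lemma Cmod_Cexp_taylor_le (z : C) : Cmod (Cexp z - 1 - z) <= Cmod z * Cmod z * exp (Cmod z).
Proof.
  assert (H : is_RInt (V := C_R_NormedModule)
    (fun t : R => z * Cexp (RtoC t * z) - z)%C 0 1 (Cexp z - 1 - z)%C).
  { apply (is_RInt_minus (V := C_R_NormedModule)); [apply is_RInt_Cexp|].
    assert (H := is_RInt_const (V := C_R_NormedModule) 0 1 z).
    rewrite Rminus_0_r in H.
    exact (eq_ind _ (is_RInt (V := C_R_NormedModule) _ 0 1) H _ (scal_one (V := C_R_NormedModule) z)). }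
  rewrite (Cmod_norm (Cexp z - 1 - z)).
  replace (Cmod z * Cmod z * exp (Cmod z)) with ((1 - 0) * (Cmod z * Cmod z * exp (Cmod z))) by ring.
  eapply (norm_RInt_le_const (V := C_R_NormedModule)); [lra| |exact H].
  intros t Ht. rewrite <- Cmod_norm.
  replace (z * Cexp (t * z) - z)%C with (z * (Cexp (t * z) - 1))%C by ring.
  rewrite Cmod_mult, Rmult_assoc. apply Rmult_le_compat_l; [apply Cmod_ge_0|].
  eapply Rle_trans; [apply Cmod_Cexp_minus_1_le|].
  assert (Hz := Cmod_RtoC_mult_le t z Ht).
  apply Rmult_le_compat; [apply Cmod_ge_0|apply Rlt_le, exp_pos|exact Hz|now apply exp_le].
Qed.

Lemma is_Cderive_Cexp (z : C) : is_Cderive Cexp z (Cexp z).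
Proof.
  apply is_Cderive_eps. intros eps Heps.
  assert (He := exp_pos (fst z)). assert (He1 := exp_pos 1).
  set (q := exp (fst z) * exp 1).
  assert (Hq : 0 < q) by (unfold q; nra).
  assert (Hd : 0 < eps / q) by now apply Rdiv_lt_0_compat.
  exists (Rmin 1 (eps / q)). split; [apply Rmin_pos; lra|].
  intros w Hw.
  assert (H1 := Rmin_l 1 (eps / q)). assert (H2 := Rmin_r 1 (eps / q)).
  assert (E : Cexp w = (Cexp z * Cexp (w - z))%C).
  { rewrite <- Cexp_plus. f_equal. ring. }
  rewrite E.
  replace (Cexp z * Cexp (w - z) - Cexp z - Cexp z * (w - z))%C
    with (Cexp z * (Cexp (w - z) - 1 - (w - z)))%C by ring.
  rewrite Cmod_mult, Cmod_Cexp.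
  set (k := (w - z)%C) in *. assert (Hk := Cmod_ge_0 k).
  apply Rle_trans with (exp (fst z) * (Cmod k * Cmod k * exp 1)).
  - apply Rmult_le_compat_l; [lra|].
    eapply Rle_trans; [apply Cmod_Cexp_taylor_le|].
    apply Rmult_le_compat_l; [nra|]. apply exp_le. lra.
  - replace (exp (fst z) * (Cmod k * Cmod k * exp 1)) with (q * Cmod k * Cmod k) by (unfold q; ring).
    apply Rmult_le_compat_r; [lra|].
    apply Rle_trans with (q * (eps / q)); [apply Rmult_le_compat_l; lra|].
    apply Req_le. field. lra.
Qed.

Lemma ex_Cderive_Cexp (f : C -> C) (z : C) : ex_Cderive f z -> ex_Cderive (fun w => Cexp (f w)) z.
Proof.
  intros H. apply (ex_Cderive_comp Cexp f); [eexists; apply is_Cderive_Cexp|exact H].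
Qed.

(* The principal logarithm on the right half-plane only. *)
Definition Clog (z : C) : C := (ln (Cmod z), atan (snd z / fst z)).

Lemma Cexp_Clog (z : C) : 0 < fst z -> Cexp (Clog z) = z.
Proof.
  destruct z as [x y]; simpl. intros Hx. unfold Cexp, Clog; simpl.
  assert (Hs : Cmod (x, y) = x * sqrt (1 + (y / x)²)).
  { unfold Cmod; simpl.
    replace (x * (x * 1) + y * (y * 1)) with (x² * (1 + (y / x)²)) by (unfold Rsqr; field; lra).
    rewrite sqrt_mult; [|apply Rle_0_sqr|assert (H := Rle_0_sqr (y / x)); lra].
    rewrite sqrt_Rsqr by lra. reflexivity. }
  assert (Hp : 0 < sqrt (1 + (y / x)²)).
  { apply sqrt_lt_R0. assert (H := Rle_0_sqr (y / x)). lra. }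
  rewrite Hs, exp_ln by (apply Rmult_lt_0_compat; lra).
  rewrite cos_atan, sin_atan. f_equal; field; lra.
Qed.

Lemma Clog_RtoC (x : R) : 0 < x -> Clog (RtoC x) = RtoC (ln x).
Proof.
  intros Hx. unfold Clog. rewrite Cmod_R, Rabs_pos_eq by lra.
  unfold RtoC; simpl. f_equal. replace (0 / x) with 0 by (field; lra). apply atan_0.
Qed.

(** Continuity is proved componentwise; together with [Cexp_Clog] it is all that the derivative of
    the logarithm needs. *)
Lemma Clog_continuous (z : C) : 0 < fst z ->
  forall eps, 0 < eps -> exists del, 0 < del /\
    forall w, Cmod (w - z) < del -> Cmod (Clog w - Clog z) < eps.
Proof.
  intros Hz.
  assert (H : continuous (T := C_UniformSpace) (U := C_UniformSpace) Clog z).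
  { destruct z as [x y]. simpl in Hz.
    assert (H1 : continuous (T := C_UniformSpace) (U := R_UniformSpace) (fun z => ln (Cmod z)) (x, y)).
    { apply (continuous_comp (U := C_UniformSpace) (V := R_UniformSpace) (W := R_UniformSpace) Cmod ln).
      - intros P [e He]. apply locally_Cmod. exists e. split; [apply cond_pos|].
        intros w Hw. apply He. change (Rabs (Cmod w - Cmod (x, y)) < e).
        eapply Rle_lt_trans; [|exact Hw].
        apply Rabs_le. assert (A := Cmod_triangle_minus w (x, y)).
        assert (B := Cmod_triangle_minus (x, y) w). rewrite Cmod_minus_sym in B. lra.
      - apply continuous_ln. assert (A := fst_le_Cmod (x, y)). simpl in A. lra. }
    assert (H2 : continuous (T := C_UniformSpace) (U := R_UniformSpace) (fun z => atan (snd z / fst z)) (x, y)).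
    { apply (continuous_comp (U := C_UniformSpace) (V := R_UniformSpace) (W := R_UniformSpace)
        (fun z => snd z / fst z) atan); [|apply continuous_atan].
      apply (continuous_mult (U := C_UniformSpace) (K := R_AbsRing) (fun z => snd z) (fun z => / fst z)).
      - apply (continuous_snd (U := R_UniformSpace) (V := R_UniformSpace)).
      - apply (continuous_comp (U := C_UniformSpace) (V := R_UniformSpace) (W := R_UniformSpace) fst Rinv).
        + apply (continuous_fst (U := R_UniformSpace) (V := R_UniformSpace)).
        + apply continuous_Rinv. simpl. lra. }
    intros P [e He].
    assert (L1 := H1 _ (locally_ball (T := R_UniformSpace) _ e)).
    assert (L2 := H2 _ (locally_ball (T := R_UniformSpace) _ e)).
    destruct L1 as [e1 L1], L2 as [e2 L2].
    exists (mkposreal _ (Rmin_pos _ _ (cond_pos e1) (cond_pos e2))).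
    intros w Hw. apply He. split.
    - apply L1. exact (ball_le (M := C_UniformSpace) _ _ _ (Rmin_l e1 e2) _ Hw).
    - apply L2. exact (ball_le (M := C_UniformSpace) _ _ _ (Rmin_r e1 e2) _ Hw). }
  intros eps Heps.
  assert (HP : locally (T := C_UniformSpace) (Clog z) (fun w => Cmod (w - Clog z) < eps)).
  { apply locally_Cmod. exists eps; auto. }
  apply H in HP. apply locally_Cmod in HP. exact HP.
Qed.

(** The derivative of an inverse function. The bound [kappa] on |k| forces |e^k - 1| >= |k| / 2, so
    that the remainder, of order |k|^2, is small compared with |w - z| = |z| |e^k - 1|. *)
Lemma is_Cderive_Clog (z : C) : 0 < fst z -> is_Cderive Clog z (/ z)%C.
Proof.
  intros Hz.
  assert (Hz0 : z <> RtoC 0).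
  { intros E. rewrite E in Hz. simpl in Hz. lra. }
  assert (Hm : 0 < Cmod z) by now apply Cmod_gt_0.
  apply is_Cderive_eps. intros eps Heps.
  assert (He1 := exp_pos 1).
  (* Compare w - z = z (e^k - 1) with k = Clog w - Clog z. *)
  set (kappa := Rmin 1 (Rmin (/ (2 * exp 1)) (eps * Cmod z / (2 * exp 1)))).
  assert (K1 : kappa <= 1) by apply Rmin_l.
  assert (K2 : kappa * exp 1 <= / 2).
  { apply Rle_trans with (/ (2 * exp 1) * exp 1).
    - apply Rmult_le_compat_r; [lra|]. eapply Rle_trans; [apply Rmin_r|apply Rmin_l].
    - apply Req_le. field. lra. }
  assert (K3 : kappa * exp 1 <= eps * Cmod z / 2).
  { apply Rle_trans with (eps * Cmod z / (2 * exp 1) * exp 1).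
    - apply Rmult_le_compat_r; [lra|]. eapply Rle_trans; [apply Rmin_r|apply Rmin_r].
    - apply Req_le. field. lra. }
  assert (K0 : 0 < kappa).
  { repeat apply Rmin_pos; [lra|apply Rinv_0_lt_compat; lra|].
    apply Rdiv_lt_0_compat; [apply Rmult_lt_0_compat|]; lra. }
  destruct (Clog_continuous z Hz kappa K0) as (d1 & D1 & H1).
  exists (Rmin d1 (fst z)). split; [now apply Rmin_pos|].
  intros w Hw.
  assert (M1 := Rmin_l d1 (fst z)). assert (M2 := Rmin_r d1 (fst z)).
  specialize (H1 w ltac:(lra)).
  assert (Hw0 : 0 < fst w).
  { assert (A := Rabs_fst_le_Cmod (w - z)). unfold Cminus in A; simpl in A.
    assert (B := Rle_abs (- (fst w + - fst z))). rewrite Rabs_Ropp in B.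
    unfold Cminus in Hw. lra. }
  set (k := (Clog w - Clog z)%C) in *.
  assert (E : (w - z = z * (Cexp k - 1))%C).
  { rewrite <- (Cexp_Clog w Hw0) at 1. replace (Clog w) with (Clog z + k)%C by (unfold k; ring).
    rewrite Cexp_plus, Cexp_Clog by exact Hz. ring. }
  rewrite E.
  replace (k - / z * (z * (Cexp k - 1)))%C with (- (Cexp k - 1 - k))%C by (field; exact Hz0).
  rewrite Cmod_opp, Cmod_mult.
  assert (T : Cmod (Cexp k - 1 - k) <= Cmod k * Cmod k * exp 1).
  { eapply Rle_trans; [apply Cmod_Cexp_taylor_le|].
    assert (Hk := Cmod_ge_0 k). apply Rmult_le_compat_l; [nra|]. apply exp_le. lra. }
  assert (Hk := Cmod_ge_0 k).
  assert (T1 : Cmod k * Cmod k * exp 1 <= Cmod k * (kappa * exp 1)).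
  { rewrite Rmult_assoc. apply Rmult_le_compat_l; [lra|]. apply Rmult_le_compat_r; lra. }
  assert (T2 : Cmod k / 2 <= Cmod (Cexp k - 1)).
  { assert (A := Cmod_triangle_minus k (k - (Cexp k - 1))).
    replace (k - (k - (Cexp k - 1)))%C with (Cexp k - 1)%C in A by ring.
    rewrite Cmod_minus_sym in A.
    assert (Cmod k * (kappa * exp 1) <= Cmod k * / 2) by (apply Rmult_le_compat_l; lra). lra. }
  apply Rle_trans with (Cmod k * (eps * Cmod z / 2)).
  - eapply Rle_trans; [exact T|]. eapply Rle_trans; [exact T1|].
    apply Rmult_le_compat_l; lra.
  - assert (0 < eps * Cmod z) by (apply Rmult_lt_0_compat; lra). nra.
Qed.

(** * The residue theorem on rectangles *)

Lemma C_neq_fst (z w : C) : fst z <> fst w -> z <> w.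
Proof. intros H E. now rewrite E in H. Qed.

Lemma C_neq_snd (z w : C) : snd z <> snd w -> z <> w.
Proof. intros H E. now rewrite E in H. Qed.

Lemma Cminus_neq_0 (z w : C) : z <> w -> (z - w)%C <> RtoC 0.
Proof.
  intros H E. apply H. replace z with ((z - w) + w)%C by ring. rewrite E. ring.
Qed.

(** Removability of a singularity in integral form. The rectangle is cut into a small square around
    p and four rectangles on which [goursat] applies. On the boundary of the square of half-side
    eta, |f| is at most (eps / 8) / eta, against a perimeter of 8 eta. *)
Lemma rect_int_shrink (f : C -> C) (p : C) (a b c d : R) :
  a < fst p < b -> c < snd p < d ->
  (forall z, in_rect a b c d z -> z <> p -> ex_Cderive f z) ->
  (forall eps, 0 < eps -> exists del, 0 < del /\
     forall z, z <> p -> Cmod (z - p) < del -> Cmod ((z - p) * f z) <= eps) ->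
  rect_int f a b c d = RtoC 0.
Proof.
  destruct p as [x y]; simpl. intros Hx Hy Hf Hp.
  assert (Hsq : forall eta, 0 < eta -> a < x - eta -> x + eta < b -> c < y - eta -> y + eta < d ->
    rect_int f a b c d = rect_int f (x - eta) (x + eta) (y - eta) (y + eta)).
  { intros eta He H1 H2 H3 H4.
    assert (Hf1 : forall z : C, fst z <> x \/ snd z <> y -> in_rect a b c d z -> ex_Cderive f z).
    { intros z [Hz|Hz] Hin; apply Hf; try exact Hin;
      [apply C_neq_fst|apply C_neq_snd]; exact Hz. }
    rewrite (rect_int_split_fst f a (x - eta) b), (rect_int_split_fst f (x - eta) (x + eta) b);
      try lra; try (intros [u v] Hz; apply Hf1; on_rect).
    rewrite (rect_int_split_snd f (x - eta) (x + eta) c (y - eta) d),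
            (rect_int_split_snd f (x - eta) (x + eta) (y - eta) (y + eta) d);
      try lra; try (intros [u v] Hz; apply Hf1; on_rect).
    rewrite (goursat f a (x - eta)), (goursat f (x + eta) b),
            (goursat f _ _ c (y - eta)), (goursat f _ _ (y + eta) d);
      try lra; try (intros [u v] Hz; apply Hf1; on_rect).
    ring. }
  apply Cmod_eq_0, Rle_antisym; [|apply Cmod_ge_0].
  apply le_epsilon. intros eps Heps. rewrite Rplus_0_l.
  destruct (Hp (eps / 8) ltac:(lra)) as (del & Hdel & H).
  set (m := Rmin (Rmin (x - a) (b - x)) (Rmin (Rmin (y - c) (d - y)) del)).
  assert (Hm : 0 < m) by (unfold m; repeat apply Rmin_pos; lra).
  assert (M1 : m <= x - a) by (unfold m; eapply Rle_trans; [apply Rmin_l|apply Rmin_l]).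
  assert (M2 : m <= b - x) by (unfold m; eapply Rle_trans; [apply Rmin_l|apply Rmin_r]).
  assert (M3 : m <= y - c).
  { unfold m. eapply Rle_trans; [apply Rmin_r|]. eapply Rle_trans; [apply Rmin_l|apply Rmin_l]. }
  assert (M4 : m <= d - y).
  { unfold m. eapply Rle_trans; [apply Rmin_r|]. eapply Rle_trans; [apply Rmin_l|apply Rmin_r]. }
  assert (M5 : m <= del) by (unfold m; eapply Rle_trans; [apply Rmin_r|apply Rmin_r]).
  (* The square has to lie inside the rectangle and its corners, at distance at most 2 eta from p,
     inside the disc of radius [del]. *)
  set (eta := m / 3). assert (Heta : m = 3 * eta) by (unfold eta; lra).
  rewrite (Hsq eta) by lra.
  replace eps with (2 * ((x + eta - (x - eta)) + (y + eta - (y - eta))) * (eps / 8 / eta))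
    by (field; lra).
  assert (Hon : forall z, on_rect (x - eta) (x + eta) (y - eta) (y + eta) z ->
     in_rect a b c d z /\ z <> (x, y) /\ eta <= Cmod (z - (x, y)) < del).
  { intros [u v] [[Hu Hv] Hb]. simpl in *. split; [split; simpl; lra|].
    assert (A1 := Rabs_fst_le_Cmod ((u, v) - (x, y))).
    assert (A2 := Rabs_snd_le_Cmod ((u, v) - (x, y))).
    assert (A3 := Cmod_le_Rabs ((u, v) - (x, y))).
    unfold Cminus in *; simpl in *.
    assert (B1 : Rabs (u + - x) <= eta) by (apply Rabs_le; lra).
    assert (B2 : Rabs (v + - y) <= eta) by (apply Rabs_le; lra).
    assert (B3 : eta <= Cmod ((u, v) + - (x, y))).
    { destruct Hb as [Hb|[Hb|[Hb|Hb]]]; rewrite Hb in A1, A2 |- *;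
      unfold Rabs in A1, A2; repeat destruct Rcase_abs in A1; repeat destruct Rcase_abs in A2; lra. }
    split; [|lra].
    intros E. rewrite E in B3. replace ((x, y) + - (x, y))%C with (RtoC 0) in B3 by ring.
    rewrite Cmod_0 in B3. lra. }
  apply Cmod_rect_int_le; try lra.
  - intros z Hz. apply Hon in Hz. now apply Hf.
  - intros z Hz. apply Hon in Hz. destruct Hz as (_ & Hz & Hz1 & Hz2).
    specialize (H z Hz Hz2). rewrite Cmod_mult in H.
    apply Rle_div_r; [lra|].
    assert (Hf0 := Cmod_ge_0 (f z)). nra.
Qed.

(** On each side Clog(k (z - p)) is a primitive, where k = i, 1, -i, -1 turns the bottom, right, top
    and left side into the right half-plane. As |k| = 1, the real parts agree at the corners and
    cancel around the rectangle; the arguments add up to 2 pi. *)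
Lemma rect_int_inv (p : C) (a b c d : R) :
  a < fst p < b -> c < snd p < d ->
  rect_int (fun z => / (z - p))%C a b c d = (2 * PI * Ci)%C.
Proof.
  destruct p as [x y]; simpl. intros Hx Hy. unfold rect_int.
  assert (HD : forall k z : C, k <> RtoC 0 -> 0 < fst (k * (z - (x, y)))%C ->
    is_Cderive (fun w => Clog (k * (w - (x, y)))%C) z (/ (z - (x, y)))%C).
  { intros k z Hk Hpos.
    assert (Hz : (z - (x, y))%C <> RtoC 0).
    { intros E. rewrite E in Hpos. rewrite Cmult_0_r in Hpos. simpl in Hpos. lra. }
    replace (/ (z - (x, y)))%C with (/ (k * (z - (x, y))) * (0 * (z - (x, y)) + k * (1 - 0)))%C
      by (field; auto).
    apply (is_Cderive_comp Clog (fun w => k * (w - (x, y)))%C).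
    - now apply is_Cderive_Clog.
    - apply (is_Cderive_mult (fun _ => k) (fun w => w - (x, y))%C); [apply is_Cderive_const|].
      apply is_Cderive_minus; [apply is_Cderive_id|apply is_Cderive_const]. }
  assert (HE : forall z : C, z <> (x, y) -> ex_Cderive (fun z => / (z - (x, y)))%C z).
  { intros z Hz. apply (ex_Cderive_comp (fun w => / w)%C (fun z => z - (x, y))%C).
    - eexists. apply is_Cderive_inv. now apply Cminus_neq_0.
    - apply ex_Cderive_minus; [apply ex_Cderive_id|apply ex_Cderive_const]. }
  assert (HCi : Ci <> RtoC 0) by (apply C_neq_snd; simpl; lra).
  assert (HCi' : (- Ci)%C <> RtoC 0) by (apply C_neq_snd; simpl; lra).
  assert (H1 : RtoC 1 <> RtoC 0) by (apply C_neq_fst; simpl; lra).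
  assert (H1' : (- (1))%C <> RtoC 0) by (apply C_neq_fst; simpl; lra).
  rewrite (CInt_horizontal (fun w => Clog (Ci * (w - (x, y)))%C) (fun z => / (z - (x, y)))%C c);
    try lra; try (intros; apply HE, C_neq_snd; simpl; lra);
    [|intros; apply HD; [assumption|simpl; lra]].
  rewrite (CInt_horizontal (fun w => Clog (- Ci * (w - (x, y)))%C) (fun z => / (z - (x, y)))%C d);
    try lra; try (intros; apply HE, C_neq_snd; simpl; lra);
    [|intros; apply HD; [assumption|simpl; lra]].
  rewrite (CInt_vertical (fun w => Clog (1 * (w - (x, y)))%C) (fun z => / (z - (x, y)))%C b);
    try lra; try (intros; apply HE, C_neq_fst; simpl; lra);
    [|intros; apply HD; [assumption|simpl; lra]].
  rewrite (CInt_vertical (fun w => Clog (- (1) * (w - (x, y)))%C) (fun z => / (z - (x, y)))%C a);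
    try lra; try (intros; apply HE, C_neq_fst; simpl; lra);
    [|intros; apply HD; [assumption|simpl; lra]].
  assert (HM : forall k : C, Cmod k = 1 -> forall z : C, Cmod (k * z) = Cmod z).
  { intros k Hk z. rewrite Cmod_mult, Hk. ring. }
  assert (K1 : Cmod (- Ci) = 1) by (rewrite Cmod_opp; apply Cmod_Ci).
  unfold Clog.
  rewrite !(HM Ci Cmod_Ci), !(HM (- Ci)%C K1), !(HM 1%C Cmod_1), !(HM (- (1))%C Cmod_m1).
  (* Each corner is seen from its two sides under complementary angles, so each of the four corners
     contributes pi / 2. *)
  assert (T : forall s t, 0 < s -> 0 < t -> atan (s / t) = PI / 2 - atan (t / s)).
  { intros s t Hs Ht. replace (s / t) with (/ (t / s)) by (field; lra).
    apply atan_inv. now apply Rdiv_lt_0_compat. }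
  unfold Ci, Cminus, Cplus, Copp, Cmult, RtoC; simpl. f_equal; [ring|].
  replace ((0 * (c + - y) + 1 * (b + - x)) / (0 * (b + - x) - 1 * (c + - y)))
    with ((b - x) / (y - c)) by (field; lra).
  replace ((0 * (c + - y) + 1 * (a + - x)) / (0 * (a + - x) - 1 * (c + - y)))
    with (- ((x - a) / (y - c))) by (field; lra).
  replace ((1 * (d + - y) + 0 * (b + - x)) / (1 * (b + - x) - 0 * (d + - y)))
    with ((d - y) / (b - x)) by (field; lra).
  replace ((1 * (c + - y) + 0 * (b + - x)) / (1 * (b + - x) - 0 * (c + - y)))
    with (- ((y - c) / (b - x))) by (field; lra).
  replace ((- 0 * (d + - y) + - (1) * (b + - x)) / (- 0 * (b + - x) - - (1) * (d + - y)))
    with (- ((b - x) / (d - y))) by (field; lra).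
  replace ((- 0 * (d + - y) + - (1) * (a + - x)) / (- 0 * (a + - x) - - (1) * (d + - y)))
    with ((x - a) / (d - y)) by (field; lra).
  replace ((- (1) * (d + - y) + - 0 * (a + - x)) / (- (1) * (a + - x) - - 0 * (d + - y)))
    with (- ((d - y) / (x - a))) by (field; lra).
  replace ((- (1) * (c + - y) + - 0 * (a + - x)) / (- (1) * (a + - x) - - 0 * (c + - y)))
    with ((y - c) / (x - a)) by (field; lra).
  rewrite !atan_opp.
  rewrite (T (d - y) (b - x)), (T (y - c) (b - x)), (T (d - y) (x - a)), (T (y - c) (x - a)) by lra.
  field.
Qed.

(** Subtracting r / (z - p) leaves a function for which (z - p) f(z) tends to 0, and its integral
    vanishes by [rect_int_shrink]. The hypothesis is only a limit, so p may be a regular point. *)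
Lemma residue_rect (f : C -> C) (p r : C) (a b c d : R) :
  a < fst p < b -> c < snd p < d ->
  (forall z, in_rect a b c d z -> z <> p -> ex_Cderive f z) ->
  (forall eps, 0 < eps -> exists del, 0 < del /\
     forall z, z <> p -> Cmod (z - p) < del -> Cmod ((z - p) * f z - r) <= eps) ->
  rect_int f a b c d = (2 * PI * Ci * r)%C.
Proof.
  intros Hx Hy Hf Hp.
  assert (HE : forall z : C, z <> p -> ex_Cderive (fun z => / (z - p))%C z).
  { intros z Hz. apply (ex_Cderive_comp (fun w => / w)%C (fun z => z - p)%C).
    - eexists. apply is_Cderive_inv. now apply Cminus_neq_0.
    - apply ex_Cderive_minus; [apply ex_Cderive_id|apply ex_Cderive_const]. }
  assert (Hon : forall z, on_rect a b c d z -> in_rect a b c d z /\ z <> p).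
  { intros z [Hin Hb]. split; [exact Hin|].
    destruct Hb as [Hb|[Hb|[Hb|Hb]]];
      [apply C_neq_fst|apply C_neq_fst|apply C_neq_snd|apply C_neq_snd]; lra. }
  assert (H0 : rect_int (fun z => f z - r * / (z - p))%C a b c d = RtoC 0).
  { apply (rect_int_shrink _ p); auto.
    - intros z Hin Hz. apply ex_Cderive_minus; [now apply Hf|].
      apply ex_Cderive_mult; [apply ex_Cderive_const|now apply HE].
    - intros eps Heps. destruct (Hp eps Heps) as (del & Hdel & H).
      exists del. split; [exact Hdel|]. intros z Hz Hzd.
      replace ((z - p) * (f z - r * / (z - p)))%C with ((z - p) * f z - r)%C; [now apply H|].
      field. now apply Cminus_neq_0. }
  rewrite rect_int_minus in H0; try lra.
  - rewrite rect_int_mult, rect_int_inv in H0; try lra; auto.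
    + replace (rect_int f a b c d) with (rect_int f a b c d - r * (2 * PI * Ci) + r * (2 * PI * Ci))%C
        by ring. rewrite H0. ring.
    + intros z Hz. now apply HE, Hon.
  - intros z Hz. apply Hon in Hz. now apply Hf.
  - intros z Hz. apply Hon in Hz.
    apply ex_Cderive_mult; [apply ex_Cderive_const|now apply HE].
Qed.

(** * Integrals over vertical lines *)

Definition is_Clim_seq (u : nat -> C) (l : C) : Prop :=
  is_lim_seq (fun n => Cmod (u n - l)) 0.

Lemma is_lim_seq_squeeze_0 (u v : nat -> R) :
  (forall n, 0 <= u n <= v n) -> is_lim_seq v 0 -> is_lim_seq u 0.
Proof.
  intros H Hv. apply (is_lim_seq_le_le (fun _ => 0) u v); auto. apply is_lim_seq_const.
Qed.

Lemma is_lim_seq_plus_0 (u v : nat -> R) :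
  is_lim_seq u 0 -> is_lim_seq v 0 -> is_lim_seq (fun n => u n + v n) 0.
Proof.
  intros Hu Hv. replace (Finite 0) with (Finite (0 + 0)) by (f_equal; ring).
  now apply is_lim_seq_plus'.
Qed.

Lemma is_lim_seq_mult_0 (u : nat -> R) (k : R) :
  is_lim_seq u 0 -> is_lim_seq (fun n => k * u n) 0.
Proof.
  intros Hu. replace (Finite 0) with (Rbar_mult k 0) by (simpl; f_equal; ring).
  now apply is_lim_seq_scal_l.
Qed.

Lemma le_0_of_lim (a : R) (v : nat -> R) (N : nat) :
  (forall n, (N <= n)%nat -> a <= v n) -> is_lim_seq v 0 -> a <= 0.
Proof.
  intros H Hv.
  apply (is_lim_seq_le_loc (fun _ => a) v a 0).
  - exists N. exact H.
  - apply is_lim_seq_const.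
  - exact Hv.
Qed.

Lemma is_Clim_seq_unique (u : nat -> C) (l l' : C) :
  is_Clim_seq u l -> is_Clim_seq u l' -> l = l'.
Proof.
  intros H H'.
  assert (E : Cmod (l - l') <= 0).
  { apply (le_0_of_lim _ (fun n => Cmod (u n - l) + Cmod (u n - l')) 0).
    - intros n _. rewrite (Cmod_minus_sym (u n) l).
      replace (l - l')%C with ((l - u n) + (u n - l'))%C by ring. apply Cmod_triangle.
    - now apply is_lim_seq_plus_0. }
  assert (E' : (l - l')%C = RtoC 0).
  { apply Cmod_eq_0. apply Rle_antisym; [exact E|apply Cmod_ge_0]. }
  replace l with ((l - l') + l')%C by ring. rewrite E'. ring.
Qed.

Lemma is_Clim_seq_ext (u v : nat -> C) (l : C) :
  (forall n, u n = v n) -> is_Clim_seq u l -> is_Clim_seq v l.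
Proof. intros E. apply is_lim_seq_ext. intros n. now rewrite E. Qed.

Lemma is_Clim_seq_mult (u : nat -> C) (k l : C) :
  is_Clim_seq u l -> is_Clim_seq (fun n => k * u n)%C (k * l)%C.
Proof.
  intros H. apply (is_lim_seq_ext (fun n => Cmod k * Cmod (u n - l))).
  - intros n. rewrite <- Cmod_mult. f_equal. ring.
  - now apply is_lim_seq_mult_0.
Qed.

Lemma is_Clim_seq_minus (u v : nat -> C) (l m : C) :
  is_Clim_seq u l -> is_Clim_seq v m -> is_Clim_seq (fun n => u n - v n)%C (l - m)%C.
Proof.
  intros Hu Hv. eapply is_lim_seq_squeeze_0; [|exact (is_lim_seq_plus_0 _ _ Hu Hv)].
  intros n. split; [apply Cmod_ge_0|].
  replace (u n - v n - (l - m))%C with ((u n - l) + - (v n - m))%C by ring.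
  eapply Rle_trans; [apply Cmod_triangle|]. rewrite Cmod_opp. lra.
Qed.

Lemma Cmod_lim_le (u : nat -> C) (l : C) (M : R) :
  (forall n, Cmod (u n) <= M) -> is_Clim_seq u l -> Cmod l <= M.
Proof.
  intros H Hl.
  assert (E : Cmod l - M <= 0); [|lra].
  apply (le_0_of_lim _ _ 0) with (2 := Hl). intros n _.
  assert (A := Cmod_triangle_minus l (u n)). rewrite Cmod_minus_sym in A.
  specialize (H n). lra.
Qed.

(* The componentwise limit; a junk value when [u] diverges. *)
Definition CLim (u : nat -> C) : C :=
  (real (Lim_seq (fun n => fst (u n))), real (Lim_seq (fun n => snd (u n)))).

(** The Cauchy property comes with an explicit rate [e]: the tail of an integral or the remainder of
    a convergent series. *)
Lemma CLim_cauchy (u : nat -> C) (e : nat -> R) :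
  is_lim_seq e 0 -> (forall n k, Cmod (u (n + k)%nat - u n) <= e n) ->
  is_Clim_seq u (CLim u).
Proof.
  intros He H.
  assert (Hc : forall (pr : C -> R), (forall z w, Rabs (pr z - pr w) <= Cmod (z - w)) ->
    is_lim_seq (fun n => pr (u n)) (real (Lim_seq (fun n => pr (u n))))).
  { intros pr Hpr.
    assert (Hex : ex_finite_lim_seq (fun n => pr (u n))).
    { apply ex_lim_seq_cauchy_corr. intros eps.
      apply is_lim_seq_spec in He. destruct (He (pos_div_2 eps)) as [N HN].
      assert (HN' : forall n, (N <= n)%nat -> Rabs (pr (u n) - pr (u N)) < eps / 2).
      { intros n Hn. eapply Rle_lt_trans; [apply Hpr|].
        replace n with (N + (n - N))%nat by lia.
        eapply Rle_lt_trans; [apply H|].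
        specialize (HN N (Nat.le_refl _)). simpl in HN. rewrite Rminus_0_r in HN.
        eapply Rle_lt_trans; [apply Rle_abs|exact HN]. }
      exists N. intros n m Hn Hm.
      replace (pr (u n) - pr (u m)) with ((pr (u n) - pr (u N)) - (pr (u m) - pr (u N))) by ring.
      eapply Rle_lt_trans; [apply Rabs_triang|]. rewrite Rabs_Ropp.
      specialize (HN' n Hn) as A. specialize (HN' m Hm). lra. }
    destruct Hex as [l Hl]. rewrite (is_lim_seq_unique _ _ Hl). exact Hl. }
  assert (H1 := Hc fst (fun z w => Rabs_fst_le_Cmod (z - w))).
  assert (H2 := Hc snd (fun z w => Rabs_snd_le_Cmod (z - w))).
  assert (Ha : forall (v : nat -> R) (l : R), is_lim_seq v l -> is_lim_seq (fun n => Rabs (v n - l)) 0).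
  { intros v l Hv. apply (is_lim_seq_abs_0 (fun n => v n - l)).
    replace (Finite 0) with (Finite (l - l)) by (f_equal; ring).
    apply is_lim_seq_minus'; [exact Hv|apply is_lim_seq_const]. }
  eapply is_lim_seq_squeeze_0; [|exact (is_lim_seq_plus_0 _ _ (Ha _ _ H1) (Ha _ _ H2))].
  intros n. split; [apply Cmod_ge_0|].
  apply (Cmod_le_Rabs (u n - CLim u)).
Qed.

Lemma CLim_unique (u : nat -> C) (l : C) : is_Clim_seq u l -> CLim u = l.
Proof.
  intros H.
  assert (Hc : forall (pr : C -> R), (forall z w, Rabs (pr z - pr w) <= Cmod (z - w)) ->
    real (Lim_seq (fun n => pr (u n))) = pr l).
  { intros pr Hpr.
    assert (L : is_lim_seq (fun n => pr (u n)) (pr l)); [|now rewrite (is_lim_seq_unique _ _ L)].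
    replace (Finite (pr l)) with (Finite (0 + pr l)) by (f_equal; ring).
    apply (is_lim_seq_ext (fun n => (pr (u n) - pr l) + pr l)); [intros; ring|].
    apply is_lim_seq_plus'; [|apply is_lim_seq_const].
    apply is_lim_seq_abs_0. apply (is_lim_seq_squeeze_0 _ (fun n => Cmod (u n - l))); [|exact H].
    intros n. split; [apply Rabs_pos|apply Hpr]. }
  unfold CLim.
  rewrite (Hc fst (fun z w => Rabs_fst_le_Cmod (z - w))), (Hc snd (fun z w => Rabs_snd_le_Cmod (z - w))).
  now destruct l.
Qed.

Lemma is_lim_seq_exp_opp (kappa : R) : 0 < kappa ->
  is_lim_seq (fun n => exp (- kappa * INR n)) 0.
Proof.
  intros Hk. apply (is_lim_seq_ext (fun n => (exp (- kappa)) ^ n)).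
  - intros n. induction n as [|n IH].
    + simpl. rewrite Rmult_0_r, exp_0. reflexivity.
    + rewrite S_INR. change (exp (- kappa) ^ S n) with (exp (- kappa) * exp (- kappa) ^ n).
      rewrite IH, <- exp_plus. f_equal. ring.
  - apply is_lim_seq_geom. rewrite Rabs_pos_eq by (apply Rlt_le, exp_pos).
    rewrite <- exp_0. apply exp_increasing. lra.
Qed.

(* The integral over the vertical line Re z = c with respect to the imaginary
   part, as a symmetric limit; the factor dz = i dw is left out. *)
Definition line_sum (f : C -> C) (c : R) (n : nat) : C :=
  CInt (fun w => f (c, w)) (- INR n) (INR n).

Definition line_int (f : C -> C) (c : R) : C := CLim (line_sum f c).

Lemma line_sum_ext (f g : C -> C) (c : R) (n : nat) :
  (forall w, f (c, w) = g (c, w)) -> line_sum f c n = line_sum g c n.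
Proof.
  intros H. assert (Hn := pos_INR n). apply CInt_ext; [lra|]. intros w _. apply H.
Qed.

Lemma line_sum_minus (f g : C -> C) (c : R) (n : nat) :
  (forall w, ex_Cderive f (c, w)) -> (forall w, ex_Cderive g (c, w)) ->
  line_sum (fun z => f z - g z)%C c n = (line_sum f c n - line_sum g c n)%C.
Proof.
  intros Hf Hg. assert (Hn := pos_INR n).
  apply CInt_minus; [lra| |]; intros w _; now apply Ccontinuous_vertical.
Qed.

Lemma line_sum_mult (f : C -> C) (k : C) (c : R) (n : nat) :
  (forall w, ex_Cderive f (c, w)) ->
  line_sum (fun z => k * f z)%C c n = (k * line_sum f c n)%C.
Proof.
  intros Hf. assert (Hn := pos_INR n).
  apply CInt_mult; [lra|]. intros w _. now apply Ccontinuous_vertical.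
Qed.

(** Each of the two tails is compared with the integral of M e^(-kappa |w|), which is computed by an
    explicit primitive. The bound does not depend on k. *)
Lemma line_sum_diff (f : C -> C) (c M kappa : R) : 0 < kappa -> 0 <= M ->
  (forall w, ex_Cderive f (c, w)) ->
  (forall w, Cmod (f (c, w)) <= M * exp (- kappa * Rabs w)) ->
  forall n k, Cmod (line_sum f c (n + k) - line_sum f c n) <= 2 * M / kappa * exp (- kappa * INR n).
Proof.
  intros Hk HM Hf Hb n k. unfold line_sum.
  assert (Hn := pos_INR n). assert (Hk0 := pos_INR k).
  assert (Hnk : INR n <= INR (n + k)) by (rewrite plus_INR; lra).
  assert (Hc : forall w, Ccontinuous (fun w => f (c, w)) w) by (intros; now apply Ccontinuous_vertical).
  rewrite <- (CInt_Chasles _ (- INR (n + k)) (- INR n)), <- (CInt_Chasles _ (- INR n) (INR n));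
    try lra; auto.
  replace (CInt (fun w : R => f (c, w)) (- INR (n + k)) (- INR n) +
    (CInt (fun w : R => f (c, w)) (- INR n) (INR n) + CInt (fun w : R => f (c, w)) (INR n) (INR (n + k))) -
    CInt (fun w : R => f (c, w)) (- INR n) (INR n))%C with
    (CInt (fun w : R => f (c, w)) (- INR (n + k)) (- INR n) +
     CInt (fun w : R => f (c, w)) (INR n) (INR (n + k)))%C by ring.
  eapply Rle_trans; [apply Cmod_triangle|].
  assert (HE := exp_pos (- kappa * INR (n + k))).
  assert (HE' : 0 <= M / kappa * exp (- kappa * INR (n + k))).
  { apply Rmult_le_pos; [apply Rdiv_le_0_compat; lra|lra]. }
  assert (L1 : Cmod (CInt (fun w : R => f (c, w)) (- INR (n + k)) (- INR n)) <=
    M / kappa * exp (- kappa * INR n) - M / kappa * exp (- kappa * INR (n + k))).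
  { apply (Cmod_CInt_le _ (fun w => M * exp (kappa * w))); try lra; auto.
    - intros w Hw. eapply Rle_trans; [apply Hb|].
      rewrite Rabs_left1 by lra. apply Req_le. do 2 f_equal. ring.
    - replace (M / kappa * exp (- kappa * INR n) - M / kappa * exp (- kappa * INR (n + k))) with
        (minus (M / kappa * exp (kappa * - INR n)) (M / kappa * exp (kappa * - INR (n + k)))).
      2:{ unfold minus, plus, opp; simpl. replace (kappa * - INR n) with (- kappa * INR n) by ring.
          replace (kappa * - INR (n + k)) with (- kappa * INR (n + k)) by ring. ring. }
      apply (is_RInt_derive (V := R_CompleteNormedModule) (fun w => M / kappa * exp (kappa * w))).
      + intros w _. auto_derive; [trivial|]. field. lra.
      + intros w _. apply (ex_derive_continuous (V := R_NormedModule)). auto_derive; trivial. }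
  assert (L2 : Cmod (CInt (fun w : R => f (c, w)) (INR n) (INR (n + k))) <=
    M / kappa * exp (- kappa * INR n) - M / kappa * exp (- kappa * INR (n + k))).
  { apply (Cmod_CInt_le _ (fun w => M * exp (- kappa * w))); try lra; auto.
    - intros w Hw. eapply Rle_trans; [apply Hb|].
      rewrite Rabs_pos_eq by lra. lra.
    - replace (M / kappa * exp (- kappa * INR n) - M / kappa * exp (- kappa * INR (n + k))) with
        (minus (- (M / kappa) * exp (- kappa * INR (n + k))) (- (M / kappa) * exp (- kappa * INR n))).
      2:{ unfold minus, plus, opp; simpl. ring. }
      apply (is_RInt_derive (V := R_CompleteNormedModule) (fun w => - (M / kappa) * exp (- kappa * w))).
      + intros w _. auto_derive; [trivial|]. field. lra.
      + intros w _. apply (ex_derive_continuous (V := R_NormedModule)). auto_derive; trivial. }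
  replace (2 * M / kappa * exp (- kappa * INR n)) with
    (M / kappa * exp (- kappa * INR n) + M / kappa * exp (- kappa * INR n)) by (field; lra).
  lra.
Qed.

Lemma Cmod_line_sum_le (f : C -> C) (c M kappa : R) : 0 < kappa -> 0 <= M ->
  (forall w, ex_Cderive f (c, w)) ->
  (forall w, Cmod (f (c, w)) <= M * exp (- kappa * Rabs w)) ->
  forall n, Cmod (line_sum f c n) <= 2 * M / kappa.
Proof.
  intros Hk HM Hf Hb n.
  (* The truncation at height 0 is an integral over a degenerate interval, so the difference from it
     bounds every truncation. *)
  assert (H := line_sum_diff f c M kappa Hk HM Hf Hb 0 n).
  assert (E : line_sum f c 0 = RtoC 0).
  { apply Cmod_eq_0, Rle_antisym; [|apply Cmod_ge_0]. unfold line_sum. simpl.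
    replace 0 with ((0 - - 0) * M) at 3 by ring.
    apply Cmod_CInt_le_const; [lra|intros; now apply Ccontinuous_vertical|].
    intros x Hx. eapply Rle_trans; [apply Hb|].
    replace x with 0 by lra. rewrite Rabs_R0, Rmult_0_r, exp_0. lra. }
  rewrite E in H. simpl in H. rewrite Rmult_0_r, exp_0, Rmult_1_r in H.
  replace (line_sum f c n - 0)%C with (line_sum f c n) in H by ring. exact H.
Qed.

Lemma line_int_correct (f : C -> C) (c M kappa : R) : 0 < kappa -> 0 <= M ->
  (forall w, ex_Cderive f (c, w)) ->
  (forall w, Cmod (f (c, w)) <= M * exp (- kappa * Rabs w)) ->
  is_Clim_seq (line_sum f c) (line_int f c).
Proof.
  intros Hk HM Hf Hb.
  apply (CLim_cauchy _ (fun n => 2 * M / kappa * exp (- kappa * INR n))).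
  - apply is_lim_seq_mult_0, is_lim_seq_exp_opp, Hk.
  - now apply line_sum_diff.
Qed.

Lemma Cmod_line_int_le (f : C -> C) (c M kappa : R) : 0 < kappa -> 0 <= M ->
  (forall w, ex_Cderive f (c, w)) ->
  (forall w, Cmod (f (c, w)) <= M * exp (- kappa * Rabs w)) ->
  Cmod (line_int f c) <= 2 * M / kappa.
Proof.
  intros Hk HM Hf Hb.
  apply (Cmod_lim_le (line_sum f c)); [now apply Cmod_line_sum_le|now apply (line_int_correct f c M kappa)].
Qed.

Lemma line_int_ext (f g : C -> C) (c : R) :
  (forall w, f (c, w) = g (c, w)) -> line_int f c = line_int g c.
Proof.
  intros H. unfold line_int, CLim.
  assert (E := fun n => line_sum_ext f g c n H).
  rewrite (Lim_seq_ext (fun n => fst (line_sum f c n)) (fun n => fst (line_sum g c n))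
    (fun n => f_equal fst (E n))).
  rewrite (Lim_seq_ext (fun n => snd (line_sum f c n)) (fun n => snd (line_sum g c n))
    (fun n => f_equal snd (E n))).
  reflexivity.
Qed.

Lemma line_int_mult (f : C -> C) (k : C) (c M kappa : R) : 0 < kappa -> 0 <= M ->
  (forall w, ex_Cderive f (c, w)) ->
  (forall w, Cmod (f (c, w)) <= M * exp (- kappa * Rabs w)) ->
  line_int (fun z => k * f z)%C c = (k * line_int f c)%C.
Proof.
  intros Hk HM Hf Hb. apply CLim_unique.
  apply (is_Clim_seq_ext (fun n => k * line_sum f c n)%C).
  - intros n. symmetry. now apply line_sum_mult.
  - apply is_Clim_seq_mult. now apply (line_int_correct f c M kappa).
Qed.

(** The residue theorem on [a, b] x [-n, n] as n grows: the horizontal sides die out exponentially.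
    The decay is asked for only from height [W] on, because f may be unbounded near p. Since
    [line_sum] leaves out the i of dz, the constant is 2 pi instead of 2 pi i. *)
Lemma residue_strip (f : C -> C) (p r la lb : C) (a b M kappa : R) (W : R) :
  0 < kappa -> a < fst p < b ->
  (forall z, a <= fst z <= b -> z <> p -> ex_Cderive f z) ->
  (forall eps, 0 < eps -> exists del, 0 < del /\
     forall z, z <> p -> Cmod (z - p) < del -> Cmod ((z - p) * f z - r) <= eps) ->
  (forall z, a <= fst z <= b -> W <= Rabs (snd z) -> Cmod (f z) <= M * exp (- kappa * Rabs (snd z))) ->
  is_Clim_seq (line_sum f a) la -> is_Clim_seq (line_sum f b) lb ->
  (lb - la = 2 * PI * r)%C.
Proof.
  intros Hk Hp Hf Hr Hb Ha Hlb.
  (* Beyond [N] the rectangle contains p in its interior and its horizontal sides lie where the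
     decay holds. *)
  destruct (INR_unbounded (Rmax W (Rabs (snd p) + 1))) as [N HN].
  assert (HN1 := Rmax_l W (Rabs (snd p) + 1)). assert (HN2 := Rmax_r W (Rabs (snd p) + 1)).
  assert (E : Cmod (lb - la - 2 * PI * r) <= 0).
  { apply (le_0_of_lim _ (fun n => (Cmod (line_sum f a n - la) + Cmod (line_sum f b n - lb))
      + 2 * (b - a) * M * exp (- kappa * INR n)) N).
    - intros n Hn. apply le_INR in Hn.
      assert (Hpn : - INR n < snd p < INR n).
      { assert (A := Rle_abs (snd p)). assert (B := Rle_abs (- snd p)). rewrite Rabs_Ropp in B. lra. }
      assert (HR := residue_rect f p r a b (- INR n) (INR n) Hp Hpn
        (fun z Hz => Hf z (proj1 Hz)) Hr).
      unfold rect_int in HR.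
      fold (line_sum f a n) (line_sum f b n) in HR.
      set (B := CInt (fun t => f (t, - INR n)) a b) in *.
      set (T := CInt (fun t => f (t, INR n)) a b) in *.
      assert (HS : forall y, Rabs y = INR n ->
        Cmod (CInt (fun t => f (t, y)) a b) <= (b - a) * (M * exp (- kappa * INR n))).
      { intros y Hy. apply Cmod_CInt_le_const; [lra| |].
        - intros x Hx. apply Ccontinuous_horizontal, Hf; [exact Hx|].
          apply C_neq_snd. simpl. intros E. rewrite E in Hy. lra.
        - intros x Hx. rewrite <- Hy. apply (Hb (x, y)); [exact Hx|simpl; rewrite Hy; lra]. }
      assert (HB : Cmod B <= (b - a) * (M * exp (- kappa * INR n))).
      { apply HS. rewrite Rabs_Ropp. apply Rabs_pos_eq, pos_INR. }
      assert (HT : Cmod T <= (b - a) * (M * exp (- kappa * INR n))).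
      { apply HS. apply Rabs_pos_eq, pos_INR. }
      assert (Hi : (Ci * Ci = - (1))%C) by (unfold Ci, Cmult, Copp, RtoC; simpl; f_equal; ring).
      assert (E : (2 * PI * r = (line_sum f b n - line_sum f a n) - Ci * (B - T))%C).
      { replace (2 * PI * r)%C with (- (Ci * Ci) * (2 * PI * r))%C by (rewrite Hi; ring).
        replace (- (Ci * Ci) * (2 * PI * r))%C with (- Ci * (2 * PI * Ci * r))%C by ring.
        rewrite <- HR.
        replace (- Ci * (B + Ci * line_sum f b n - T - Ci * line_sum f a n))%C
          with (- (Ci * Ci) * (line_sum f b n - line_sum f a n) - Ci * (B - T))%C by ring.
        rewrite Hi. ring. }
      rewrite E.
      replace (lb - la - (line_sum f b n - line_sum f a n - Ci * (B - T)))%C with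
        ((line_sum f a n - la) + - (line_sum f b n - lb) + Ci * (B + - T))%C by ring.
      eapply Rle_trans; [apply Cmod_triangle|].
      rewrite Cmod_mult, Cmod_Ci, Rmult_1_l.
      assert (A1 := Cmod_triangle (line_sum f a n - la) (- (line_sum f b n - lb))).
      assert (A2 := Cmod_triangle B (- T)).
      rewrite Cmod_opp in A1, A2. lra.
    - apply is_lim_seq_plus_0; [now apply is_lim_seq_plus_0|].
      now apply is_lim_seq_mult_0, is_lim_seq_exp_opp. }
  assert (E' : (lb - la - 2 * PI * r)%C = RtoC 0).
  { apply Cmod_eq_0, Rle_antisym; [exact E|apply Cmod_ge_0]. }
  replace (lb - la)%C with ((lb - la - 2 * PI * r) + 2 * PI * r)%C by ring. rewrite E'. ring.
Qed.

(** A quadratic remainder bound that is uniform in n survives the limit. This replaces theorems on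
    differentiation of limits, for truncated integrals as well as for partial sums. *)
Lemma is_Cderive_Clim_seq (D : nat -> C -> C) (D' : nat -> C) (F : C -> C) (y l : C) (eta M : R) :
  0 < eta ->
  (forall h, Cmod h < eta -> is_Clim_seq (fun n => D n (y + h)%C) (F (y + h)%C)) ->
  is_Clim_seq D' l ->
  (forall n h, Cmod h < eta -> Cmod (D n (y + h)%C - D n y - D' n * h) <= M * (Cmod h * Cmod h)) ->
  is_Cderive F y l.
Proof.
  intros Heta HF HD' HR.
  apply is_Cderive_eps. intros eps Heps.
  assert (HM : 0 <= Rmax M 0) by apply Rmax_r.
  assert (Hd : 0 < eps / (Rmax M 0 + 1)) by (apply Rdiv_lt_0_compat; lra).
  exists (Rmin eta (eps / (Rmax M 0 + 1))). split; [now apply Rmin_pos|].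
  intros w Hw.
  assert (M1 := Rmin_l eta (eps / (Rmax M 0 + 1))).
  assert (M2 := Rmin_r eta (eps / (Rmax M 0 + 1))).
  set (h := (w - y)%C) in *.
  replace w with (y + h)%C by (unfold h; ring).
  assert (Hh := Cmod_ge_0 h).
  assert (H0 : is_Clim_seq (fun n => D n y) (F y)).
  { assert (H0 := HF (RtoC 0) ltac:(rewrite Cmod_0; exact Heta)).
    replace (y + 0)%C with y in H0 by ring. exact H0. }
  apply Rle_trans with (M * (Cmod h * Cmod h)).
  - apply (Cmod_lim_le (fun n => D n (y + h) - D n y - D' n * h)%C); [intros n; apply HR; lra|].
    apply is_Clim_seq_minus; [apply is_Clim_seq_minus; [apply HF; lra|exact H0]|].
    replace (l * h)%C with (h * l)%C by ring.
    apply (is_Clim_seq_ext (fun n => h * D' n)%C); [intros; ring|].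
    now apply is_Clim_seq_mult.
  - apply Rle_trans with (Rmax M 0 * (Cmod h * Cmod h)).
    + apply Rmult_le_compat_r; [nra|apply Rmax_l].
    + rewrite <- Rmult_assoc. apply Rmult_le_compat_r; [lra|].
      apply Rle_trans with ((Rmax M 0 + 1) * (eps / (Rmax M 0 + 1))).
      * apply Rmult_le_compat; lra.
      * apply Req_le. field. lra.
Qed.

(** * Differentiation of exponential integrals and series *)

Lemma le_exp_div (eta x : R) : 0 < eta -> x <= / eta * exp (eta * x).
Proof.
  intros He. assert (H := exp_ineq1_le (eta * x)).
  apply (Rmult_le_reg_l eta); [exact He|].
  rewrite <- Rmult_assoc, Rinv_r, Rmult_1_l by lra. lra.
Qed.

Lemma sqr_le_exp_div (eta x : R) : 0 < eta -> 0 <= x ->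
  x * x <= 4 / (eta * eta) * exp (eta * x).
Proof.
  intros He Hx. assert (H := le_exp_div (eta / 2) x ltac:(lra)).
  replace (4 / (eta * eta) * exp (eta * x)) with
    ((/ (eta / 2) * exp (eta / 2 * x)) * (/ (eta / 2) * exp (eta / 2 * x))).
  - apply Rmult_le_compat; lra.
  - replace (eta * x) with (eta / 2 * x + eta / 2 * x) by lra. rewrite exp_plus. field. lra.
Qed.

(** Of the Taylor bound |th|^2 e^(|th|), the factor |t|^2 is absorbed by one e^(eta |t|) and
    e^(|th|) by another. The resulting growth e^(2 eta |t|) must be paid for by the decay of the
    integrand, or by a margin below the radius of convergence. *)
Lemma Cmod_Cexp_remainder (t y h : C) (eta : R) : 0 < eta -> Cmod h <= eta ->
  Cmod (Cexp (t * (y + h)) - Cexp (t * y) - t * Cexp (t * y) * h) <=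
  exp (fst (t * y)%C) * (4 / (eta * eta) * exp (2 * eta * Cmod t)) * (Cmod h * Cmod h).
Proof.
  intros He Hh.
  replace (t * (y + h))%C with (t * y + t * h)%C by ring. rewrite Cexp_plus.
  replace (Cexp (t * y) * Cexp (t * h) - Cexp (t * y) - t * Cexp (t * y) * h)%C
    with (Cexp (t * y) * (Cexp (t * h) - 1 - t * h))%C by ring.
  rewrite Cmod_mult, Cmod_Cexp, Rmult_assoc.
  apply Rmult_le_compat_l; [apply Rlt_le, exp_pos|].
  eapply Rle_trans; [apply Cmod_Cexp_taylor_le|]. rewrite Cmod_mult.
  assert (Ht := Cmod_ge_0 t). assert (Hh0 := Cmod_ge_0 h).
  replace (Cmod t * Cmod h * (Cmod t * Cmod h) * exp (Cmod t * Cmod h))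
    with (Cmod t * Cmod t * exp (Cmod t * Cmod h) * (Cmod h * Cmod h)) by ring.
  apply Rmult_le_compat_r; [nra|].
  replace (2 * eta * Cmod t) with (eta * Cmod t + eta * Cmod t) by ring.
  rewrite exp_plus, <- Rmult_assoc.
  apply Rmult_le_compat; [nra|apply Rlt_le, exp_pos|now apply sqr_le_exp_div|].
  apply exp_le. nra.
Qed.

Section Laplace.

Variables (q : C -> C) (c M kappa : R) (s y : C).
Hypotheses (HM : 0 <= M) (Hq : forall w, ex_Cderive q (c, w))
  (Hb : forall w, Cmod (q (c, w)) <= M * exp (- kappa * Rabs w))
  (Hy : Rabs (snd y) < kappa).

(** The decay rate left over at y is four times [eta]: one share allows y to move by h, two are
    spent on the Taylor remainder, and the last one keeps the integral convergent. *)
Let eta := (kappa - Rabs (snd y)) / 4.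
Let B := Rabs c + Rabs (fst s) + Rabs (snd s).
Let K := exp (B * (Rabs (fst y) + eta + (Rabs (snd y) + eta))).

Let eta_pos : 0 < eta.
Proof. unfold eta. lra. Qed.

Let Re_exponent_le (w : R) (h : C) : Cmod h <= eta ->
  fst (((c, w) + s) * (y + h))%C <=
  B * (Rabs (fst y) + eta + (Rabs (snd y) + eta)) + Rabs w * (Rabs (snd y) + eta).
Proof.
  intros Hh. simpl.
  assert (H1 := Rabs_fst_le_Cmod h). assert (H2 := Rabs_snd_le_Cmod h).
  set (y1 := fst y + fst h). set (y2 := snd y + snd h).
  assert (Y1 : Rabs y1 <= Rabs (fst y) + eta).
  { eapply Rle_trans; [apply Rabs_triang|]. lra. }
  assert (Y2 : Rabs y2 <= Rabs (snd y) + eta).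
  { eapply Rle_trans; [apply Rabs_triang|]. lra. }
  assert (S1 := Rabs_pos (snd s)). assert (S2 := Rabs_pos y1). assert (S3 := Rabs_pos y2).
  assert (S4 := Rabs_pos (fst s)). assert (S5 := Rabs_pos c). assert (S6 := Rabs_pos w).
  assert (P1 : (c + fst s) * y1 <= B * (Rabs (fst y) + eta)).
  { eapply Rle_trans; [apply Rle_abs|]. rewrite Rabs_mult.
    apply Rmult_le_compat; [apply Rabs_pos|apply Rabs_pos| |exact Y1].
    eapply Rle_trans; [apply Rabs_triang|]. unfold B. lra. }
  assert (P2 : - (snd s * y2) <= B * (Rabs (snd y) + eta)).
  { eapply Rle_trans; [apply Rle_abs|]. rewrite Rabs_Ropp, Rabs_mult.
    apply Rmult_le_compat; [apply Rabs_pos|apply Rabs_pos|unfold B; lra|exact Y2]. }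
  assert (P3 : - (w * y2) <= Rabs w * (Rabs (snd y) + eta)).
  { eapply Rle_trans; [apply Rle_abs|]. rewrite Rabs_Ropp, Rabs_mult.
    apply Rmult_le_compat_l; lra. }
  lra.
Qed.

Let Cmod_base_le (w : R) : Cmod ((c, w) + s) <= B + Rabs w.
Proof.
  eapply Rle_trans; [apply Cmod_le_Rabs|]. simpl.
  assert (H1 := Rabs_triang c (fst s)). assert (H2 := Rabs_triang w (snd s)). unfold B. lra.
Qed.

Let kernel (h z : C) : C := (q z * Cexp ((z + s) * (y + h)))%C.

Let kernel_derive (h : C) (w : R) : ex_Cderive (kernel h) (c, w).
Proof.
  apply ex_Cderive_mult; [apply Hq|]. apply ex_Cderive_Cexp.
  apply ex_Cderive_mult; [|apply ex_Cderive_const].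
  apply ex_Cderive_plus; [apply ex_Cderive_id|apply ex_Cderive_const].
Qed.

(** The exponential costs |w| (|Im y| + eta) of the decay kappa |w|; all that does not grow with w
    is collected in [K]. *)
Let exponent_bound (w : R) (h : C) : Cmod h <= eta ->
  Cmod (q (c, w)) * exp (fst (((c, w) + s) * (y + h))%C) <=
  M * K * exp (- (kappa - Rabs (snd y) - eta) * Rabs w).
Proof.
  intros Hh.
  apply Rle_trans with ((M * exp (- kappa * Rabs w)) *
    (K * exp (Rabs w * (Rabs (snd y) + eta)))).
  - apply Rmult_le_compat; [apply Cmod_ge_0|apply Rlt_le, exp_pos|apply Hb|].
    unfold K. rewrite <- exp_plus. apply exp_le. now apply Re_exponent_le.
  - apply Req_le.
    replace (- (kappa - Rabs (snd y) - eta) * Rabs w)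
      with (- kappa * Rabs w + Rabs w * (Rabs (snd y) + eta)) by ring.
    rewrite exp_plus. ring.
Qed.

Let MK_pos : 0 <= M * K.
Proof. apply Rmult_le_pos; [exact HM|apply Rlt_le, exp_pos]. Qed.

Let kernel_lim (h : C) : Cmod h < eta ->
  is_Clim_seq (line_sum (kernel h) c) (line_int (kernel h) c).
Proof.
  intros Hh. apply (line_int_correct _ c (M * K) (kappa - Rabs (snd y) - eta)); auto.
  - unfold eta. lra.
  - intros w. unfold kernel. rewrite Cmod_mult, Cmod_Cexp. apply exponent_bound. lra.
Qed.

Let y0 : (y + 0)%C = y.
Proof. ring. Qed.

(** The error of the linear approximation of a truncated integral is the truncated integral of the
    Taylor remainder, bounded by |h|^2 independently of the truncation. The shift [s] makes the
    statement serve for the Barnes integral (s = 0) and for the antiderivative K_c alike. *)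
Lemma is_Cderive_line_int :
  is_Cderive (fun x => line_int (fun z => q z * Cexp ((z + s) * x))%C c) y
    (line_int (fun z => (z + s) * (q z * Cexp ((z + s) * y)))%C c).
Proof.
  assert (HD : forall z, ex_Cderive (fun z => z + s)%C z).
  { intros z. apply ex_Cderive_plus; [apply ex_Cderive_id|apply ex_Cderive_const]. }
  assert (HD' : forall w, ex_Cderive (fun z => (z + s) * (q z * Cexp ((z + s) * y)))%C (c, w)).
  { intros w. apply ex_Cderive_mult; [apply HD|].
    assert (A := kernel_derive (RtoC 0) w). unfold kernel in A. rewrite y0 in A. exact A. }
  assert (Hx := exp_pos). assert (He2 : 0 < eta * eta) by nra.
  apply (is_Cderive_Clim_seq (fun n x => line_sum (fun z => q z * Cexp ((z + s) * x))%C c n)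
    (line_sum (fun z => (z + s) * (q z * Cexp ((z + s) * y)))%C c) _ y _ eta
    (2 * (M * K * (4 / (eta * eta) * exp (2 * eta * B))) / eta)); auto.
  - apply (line_int_correct _ c (M * K * (/ eta * exp (eta * B))) (kappa - Rabs (snd y) - eta - eta)); auto.
    + unfold eta. lra.
    + apply Rmult_le_pos; [exact MK_pos|]. apply Rmult_le_pos; [|apply Rlt_le, Hx].
      apply Rlt_le, Rinv_0_lt_compat, eta_pos.
    + intros w. rewrite !Cmod_mult, Cmod_Cexp.
      assert (A := exponent_bound w (RtoC 0) ltac:(rewrite Cmod_0; lra)). rewrite y0 in A.
      assert (A' : Cmod ((c, w) + s) <= / eta * exp (eta * B) * exp (eta * Rabs w)).
      { rewrite Rmult_assoc, <- exp_plus.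
        eapply Rle_trans; [apply (le_exp_div eta); exact eta_pos|].
        apply Rmult_le_compat_l; [apply Rlt_le, Rinv_0_lt_compat, eta_pos|].
        apply exp_le. rewrite <- Rmult_plus_distr_l.
        apply Rmult_le_compat_l; [lra|apply Cmod_base_le]. }
      apply Rle_trans with ((/ eta * exp (eta * B) * exp (eta * Rabs w)) *
        (M * K * exp (- (kappa - Rabs (snd y) - eta) * Rabs w))).
      * apply Rmult_le_compat; [apply Cmod_ge_0|
          apply Rmult_le_pos; [apply Cmod_ge_0|apply Rlt_le, Hx]|exact A'|exact A].
      * replace (- (kappa - Rabs (snd y) - eta - eta) * Rabs w) with
          (eta * Rabs w + - (kappa - Rabs (snd y) - eta) * Rabs w) by ring.
        rewrite exp_plus. apply Req_le. ring.
  - intros n h Hh.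
    assert (Hn := pos_INR n).
    set (g := fun z => (q z * (Cexp ((z + s) * (y + h)) - Cexp ((z + s) * y)
                        - (z + s) * Cexp ((z + s) * y) * h))%C).
    assert (Hk0 : forall w, ex_Cderive (fun z => q z * Cexp ((z + s) * y))%C (c, w)).
    { intros w. assert (A := kernel_derive (RtoC 0) w). unfold kernel in A. rewrite y0 in A. exact A. }
    assert (E : (line_sum (fun z => q z * Cexp ((z + s) * (y + h)))%C c n
       - line_sum (fun z => q z * Cexp ((z + s) * y))%C c n
       - line_sum (fun z => (z + s) * (q z * Cexp ((z + s) * y)))%C c n * h)%C = line_sum g c n).
    { rewrite Cmult_comm.
      rewrite <- (line_sum_mult (fun z => (z + s) * (q z * Cexp ((z + s) * y)))%C) by exact HD'.
      rewrite <- (line_sum_minus (fun z => q z * Cexp ((z + s) * (y + h)))%C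
        (fun z => q z * Cexp ((z + s) * y))%C); [|apply kernel_derive|exact Hk0].
      rewrite <- (line_sum_minus (fun z => q z * Cexp ((z + s) * (y + h)) - q z * Cexp ((z + s) * y))%C
        (fun z => h * ((z + s) * (q z * Cexp ((z + s) * y))))%C).
      - apply line_sum_ext. intros w. unfold g. ring.
      - intros w. apply ex_Cderive_minus; [apply kernel_derive|apply Hk0].
      - intros w. apply ex_Cderive_mult; [apply ex_Cderive_const|apply HD']. }
    rewrite E.
    replace (2 * (M * K * (4 / (eta * eta) * exp (2 * eta * B))) / eta * (Cmod h * Cmod h)) with
      (2 * (M * K * (4 / (eta * eta) * exp (2 * eta * B)) * (Cmod h * Cmod h)) / eta) by (field; lra).
    assert (Hh0 := Cmod_ge_0 h).
    apply Cmod_line_sum_le; auto.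
    + apply Rmult_le_pos; [|nra]. apply Rmult_le_pos; [exact MK_pos|].
      apply Rmult_le_pos; [apply Rdiv_le_0_compat; lra|apply Rlt_le, Hx].
    + intros w.
      assert (HX : forall x : C, ex_Cderive (fun z => Cexp ((z + s) * x))%C (c, w)).
      { intros x. apply ex_Cderive_Cexp, ex_Cderive_mult; [apply HD|apply ex_Cderive_const]. }
      apply ex_Cderive_mult; [apply Hq|].
      apply ex_Cderive_minus; [apply ex_Cderive_minus; apply HX|].
      apply ex_Cderive_mult; [|apply ex_Cderive_const].
      apply ex_Cderive_mult; [apply HD|apply HX].
    + intros w. unfold g. rewrite Cmod_mult.
      eapply Rle_trans; [apply Rmult_le_compat_l; [apply Cmod_ge_0|
        apply (Cmod_Cexp_remainder _ y h eta); lra]|].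
      assert (A := exponent_bound w (RtoC 0) ltac:(rewrite Cmod_0; lra)). rewrite y0 in A.
      assert (A' : exp (2 * eta * Cmod ((c, w) + s)) <= exp (2 * eta * B) * exp (2 * eta * Rabs w)).
      { rewrite <- exp_plus. apply exp_le. rewrite <- Rmult_plus_distr_l.
        apply Rmult_le_compat_l; [lra|apply Cmod_base_le]. }
      apply Rle_trans with ((M * K * exp (- (kappa - Rabs (snd y) - eta) * Rabs w)) *
        ((4 / (eta * eta) * (exp (2 * eta * B) * exp (2 * eta * Rabs w))) * (Cmod h * Cmod h))).
      * match goal with |- ?X * (?Y * ?T * ?H) <= _ =>
          replace (X * (Y * T * H)) with (X * Y * (T * H)) by ring end.
        apply Rmult_le_compat; [apply Rmult_le_pos; [apply Cmod_ge_0|apply Rlt_le, Hx]| |exact A|].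
        -- apply Rmult_le_pos; [|nra].
           apply Rmult_le_pos; [apply Rdiv_le_0_compat; lra|apply Rlt_le, Hx].
        -- apply Rmult_le_compat_r; [nra|].
           apply Rmult_le_compat_l; [apply Rdiv_le_0_compat; lra|exact A'].
      * replace (- eta * Rabs w) with
          (2 * eta * Rabs w + - (kappa - Rabs (snd y) - eta) * Rabs w) by (unfold eta; field).
        rewrite exp_plus. apply Req_le. ring.
Qed.

End Laplace.

(** * Absolutely convergent complex series and power series in e^y *)

Local Notation Csum a n := (@sum_n C_AbelianMonoid a n).

Lemma Csum_Sn (a : nat -> C) (n : nat) : Csum a (S n) = (Csum a n + a (S n))%C :> C.
Proof. apply (sum_Sn (G := C_AbelianMonoid)). Qed.

Lemma Cmod_Csum_le (a : nat -> C) (b : nat -> R) (n : nat) :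
  (forall k, Cmod (a k) <= b k) -> Cmod (Csum a n) <= sum_n b n.
Proof.
  intros H. induction n as [|n IH].
  - rewrite !sum_O. apply H.
  - rewrite Csum_Sn, sum_Sn. eapply Rle_trans; [apply Cmod_triangle|].
    apply Rplus_le_compat; [exact IH|apply H].
Qed.

Lemma Cmod_Csum_diff_le (a : nat -> C) (b : nat -> R) (n k : nat) :
  (forall k, Cmod (a k) <= b k) ->
  Cmod (Csum a (n + k) - Csum a n) <= sum_n b (n + k) - sum_n b n.
Proof.
  intros H. induction k as [|k IH].
  - rewrite Nat.add_0_r. replace (Csum a n - Csum a n)%C with (RtoC 0) by ring.
    rewrite Cmod_0. lra.
  - rewrite Nat.add_succ_r, Csum_Sn, sum_Sn.
    replace (Csum a (n + k) + a (S (n + k)) - Csum a n)%C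
      with ((Csum a (n + k) - Csum a n) + a (S (n + k)))%C by ring.
    eapply Rle_trans; [apply Cmod_triangle|]. specialize (H (S (n + k))).
    unfold plus; simpl. lra.
Qed.

Lemma sum_n_le_Series (b : nat -> R) (n : nat) :
  (forall k, 0 <= b k) -> ex_series b -> sum_n b n <= Series b.
Proof.
  intros H Hb.
  apply (is_lim_seq_incr_compare (sum_n b) (Series b)).
  - apply (Series_correct b Hb).
  - intros k. rewrite sum_Sn. specialize (H (S k)). unfold plus; simpl. lra.
Qed.

Lemma Csum_correct (a : nat -> C) (b : nat -> R) :
  (forall k, Cmod (a k) <= b k) -> ex_series b ->
  is_Clim_seq (fun n => Csum a n) (CLim (fun n => Csum a n)).
Proof.
  intros H Hb.
  assert (H0 : forall k, 0 <= b k) by (intros k; eapply Rle_trans; [apply Cmod_ge_0|apply H]).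
  apply (CLim_cauchy _ (fun n => Series b - sum_n b n)).
  - replace (Finite 0) with (Finite (Series b - Series b)) by (rewrite Rminus_eq_0; reflexivity).
    apply is_lim_seq_minus'; [apply is_lim_seq_const|apply (Series_correct b Hb)].
  - intros n k. eapply Rle_trans; [now apply Cmod_Csum_diff_le|].
    assert (A := sum_n_le_Series b (n + k) H0 Hb). lra.
Qed.

Lemma Csum_minus (a b : nat -> C) (n : nat) :
  Csum (fun k => a k - b k)%C n = (Csum a n - Csum b n)%C :> C.
Proof.
  induction n as [|n IH]; [now rewrite !sum_O|]. rewrite !Csum_Sn, IH. ring.
Qed.

Lemma Csum_mult_r (a : nat -> C) (h : C) (n : nat) :
  Csum (fun k => a k * h)%C n = (Csum a n * h)%C :> C.
Proof.
  induction n as [|n IH]; [now rewrite !sum_O|]. rewrite !Csum_Sn, IH. ring.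
Qed.

(** The power series at x = e^y. In this variable its terms are exponentials, so that it can be
    compared with the line integral on a strip and differentiated by the same Taylor estimate. *)
Definition exp_series (a : nat -> C) (y : C) : C :=
  CLim (fun n => Csum (fun k => a k * Cexp (INR k * y))%C n).

Lemma Re_INR_mult (k : nat) (y : C) : fst (INR k * y)%C = INR k * fst y.
Proof. simpl. ring. Qed.

Lemma exp_series_term_le (a : nat -> C) (r : R) (y : C) (k : nat) : fst y <= r ->
  Cmod (a k * Cexp (INR k * y)) <= Cmod (a k) * exp (INR k * r).
Proof.
  intros Hy. rewrite Cmod_mult, Cmod_Cexp, Re_INR_mult.
  apply Rmult_le_compat_l; [apply Cmod_ge_0|]. apply exp_le.
  apply Rmult_le_compat_l; [apply pos_INR|exact Hy].
Qed.

Lemma exp_series_correct (a : nat -> C) (r : R) (y : C) :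
  ex_series (fun k => Cmod (a k) * exp (INR k * r)) -> fst y <= r ->
  is_Clim_seq (fun n => Csum (fun k => a k * Cexp (INR k * y))%C n) (exp_series a y).
Proof.
  intros Hr Hy. apply (Csum_correct _ _ (fun k => exp_series_term_le a r y k Hy) Hr).
Qed.

(** Absolute convergence at abscissa r leaves a margin r - Re y = 2 eta; it absorbs both the factor
    k of the derivative and the growth e^(2 eta k) in [Cmod_Cexp_remainder]. *)
Lemma ex_Cderive_exp_series (a : nat -> C) (r : R) (y : C) :
  ex_series (fun k => Cmod (a k) * exp (INR k * r)) -> fst y < r ->
  ex_Cderive (exp_series a) y.
Proof.
  intros Hr Hy. set (eta := (r - fst y) / 2). assert (He : 0 < eta) by (unfold eta; lra).
  assert (He2 : 0 < eta * eta) by nra.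
  assert (HI : forall k, Cmod (RtoC (INR k)) = INR k).
  { intros k. rewrite Cmod_R. apply Rabs_pos_eq, pos_INR. }
  set (b := fun k => Cmod (a k) * exp (INR k * r)) in *.
  assert (Hb0 : forall k, 0 <= b k).
  { intros k. apply Rmult_le_pos; [apply Cmod_ge_0|apply Rlt_le, exp_pos]. }
  exists (CLim (fun n => Csum (fun k => INR k * (a k * Cexp (INR k * y)))%C n)).
  apply (is_Cderive_Clim_seq (fun n x => Csum (fun k => a k * Cexp (INR k * x))%C n)
    (fun n => Csum (fun k => INR k * (a k * Cexp (INR k * y)))%C n) _ y _ eta
    (4 / (eta * eta) * Series b)); auto.
  - intros h Hh. apply exp_series_correct with (1 := Hr).
    assert (A := fst_le_Cmod h). simpl. unfold eta in *. lra.
  - apply (Csum_correct _ (fun k => / eta * b k)).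
    + intros k. rewrite !Cmod_mult, Cmod_Cexp, Re_INR_mult, HI.
      apply Rle_trans with (/ eta * exp (eta * INR k) * (Cmod (a k) * exp (INR k * fst y))).
      * apply Rmult_le_compat_r; [|now apply le_exp_div].
        apply Rmult_le_pos; [apply Cmod_ge_0|apply Rlt_le, exp_pos].
      * unfold b. replace (/ eta * exp (eta * INR k) * (Cmod (a k) * exp (INR k * fst y)))
          with (/ eta * (Cmod (a k) * (exp (eta * INR k) * exp (INR k * fst y)))) by ring.
        rewrite <- exp_plus.
        apply Rmult_le_compat_l; [apply Rlt_le, Rinv_0_lt_compat, He|].
        apply Rmult_le_compat_l; [apply Cmod_ge_0|]. apply exp_le.
        assert (Hk := pos_INR k). unfold eta. nra.
    + now apply (ex_series_scal_l (/ eta) b).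
  - intros n h Hh. rewrite <- Csum_mult_r, <- !Csum_minus.
    assert (Hh0 := Cmod_ge_0 h).
    apply Rle_trans with (sum_n (fun k => 4 / (eta * eta) * (Cmod h * Cmod h) * b k) n).
    + apply Cmod_Csum_le. intros k.
      replace (a k * Cexp (INR k * (y + h)) - a k * Cexp (INR k * y) -
        INR k * (a k * Cexp (INR k * y)) * h)%C with
        (a k * (Cexp (INR k * (y + h)) - Cexp (INR k * y) - INR k * Cexp (INR k * y) * h))%C by ring.
      rewrite Cmod_mult.
      eapply Rle_trans; [apply Rmult_le_compat_l; [apply Cmod_ge_0|
        apply (Cmod_Cexp_remainder _ y h eta); lra]|].
      rewrite Re_INR_mult, HI. unfold b.
      replace (INR k * r) with (INR k * fst y + 2 * eta * INR k) by (unfold eta; field).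
      rewrite exp_plus. apply Req_le. ring.
    + assert (E : sum_n (fun k => 4 / (eta * eta) * (Cmod h * Cmod h) * b k) n =
        4 / (eta * eta) * (Cmod h * Cmod h) * sum_n b n).
      { apply (sum_n_mult_l (K := R_Ring)). }
      rewrite E.
      replace (4 / (eta * eta) * Series b * (Cmod h * Cmod h)) with
        (4 / (eta * eta) * (Cmod h * Cmod h) * Series b) by ring.
      apply Rmult_le_compat_l.
      * apply Rmult_le_pos; [apply Rdiv_le_0_compat; lra|nra].
      * now apply sum_n_le_Series.
Qed.

(** * The identity theorem on a strip *)

Lemma on_rect_bounded (f : C -> C) (a b c d : R) :
  (forall z, on_rect a b c d z -> ex_Cderive f z) ->
  exists M, forall z, on_rect a b c d z -> Cmod (f z) <= M.
Proof.
  intros Hf.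
  assert (HV : forall u, u = a \/ u = b -> a <= b ->
    exists M, forall t, c <= t <= d -> Cmod (f (u, t)) <= M).
  { intros u Hu Hab.
    destruct (bounded_continuity (V := C_R_NormedModule) (fun t => f (u, t)) c d) as [M HM].
    - intros t Ht. apply (Ccontinuous_vertical f u t), Hf. on_rect.
    - exists M. intros t Ht. rewrite Cmod_norm. apply Rlt_le, HM, Ht. }
  assert (HH : forall v, v = c \/ v = d -> c <= d ->
    exists M, forall t, a <= t <= b -> Cmod (f (t, v)) <= M).
  { intros v Hv Hcd.
    destruct (bounded_continuity (V := C_R_NormedModule) (fun t => f (t, v)) a b) as [M HM].
    - intros t Ht. apply (Ccontinuous_horizontal f v t), Hf. on_rect.
    - exists M. intros t Ht. rewrite Cmod_norm. apply Rlt_le, HM, Ht. }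
  destruct (Rle_dec a b) as [Hab|Hab]; [|exists 0; intros z [[Hz _] _]; lra].
  destruct (Rle_dec c d) as [Hcd|Hcd]; [|exists 0; intros z [[_ Hz] _]; lra].
  destruct (HV a ltac:(auto) Hab) as [M1 H1]. destruct (HV b ltac:(auto) Hab) as [M2 H2].
  destruct (HH c ltac:(auto) Hcd) as [M3 H3]. destruct (HH d ltac:(auto) Hcd) as [M4 H4].
  exists (Rmax (Rmax M1 M2) (Rmax M3 M4)).
  assert (L1 := Rmax_l (Rmax M1 M2) (Rmax M3 M4)). assert (L2 := Rmax_r (Rmax M1 M2) (Rmax M3 M4)).
  assert (L3 := Rmax_l M1 M2). assert (L4 := Rmax_r M1 M2).
  assert (L5 := Rmax_l M3 M4). assert (L6 := Rmax_r M3 M4).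
  intros [u v] [[Hu Hv] Hb]. simpl in *.
  destruct Hb as [Hb|[Hb|[Hb|Hb]]]; rewrite Hb.
  - specialize (H1 v Hv). lra.
  - specialize (H2 v Hv). lra.
  - specialize (H3 u Hu). lra.
  - specialize (H4 u Hu). lra.
Qed.

(* D / (z - p)^n is holomorphic because D vanishes near p; Cauchy's formula on the
   square of half-side r then gives |D w| <= const * (|w - p| / r)^n for every n. *)
Lemma vanish_ball (D : C -> C) (p : C) (r delta : R) : 0 < r -> 0 < delta ->
  (forall z, in_rect (fst p - r) (fst p + r) (snd p - r) (snd p + r) z -> ex_Cderive D z) ->
  (forall z, Cmod (z - p) < delta -> D z = RtoC 0) ->
  forall z, Cmod (z - p) < r -> D z = RtoC 0.
Proof.
  intros Hr Hdelta HD H0 w Hw.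
  destruct (Ceq_dec w p) as [E|Hwp].
  { apply H0. rewrite E. replace (p - p)%C with (RtoC 0) by ring. now rewrite Cmod_0. }
  destruct (on_rect_bounded D (fst p - r) (fst p + r) (snd p - r) (snd p + r)) as [M HM].
  { intros z [Hz _]. now apply HD. }
  assert (HM0 : 0 <= M).
  { eapply Rle_trans; [apply Cmod_ge_0|apply (HM (fst p - r, snd p))]. on_rect. }
  assert (Hw1 := Rabs_fst_le_Cmod (w - p)). assert (Hw2 := Rabs_snd_le_Cmod (w - p)).
  assert (Hr1 : forall z, on_rect (fst p - r) (fst p + r) (snd p - r) (snd p + r) z -> r <= Cmod (z - p)).
  { intros z [_ Hb].
    assert (A1 := Rabs_fst_le_Cmod (z - p)). assert (A2 := Rabs_snd_le_Cmod (z - p)).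
    unfold Cminus in *; simpl in A1, A2.
    destruct Hb as [Hb|[Hb|[Hb|Hb]]]; try rewrite Hb in A1; try rewrite Hb in A2;
    unfold Rabs in A1, A2; repeat destruct Rcase_abs in A1; repeat destruct Rcase_abs in A2; lra. }
  set (g := r - Cmod (w - p)) in *.
  assert (Hg : 0 < g) by (unfold g; lra).
  assert (Hr2 : forall z, on_rect (fst p - r) (fst p + r) (snd p - r) (snd p + r) z -> g <= Cmod (z - w)).
  { intros z Hz. specialize (Hr1 z Hz). assert (A := Cmod_triangle_minus (z - p) (w - p)).
    replace (z - p - (w - p))%C with (z - w)%C in A by ring. unfold g. lra. }
  assert (HPI := PI_RGT_0).
  assert (Hpw : forall n, ((w - p) ^ n)%C <> RtoC 0).
  { intros n. apply Cpow_nz. now apply Cminus_neq_0. }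
  assert (Hquot : forall n z, z <> p -> ex_Cderive D z ->
    ex_Cderive (fun z => D z / (z - p) ^ n)%C z).
  { intros n z Hz Hd. apply ex_Cderive_div; [|exact Hd|].
    - apply Cpow_nz. now apply Cminus_neq_0.
    - apply (ex_Cderive_pow (fun z => z - p)%C).
      apply ex_Cderive_minus; [apply ex_Cderive_id|apply ex_Cderive_const]. }
  (* Cauchy's formula for D / (z - p)^n: perimeter 8 r, modulus at most M / r^n and distance at
     least [g] from w on the boundary, then multiplication by |w - p|^n / (2 pi). *)
  assert (Hn : forall n, Cmod (D w) <= 8 * r * M / (2 * PI * g) * (Cmod (w - p) / r) ^ n).
  { intros n.
    set (f := fun z => ((D z / (z - p) ^ n) / (z - w))%C).
    assert (Hin : fst p - r < fst w < fst p + r /\ snd p - r < snd w < snd p + r).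
    { unfold Cminus in *; simpl in Hw1, Hw2.
      unfold Rabs in Hw1, Hw2; repeat destruct Rcase_abs in Hw1; repeat destruct Rcase_abs in Hw2; lra. }
    assert (Hf : forall z, in_rect (fst p - r) (fst p + r) (snd p - r) (snd p + r) z ->
      z <> w -> ex_Cderive f z).
    { intros z Hz Hzw.
      (* At p the function is locally constant 0: its numerator vanishes nearby, whatever value the
         inverse of 0 takes. *)
      destruct (Ceq_dec z p) as [E|Hzp].
      - exists (RtoC 0). apply (is_Cderive_ext_loc (fun _ => RtoC 0) f z _ delta); [exact Hdelta| |
          apply is_Cderive_const].
        intros x Hx. unfold f. rewrite H0 by (rewrite <- E; exact Hx). unfold Cdiv. ring.
      - apply ex_Cderive_div; [now apply Cminus_neq_0|now apply Hquot; [|apply HD]|].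
        apply ex_Cderive_minus; [apply ex_Cderive_id|apply ex_Cderive_const]. }
    assert (HR := residue_rect f w (D w / (w - p) ^ n)%C (fst p - r) (fst p + r) (snd p - r) (snd p + r)
      (proj1 Hin) (proj2 Hin) Hf).
    assert (HB : Cmod (rect_int f (fst p - r) (fst p + r) (snd p - r) (snd p + r)) <=
      2 * ((fst p + r - (fst p - r)) + (snd p + r - (snd p - r))) * (M / r ^ n / g)).
    { apply Cmod_rect_int_le; try lra.
      - intros z Hz. apply Hf; [apply Hz|]. intros E. specialize (Hr2 z Hz). rewrite E in Hr2.
        replace (w - w)%C with (RtoC 0) in Hr2 by ring. rewrite Cmod_0 in Hr2. lra.
      - intros z Hz. specialize (Hr1 z Hz). specialize (Hr2 z Hz). specialize (HM z Hz).
        assert (Hzp : (z - p)%C <> RtoC 0) by (apply Cmod_gt_0; lra).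
        assert (Hzw : (z - w)%C <> RtoC 0) by (apply Cmod_gt_0; lra).
        assert (Hpn : 0 < r ^ n) by now apply pow_lt.
        unfold f. rewrite !Cmod_div, Cmod_pow; [|now apply Cpow_nz|exact Hzw].
        assert (Hpn' : r ^ n <= Cmod (z - p) ^ n) by (apply pow_incr; lra).
        unfold Rdiv.
        apply Rmult_le_compat; [|apply Rlt_le, Rinv_0_lt_compat; lra| |apply Rinv_le_contravar; lra].
        + apply Rmult_le_pos; [apply Cmod_ge_0|apply Rlt_le, Rinv_0_lt_compat; lra].
        + apply Rmult_le_compat; [apply Cmod_ge_0|apply Rlt_le, Rinv_0_lt_compat; lra|lra|
            apply Rinv_le_contravar; lra]. }
    rewrite HR in HB.
    - rewrite !Cmod_mult, Cmod_Ci, Cmod_div, Cmod_pow, !Cmod_R, !Rabs_pos_eq in HB by (auto; lra).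
      assert (Hpn : 0 < r ^ n) by now apply pow_lt.
      assert (Hpm : 0 < Cmod (w - p) ^ n) by (rewrite <- Cmod_pow; apply Cmod_gt_0, Hpw).
      replace (Cmod (D w)) with
        ((2 * PI * 1 * (Cmod (D w) / Cmod (w - p) ^ n)) * (Cmod (w - p) ^ n / (2 * PI)))
        by (field; lra).
      replace (8 * r * M / (2 * PI * g) * (Cmod (w - p) / r) ^ n) with
        (2 * ((fst p + r - (fst p - r)) + (snd p + r - (snd p - r))) * (M / r ^ n / g)
          * (Cmod (w - p) ^ n / (2 * PI))).
      + apply Rmult_le_compat_r; [|exact HB]. apply Rdiv_le_0_compat; lra.
      + replace ((Cmod (w - p) / r) ^ n) with (Cmod (w - p) ^ n / r ^ n)
          by (unfold Rdiv; rewrite Rpow_mult_distr, pow_inv; reflexivity).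
        field. lra.
    - intros eps Heps.
      destruct (ex_Cderive_continuous _ _ (Hquot n w Hwp (HD w ltac:(split; simpl; lra))) eps Heps)
        as (del & Hdel & Hc).
      exists del. split; [exact Hdel|]. intros z Hz Hzd.
      unfold f. replace ((z - w) * (D z / (z - p) ^ n / (z - w)))%C with (D z / (z - p) ^ n)%C.
      + apply Rlt_le. now apply Hc.
      + set (X := (D z / (z - p) ^ n)%C). field. now apply Cminus_neq_0. }
  apply Cmod_eq_0, Rle_antisym; [|apply Cmod_ge_0].
  apply (le_0_of_lim _ (fun n => 8 * r * M / (2 * PI * g) * (Cmod (w - p) / r) ^ n) 0).
  - intros n _. apply Hn.
  - apply is_lim_seq_mult_0, is_lim_seq_geom.
    rewrite Rabs_pos_eq by (apply Rdiv_le_0_compat; [apply Cmod_ge_0|lra]).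
    apply Rlt_div_l; lra.
Qed.

(** Discs of radius theta are centred on the real axis at steps of theta / 2, ending at x. The disc
    of half the radius around each centre lies in the preceding disc, and [vanish_ball] enlarges it
    to radius theta; the square needed there just fits into the strip. *)
Lemma vanish_on_strip (D : C -> C) (x theta Q : R) : 0 < theta ->
  (forall z, fst z <= x + theta -> Rabs (snd z) <= theta -> ex_Cderive D z) ->
  (forall z, fst z < Q -> Rabs (snd z) <= theta -> D z = RtoC 0) ->
  D (RtoC x) = RtoC 0.
Proof.
  intros Ht HD H0.
  (* [N] steps to the left of x, the whole disc lies in Re z < Q, where D vanishes by hypothesis. *)
  destruct (INR_unbounded ((x - Q + theta) / (theta / 2))) as [N HN].
  apply Rlt_div_l in HN; [|lra].
  assert (H : forall j, (j <= N)%nat -> forall z,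
    Cmod (z - RtoC (x - INR (N - j) * (theta / 2))) < theta -> D z = RtoC 0).
  { induction j as [|j IH]; intros Hj z Hz.
    - rewrite Nat.sub_0_r in Hz.
      assert (A1 := Rabs_fst_le_Cmod (z - RtoC (x - INR N * (theta / 2)))).
      assert (A2 := Rabs_snd_le_Cmod (z - RtoC (x - INR N * (theta / 2)))).
      simpl in A1, A2. replace (snd z + - 0) with (snd z) in A2 by ring.
      apply H0; [|lra].
      assert (A3 := Rle_abs (fst z + - (x - INR N * (theta / 2)))). lra.
    - assert (Hk : INR (N - j) = INR (N - S j) + 1).
      { rewrite <- S_INR. f_equal. lia. }
      assert (Hk0 := pos_INR (N - S j)).
      set (u := x - INR (N - S j) * (theta / 2)) in *.
      apply (vanish_ball D (RtoC u) theta (theta / 2)); try lra.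
      + intros v [Hv1 Hv2]. simpl in *. apply HD.
        * unfold u in Hv1. nra.
        * apply Rabs_le. lra.
      + intros v Hv. apply IH; [lia|].
        replace (v - RtoC (x - INR (N - j) * (theta / 2)))%C with
          ((v - RtoC u) + RtoC (theta / 2))%C.
        * eapply Rle_lt_trans; [apply Cmod_triangle|]. rewrite Cmod_R, Rabs_pos_eq by lra. lra.
        * rewrite Hk. unfold u. unfold Cminus. rewrite <- !RtoC_opp.
          replace (v + RtoC (- (x - INR (N - S j) * (theta / 2))) + RtoC (theta / 2))%C with
            (v + (RtoC (- (x - INR (N - S j) * (theta / 2))) + RtoC (theta / 2)))%C by ring.
          rewrite <- RtoC_plus. do 2 f_equal. lra. }
  apply (H N (Nat.le_refl _)). rewrite Nat.sub_diag. simpl.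
  replace (RtoC x - RtoC (x - 0 * (theta / 2)))%C with (RtoC 0); [now rewrite Cmod_0|].
  rewrite <- RtoC_minus. f_equal. lra.
Qed.

(** * The sine function and residues at simple poles *)

Lemma Csin_pair (x y : R) : Csin (x, y) = (sin x * cosh y, cos x * sinh y).
Proof.
  unfold Csin.
  assert (E : (/ (2 * Ci))%C = (0, - / 2)).
  { unfold Cinv, Ci, Cmult, RtoC; simpl. f_equal; field. }
  unfold Cdiv. rewrite E. unfold Cexp, cosh, sinh, Ci, Cmult, Cminus, Cplus, Copp, RtoC; simpl.
  replace (0 * x - 1 * y) with (- y) by ring. replace (0 * y + 1 * x) with x by ring.
  rewrite Ropp_involutive, cos_neg, sin_neg. f_equal; field.
Qed.

Lemma cosh_ge (y : R) : exp (Rabs y) / 2 <= cosh y.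
Proof.
  unfold cosh. assert (H1 := exp_pos y). assert (H2 := exp_pos (- y)).
  unfold Rabs. destruct Rcase_abs; lra.
Qed.

(** The real part alone suffices. This serves on vertical lines that avoid the integers, with a
    constant depending on the line. *)
Lemma Cmod_Csin_ge_sin (x y : R) : Rabs (sin x) * exp (Rabs y) / 2 <= Cmod (Csin (x, y)).
Proof.
  rewrite Csin_pair.
  eapply Rle_trans; [|apply Rabs_fst_le_Cmod]. simpl. rewrite Rabs_mult.
  unfold Rdiv. rewrite Rmult_assoc. apply Rmult_le_compat_l; [apply Rabs_pos|].
  eapply Rle_trans; [apply cosh_ge|apply Rle_abs].
Qed.

(** From |sin(x + iy)|^2 = sin^2 x + sinh^2 y. This serves on horizontal segments, where sin x may
    vanish. *)
Lemma Cmod_Csin_ge_sinh (x y : R) : Rabs (sinh y) <= Cmod (Csin (x, y)).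
Proof.
  rewrite Csin_pair. unfold Cmod. rewrite <- sqrt_Rsqr_abs.
  apply sqrt_le_1_alt. simpl.
  assert (H := sin2_cos2 x). unfold Rsqr in *.
  assert (Hc : cosh y * cosh y = 1 + sinh y * sinh y).
  { unfold cosh, sinh. assert (E : exp y * exp (- y) = 1).
    { rewrite <- exp_plus, Rplus_opp_r. apply exp_0. }
    field_simplify. assert (E2 := f_equal (fun t => 4 * t) E). simpl in E2. lra. }
  replace (sin x * cosh y * (sin x * cosh y * 1) + cos x * sinh y * (cos x * sinh y * 1))
    with (sin x * sin x * (cosh y * cosh y) + cos x * cos x * (sinh y * sinh y)) by ring.
  rewrite Hc.
  replace (sin x * sin x * (1 + sinh y * sinh y) + cos x * cos x * (sinh y * sinh y))
    with (sin x * sin x + (sin x * sin x + cos x * cos x) * (sinh y * sinh y)) by ring.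
  rewrite H. assert (H' := Rle_0_sqr (sin x)). unfold Rsqr in H'. lra.
Qed.

Lemma Rabs_sinh_ge (y : R) : 1 <= Rabs y -> exp (Rabs y) / 4 <= Rabs (sinh y).
Proof.
  intros Hy.
  assert (H : forall t, 1 <= t -> exp t / 4 <= sinh t).
  { intros t Ht. unfold sinh.
    assert (H1 : exp (- t) <= 1) by (rewrite <- exp_0; apply exp_le; lra).
    assert (H2 := exp_ineq1_le t). lra. }
  unfold Rabs in *. destruct Rcase_abs.
  - specialize (H _ Hy).
    assert (E : sinh (- y) = - sinh y) by (unfold sinh; rewrite Ropp_involutive; field).
    rewrite E in H. assert (A := exp_pos (- y)). destruct Rcase_abs; lra.
  - specialize (H _ Hy). assert (A := exp_pos y). destruct Rcase_abs; lra.
Qed.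

Lemma Csin_neq_0 (k : Z) (z : C) : IZR k - 1 < fst z < IZR k + 1 -> z <> RtoC (IZR k) ->
  Csin (PI * z) <> RtoC 0.
Proof.
  destruct z as [x y]; simpl. intros Hx Hz.
  assert (HPI := PI_RGT_0).
  replace (PI * (x, y))%C with ((PI * x, PI * y) : C)
    by (unfold Cmult, RtoC; simpl; f_equal; ring).
  intros H. rewrite Csin_pair in H. unfold RtoC in H. injection H as H1 H2.
  assert (Hcosh : 0 < cosh (PI * y)).
  { eapply Rlt_le_trans; [|apply cosh_ge]. assert (A := exp_pos (Rabs (PI * y))). lra. }
  apply Rmult_integral in H1. destruct H1 as [H1|H1]; [|lra].
  destruct (sin_eq_0_0 _ H1) as [m Hm].
  assert (Em : x = IZR m) by (apply (Rmult_eq_reg_l PI); lra).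
  assert (m = k).
  { rewrite Em in Hx. rewrite <- minus_IZR, <- plus_IZR in Hx.
    destruct Hx as [L1 L2]. apply lt_IZR in L1, L2. lia. }
  subst m.
  assert (Hcos : cos (PI * x) <> 0).
  { intros E. assert (A := sin2_cos2 (PI * x)). rewrite E, H1 in A. unfold Rsqr in A. lra. }
  apply Rmult_integral in H2. destruct H2 as [H2|H2]; [contradiction|].
  assert (Ey : PI * y = 0).
  { unfold sinh in H2. assert (E : exp (PI * y) = exp (- (PI * y))) by lra.
    apply exp_inv in E. lra. }
  apply Hz. unfold RtoC. f_equal; [exact Em|].
  apply Rmult_integral in Ey. destruct Ey; lra.
Qed.

Lemma is_Cderive_Csin (z : C) : is_Cderive Csin z ((Cexp (Ci * z) + Cexp (- (Ci * z))) / 2)%C.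
Proof.
  assert (HCi : Ci <> RtoC 0) by (apply C_neq_snd; simpl; lra).
  assert (H2 : RtoC 2 <> RtoC 0) by (apply C_neq_fst; simpl; lra).
  assert (D1 : is_Cderive (fun w => Ci * w)%C z Ci).
  { apply is_Cderive_linear. }
  assert (D2 : is_Cderive (fun w => - (Ci * w))%C z (- Ci)%C).
  { apply (is_Cderive_ext_loc (fun w => 0 - Ci * w)%C _ z _ 1); [lra|intros; ring|].
    replace (- Ci)%C with (0 - Ci)%C by ring.
    apply (is_Cderive_minus (fun _ => RtoC 0)); [apply is_Cderive_const|exact D1]. }
  replace ((Cexp (Ci * z) + Cexp (- (Ci * z))) / 2)%C with
    ((Cexp (Ci * z) * Ci - Cexp (- (Ci * z)) * - Ci) * / (2 * Ci) +
     (Cexp (Ci * z) - Cexp (- (Ci * z))) * 0)%C by (field; auto).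
  apply (is_Cderive_mult (fun w => Cexp (Ci * w) - Cexp (- (Ci * w)))%C (fun _ => / (2 * Ci))%C);
    [|apply is_Cderive_const].
  apply is_Cderive_minus.
  - apply (is_Cderive_comp Cexp (fun w => Ci * w)%C); [apply is_Cderive_Cexp|exact D1].
  - apply (is_Cderive_comp Cexp (fun w => - (Ci * w))%C); [apply is_Cderive_Cexp|exact D2].
Qed.

Lemma sin_cos_INR_PI (k : nat) : sin (PI * INR k) = 0 /\ cos (PI * INR k) = (-1) ^ k.
Proof.
  induction k as [|k [IH1 IH2]].
  - simpl. rewrite Rmult_0_r. split; [apply sin_0|apply cos_0].
  - rewrite S_INR, Rmult_plus_distr_l, Rmult_1_r, neg_sin, neg_cos, IH1, IH2. simpl.
    split; ring.
Qed.

Lemma PI_mult_INR (k : nat) : (PI * INR k)%C = (PI * INR k, 0).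
Proof. unfold Cmult, RtoC; simpl. f_equal; ring. Qed.

Lemma Csin_PI_INR (k : nat) : Csin (PI * INR k) = RtoC 0.
Proof.
  rewrite PI_mult_INR, Csin_pair. destruct (sin_cos_INR_PI k) as [-> _].
  unfold sinh. rewrite Ropp_0. unfold RtoC. f_equal; lra.
Qed.

Lemma is_Cderive_Csin_PI (z : C) : is_Cderive (fun w => Csin (PI * w)) z
  ((Cexp (Ci * (PI * z)) + Cexp (- (Ci * (PI * z)))) / 2 * PI)%C.
Proof.
  apply (is_Cderive_comp Csin (fun w => PI * w)%C); [apply is_Cderive_Csin|apply is_Cderive_linear].
Qed.

Lemma is_Cderive_Csin_PI_INR (k : nat) :
  is_Cderive (fun w => Csin (PI * w)) (RtoC (INR k)) (RtoC ((-1) ^ k * PI)).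
Proof.
  replace (RtoC ((-1) ^ k * PI)) with
    ((Cexp (Ci * (PI * INR k)) + Cexp (- (Ci * (PI * INR k)))) / 2 * PI)%C;
    [apply is_Cderive_Csin_PI|].
  rewrite RtoC_mult. f_equal.
  assert (E : forall e, Cexp (0, e * (PI * INR k)) = (cos (e * (PI * INR k)), sin (e * (PI * INR k)))).
  { intros e. unfold Cexp; simpl. rewrite exp_0. f_equal; ring. }
  rewrite PI_mult_INR.
  replace (Ci * (PI * INR k, 0)%R)%C with ((0, 1 * (PI * INR k)) : C)
    by (unfold Ci, Cmult; simpl; f_equal; ring).
  replace (- ((0, 1 * (PI * INR k))%R : C))%C with ((0, -1 * (PI * INR k)) : C)
    by (unfold Copp; simpl; f_equal; ring).
  rewrite !E. rewrite Rmult_1_l. replace (-1 * (PI * INR k)) with (- (PI * INR k)) by ring.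
  rewrite cos_neg, sin_neg. destruct (sin_cos_INR_PI k) as [-> ->].
  apply injective_projections; simpl; field.
Qed.

(** * Limits over punctured neighbourhoods and the residues of h *)

Definition Clim_at (f : C -> C) (p l : C) : Prop :=
  forall eps, 0 < eps -> exists del, 0 < del /\
    forall z, z <> p -> Cmod (z - p) < del -> Cmod (f z - l) <= eps.

Lemma Clim_at_ext (f g : C -> C) (p l : C) (e : R) : 0 < e ->
  (forall z, z <> p -> Cmod (z - p) < e -> f z = g z) -> Clim_at f p l -> Clim_at g p l.
Proof.
  intros He E H eps Heps. destruct (H eps Heps) as (d & Hd & H').
  exists (Rmin d e). split; [now apply Rmin_pos|]. intros z Hz Hzd.
  assert (L1 := Rmin_l d e). assert (L2 := Rmin_r d e).
  rewrite <- E by (auto; lra). apply H'; auto; lra.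
Qed.

Lemma Clim_at_continuous (f : C -> C) (p : C) : ex_Cderive f p -> Clim_at f p (f p).
Proof.
  intros H eps Heps. destruct (ex_Cderive_continuous f p H eps Heps) as (d & Hd & H').
  exists d. split; [exact Hd|]. intros z _ Hz. apply Rlt_le. now apply H'.
Qed.

Lemma Clim_at_plus (f g : C -> C) (p l m : C) :
  Clim_at f p l -> Clim_at g p m -> Clim_at (fun z => f z + g z)%C p (l + m)%C.
Proof.
  intros Hf Hg eps Heps.
  destruct (Hf (eps / 2) ltac:(lra)) as (d1 & D1 & F1).
  destruct (Hg (eps / 2) ltac:(lra)) as (d2 & D2 & F2).
  exists (Rmin d1 d2). split; [now apply Rmin_pos|]. intros z Hz Hzd.
  assert (L1 := Rmin_l d1 d2). assert (L2 := Rmin_r d1 d2).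
  specialize (F1 z Hz ltac:(lra)). specialize (F2 z Hz ltac:(lra)).
  replace (f z + g z - (l + m))%C with ((f z - l) + (g z - m))%C by ring.
  eapply Rle_trans; [apply Cmod_triangle|]. lra.
Qed.

Lemma Clim_at_mult (f g : C -> C) (p l m : C) :
  Clim_at f p l -> Clim_at g p m -> Clim_at (fun z => f z * g z)%C p (l * m)%C.
Proof.
  intros Hf Hg eps Heps.
  assert (Hl := Cmod_ge_0 l). assert (Hm := Cmod_ge_0 m).
  set (q := 2 * (Cmod l + Cmod m + 1)).
  assert (Hq : 0 < q) by (unfold q; lra).
  set (e := Rmin 1 (eps / q)).
  assert (He : 0 < e) by (apply Rmin_pos; [lra|now apply Rdiv_lt_0_compat]).
  assert (He1 : e <= 1) by apply Rmin_l.
  assert (He2 : e * q <= eps).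
  { apply Rle_trans with (eps / q * q); [apply Rmult_le_compat_r; [lra|apply Rmin_r]|].
    apply Req_le. field. lra. }
  destruct (Hf e He) as (d1 & D1 & F1). destruct (Hg e He) as (d2 & D2 & F2).
  exists (Rmin d1 d2). split; [now apply Rmin_pos|]. intros z Hz Hzd.
  assert (L1 := Rmin_l d1 d2). assert (L2 := Rmin_r d1 d2).
  specialize (F1 z Hz ltac:(lra)). specialize (F2 z Hz ltac:(lra)).
  replace (f z * g z - l * m)%C with
    ((f z - l) * (g z - m) + l * (g z - m) + (f z - l) * m)%C by ring.
  eapply Rle_trans; [apply Cmod_triangle|].
  eapply Rle_trans; [apply Rplus_le_compat_r, Cmod_triangle|].
  rewrite !Cmod_mult.
  assert (A1 := Cmod_ge_0 (f z - l)). assert (A2 := Cmod_ge_0 (g z - m)).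
  apply Rle_trans with (e * q); [|exact He2]. unfold q. nra.
Qed.

Lemma Clim_at_unique (f : C -> C) (p l m : C) : Clim_at f p l -> Clim_at f p m -> l = m.
Proof.
  intros Hf Hg.
  assert (E : Cmod (l - m) <= 0).
  { apply le_epsilon. intros eps Heps. rewrite Rplus_0_l.
    destruct (Hf (eps / 2) ltac:(lra)) as (d1 & D1 & F1).
    destruct (Hg (eps / 2) ltac:(lra)) as (d2 & D2 & F2).
    assert (Hd : 0 < Rmin d1 d2) by now apply Rmin_pos.
    assert (L1 := Rmin_l d1 d2). assert (L2 := Rmin_r d1 d2).
    set (z := (p + RtoC (Rmin d1 d2 / 2))%C).
    assert (Ez : (z - p)%C = RtoC (Rmin d1 d2 / 2)) by (unfold z; ring).
    assert (Hz : Cmod (z - p) = Rmin d1 d2 / 2).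
    { rewrite Ez, Cmod_R. apply Rabs_pos_eq. lra. }
    assert (Hzp : z <> p).
    { intros E. rewrite E in Hz. replace (p - p)%C with (RtoC 0) in Hz by ring.
      rewrite Cmod_0 in Hz. lra. }
    specialize (F1 z Hzp ltac:(lra)). specialize (F2 z Hzp ltac:(lra)).
    rewrite Cmod_minus_sym in F1.
    replace (l - m)%C with ((l - f z) + (f z - m))%C by ring.
    eapply Rle_trans; [apply Cmod_triangle|]. lra. }
  assert (E' : (l - m)%C = RtoC 0).
  { apply Cmod_eq_0, Rle_antisym; [exact E|apply Cmod_ge_0]. }
  replace l with ((l - m) + m)%C by ring. rewrite E'. ring.
Qed.

Lemma Clim_at_derive (f : C -> C) (p d : C) : is_Cderive f p d ->
  Clim_at (fun z => (f z - f p) / (z - p))%C p d.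
Proof.
  rewrite is_Cderive_eps. intros H eps Heps.
  destruct (H eps Heps) as (del & Hdel & H').
  exists del. split; [exact Hdel|]. intros z Hz Hzd.
  assert (Hzp := Cminus_neq_0 z p Hz).
  replace ((f z - f p) / (z - p) - d)%C with ((f z - f p - d * (z - p)) / (z - p))%C
    by (field; exact Hzp).
  rewrite Cmod_div by exact Hzp.
  apply Rle_div_l; [now apply Cmod_gt_0|]. now apply H'.
Qed.

Lemma Clim_at_inv (f : C -> C) (p l : C) : l <> RtoC 0 ->
  Clim_at f p l -> Clim_at (fun z => / f z)%C p (/ l)%C.
Proof.
  intros Hl Hf eps Heps.
  assert (Hd : ex_Cderive (fun w => / w)%C l) by (eexists; now apply is_Cderive_inv).
  destruct (ex_Cderive_continuous _ l Hd eps Heps) as (d & D & F).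
  destruct (Hf (d / 2) ltac:(lra)) as (d' & D' & F').
  exists d'. split; [exact D'|]. intros z Hz Hzd. apply Rlt_le, F.
  specialize (F' z Hz Hzd). lra.
Qed.

(** The inverse of the difference quotient of sin(pi z) at k, whose limit is (-1)^k pi; the sign is
    its own inverse. *)
Lemma Clim_at_inv_Csin (k : nat) :
  Clim_at (fun z => (z - INR k) / Csin (PI * z))%C (RtoC (INR k)) (RtoC ((-1) ^ k / PI)).
Proof.
  assert (HPI := PI_RGT_0).
  assert (Hk1 : (-1) ^ k * (-1) ^ k = 1) by (rewrite <- Rpow_mult_distr; replace (-1 * -1) with 1 by ring; apply pow1).
  assert (Hk0 : (-1) ^ k <> 0) by (apply pow_nonzero; lra).
  replace (RtoC ((-1) ^ k / PI)) with (/ RtoC ((-1) ^ k * PI))%C.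
  2:{ rewrite <- RtoC_inv by (apply Rmult_integral_contrapositive_currified; [exact Hk0|lra]). f_equal.
      replace (/ ((-1) ^ k * PI)) with ((-1) ^ k * (-1) ^ k / ((-1) ^ k * PI))
        by (rewrite Hk1; field; repeat split; (exact Hk0 || lra)).
      field; repeat split; (exact Hk0 || lra). }
  apply (Clim_at_ext (fun z => / ((Csin (PI * z) - Csin (PI * INR k)) / (z - INR k)))%C _ _ _ 1); [lra| |].
  - intros z Hz Hz1. rewrite Csin_PI_INR.
    assert (Hs : Csin (PI * z) <> RtoC 0).
    { apply (Csin_neq_0 (Z.of_nat k)); rewrite <- INR_IZR_INZ; [|exact Hz].
      assert (A := Rabs_fst_le_Cmod (z - INR k)). simpl in A.
      apply Rle_lt_trans with (2 := Hz1) in A. apply Rabs_lt_between in A. lra. }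
    replace (Csin (PI * z) - 0)%C with (Csin (PI * z)) by ring.
    field. split; [exact Hs|now apply Cminus_neq_0].
  - apply Clim_at_inv.
    + intros E. apply RtoC_inj in E. apply Rmult_integral in E. destruct E; [contradiction|lra].
    + apply (Clim_at_derive (fun w => Csin (PI * w))). apply is_Cderive_Csin_PI_INR.
Qed.

Lemma locally'_Cmod (p : C) (Q : C -> Prop) : locally' (T := C_UniformSpace) p Q ->
  exists e, 0 < e /\ forall z, z <> p -> Cmod (z - p) < e -> Q z.
Proof.
  intros H. apply (locally_Cmod p (fun z => z <> p -> Q z)) in H.
  destruct H as (e & He & H). exists e. split; auto.
Qed.

Lemma Clim_at_minus_pole (u : C -> C) (p : C) (m : nat) : analytic_at u p ->
  Clim_at (fun z => (z - p) ^ S m * u z)%C p (RtoC 0).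
Proof.
  intros Hu.
  assert (H : ex_Cderive (fun z => (z - p) ^ S m * u z)%C p).
  { apply ex_Cderive_mult; [|now apply analytic_at_ex_Cderive].
    apply (ex_Cderive_pow (fun z => z - p)%C).
    apply ex_Cderive_minus; [apply ex_Cderive_id|apply ex_Cderive_const]. }
  apply Clim_at_continuous in H. simpl in H.
  replace ((p - p) * (p - p) ^ m * u p)%C with (RtoC 0) in H; [exact H|].
  replace (p - p)%C with (RtoC 0) by ring. ring.
Qed.

(** Multiplication by (z - p)^(n+1) isolates the coefficient of the most singular term, which has
    index n. *)
Lemma Clim_at_principal_part (c : nat -> C) (p : C) (n : nat) :
  Clim_at (fun z => (z - p) ^ S n * Csum (fun j => c j / (z - p) ^ S j) n)%C p (c n).
Proof.
  induction n as [|n IH].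
  - apply (Clim_at_ext (fun _ => c 0%nat) _ _ _ 1); [lra| |].
    + intros z Hz _. rewrite sum_O. simpl. field. now apply Cminus_neq_0.
    + apply (Clim_at_continuous (fun _ => c 0%nat)), ex_Cderive_const.
  - assert (Hz1 : Clim_at (fun z => z - p)%C p (RtoC 0)).
    { assert (A := Clim_at_continuous (fun z => z - p)%C p).
      cbv beta in A. replace (p - p)%C with (RtoC 0) in A by ring. apply A.
      apply ex_Cderive_minus; [apply ex_Cderive_id|apply ex_Cderive_const]. }
    assert (A := Clim_at_plus _ _ _ _ _ (Clim_at_mult _ _ _ _ _ Hz1 IH)
      (Clim_at_continuous (fun _ => c (S n)) p (ex_Cderive_const _ p))).
    cbv beta in A. replace (0 * c n + c (S n))%C with (c (S n)) in A by ring.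
    revert A. apply Clim_at_ext with 1; [lra|].
    intros z Hz _. rewrite Csum_Sn. simpl. field.
    split; [apply Cpow_nz|]; now apply Cminus_neq_0.
Qed.

Lemma laurent_at_simple (h : C -> C) (p l : C) (n : nat) (c : nat -> C) :
  Clim_at (fun z => (z - p) * h z)%C p l -> laurent_at h p n c -> c 0%nat = l.
Proof.
  intros Hl. induction n as [|n IH]; intros (u & Hu & He).
  - apply locally'_Cmod in He. destruct He as (e & He0 & He).
    apply (Clim_at_unique (fun z => (z - p) * h z)%C p); [|exact Hl].
    assert (A := Clim_at_plus _ _ _ _ _ (Clim_at_principal_part c p 0) (Clim_at_minus_pole u p 0 Hu)).
    replace (c 0%nat + 0)%C with (c 0%nat) in A by ring.
    revert A. apply Clim_at_ext with e; [exact He0|].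
    intros z Hz Hze. rewrite (He z Hz Hze). simpl.
    match goal with |- context [sum_n ?a 0] => set (S0 := sum_n a 0 : C) end. ring.
  - assert (Hc : c (S n) = RtoC 0).
    { apply locally'_Cmod in He. destruct He as (e & He0 & He).
      apply (Clim_at_unique (fun z => (z - p) ^ S n * ((z - p) * h z))%C p).
      - assert (A := Clim_at_plus _ _ _ _ _ (Clim_at_principal_part c p (S n)) (Clim_at_minus_pole u p (S n) Hu)).
        replace (c (S n) + 0)%C with (c (S n)) in A by ring.
        revert A. apply Clim_at_ext with e; [exact He0|].
        intros z Hz Hze. rewrite (He z Hz Hze).
        match goal with |- context [sum_n ?a (S n)] => set (S0 := sum_n a (S n) : C) end.
        change ((z - p) ^ S (S n))%C with ((z - p) * (z - p) ^ S n)%C. ring.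
      - assert (A := Clim_at_mult _ _ _ _ _ (Clim_at_minus_pole (fun _ => RtoC 1) p n
          (filter_forall (F := locally (T := C_UniformSpace) p) _ (fun z => ex_Cderive_const _ z))) Hl).
        cbv beta in A. replace (0 * l)%C with (RtoC 0) in A by ring.
        revert A. apply Clim_at_ext with 1; [lra|]. intros z _ _. ring. }
    apply IH. exists u. split; [exact Hu|].
    revert He. apply filter_imp. intros z E. rewrite E, Csum_Sn, Hc.
    unfold Cdiv. rewrite Cmult_0_l.
    match goal with |- context [sum_n ?a n] => set (S0 := sum_n a n : C) end. ring.
Qed.

(** The value selected by iota is identified through uniqueness over expansions of all lengths. That
    it is not 0 later shows phi(0) <> 0. *)
Lemma Residue_simple_pole (h : C -> C) (p : C) : simple_pole_at h p ->
  Clim_at (fun z => (z - p) * h z)%C p (Residue h p) /\ Residue h p <> RtoC 0.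
Proof.
  intros (c & Hc & Hc0).
  assert (Hl : Clim_at (fun z => (z - p) * h z)%C p (c 0%nat)).
  { destruct Hc as (u & Hu & He).
    apply locally'_Cmod in He. destruct He as (e & He0 & He).
    assert (A := Clim_at_plus _ _ _ _ _ (Clim_at_principal_part c p 0) (Clim_at_minus_pole u p 0 Hu)).
    replace (c 0%nat + 0)%C with (c 0%nat) in A by ring.
    revert A. apply Clim_at_ext with e; [exact He0|].
    intros z Hz Hze. rewrite (He z Hz Hze). simpl.
    match goal with |- context [sum_n ?a 0] => set (S0 := sum_n a 0 : C) end. ring. }
  assert (E : Residue h p = c 0%nat).
  { unfold Residue. apply (iota_unique (V := C_CompleteNormedModule)).
    - intros r (n & c' & Hc' & ->). now apply (laurent_at_simple h p _ n c').
    - now exists 0%nat, c. }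
  rewrite E. now split.
Qed.

(** Near k, (z - k) h(-z) = (z - k) / sin(pi z) * phi(z). The minus sign comes from the reflection:
    -z - (-k) = -(z - k). *)
Lemma Residue_eq_phi (h phi : C -> C) (k : nat) :
  simple_pole_at h (- INR k)%C -> removes_singularities h phi ->
  Residue h (- INR k)%C = (- (RtoC ((-1) ^ k / PI) * phi (INR k)))%C.
Proof.
  intros Hp [H1 H2].
  apply Residue_simple_pole in Hp. destruct Hp as [Hp _].
  assert (Hphi := Clim_at_continuous phi _ (analytic_at_ex_Cderive _ _ (H2 k))).
  assert (A := Clim_at_mult _ _ _ _ _ (Clim_at_inv_Csin k) Hphi).
  assert (Hp' : Clim_at (fun z => - ((z - INR k) * h (- z)))%C (RtoC (INR k)) (Residue h (- INR k)%C)).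
  { intros eps Heps. destruct (Hp eps Heps) as (d & Hd & H).
    exists d. split; [exact Hd|]. intros z Hz Hzd.
    assert (E : (- z - - INR k = - (z - INR k))%C) by ring.
    specialize (H (- z)%C).
    replace (- ((z - INR k) * h (- z)))%C with ((- z - - INR k) * h (- z))%C by ring.
    apply H; [|now rewrite E, Cmod_opp].
    intros E'. apply Hz. replace z with (- - z)%C by ring. rewrite E'. ring. }
  assert (B : Clim_at (fun z => - ((z - INR k) * h (- z)))%C (RtoC (INR k))
    (- (1) * (RtoC ((-1) ^ k / PI) * phi (INR k)))%C).
  { assert (A' := Clim_at_mult _ _ _ _ _
      (Clim_at_continuous (fun _ => (- (1))%C) (RtoC (INR k)) (ex_Cderive_const _ _)) A).
    revert A'. apply Clim_at_ext with 1; [lra|].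
    intros z Hz Hz1.
    assert (Hs : fst z <> INR k \/ snd z <> 0).
    { destruct (Req_dec (fst z) (INR k)) as [E1|E1]; [|now left].
      destruct (Req_dec (snd z) 0) as [E2|E2]; [|now right].
      exfalso. apply Hz. destruct z; simpl in *; subst; reflexivity. }
    assert (A1 := Rabs_fst_le_Cmod (z - INR k)). simpl in A1.
    apply Rle_lt_trans with (2 := Hz1) in A1. apply Rabs_lt_between in A1.
    rewrite H1.
    - field. apply (Csin_neq_0 (Z.of_nat k)); rewrite <- INR_IZR_INZ; [lra|exact Hz].
    (* Within distance 1 of k the only natural number is k itself, so the defining equation of [phi]
       applies. *)
    - intros j Ej. apply Hz. rewrite Ej. do 2 f_equal.
      rewrite Ej in A1. simpl in A1.
      destruct A1 as [L1 L2].
      assert (M1 : INR k < INR (S j)) by (rewrite S_INR; lra).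
      assert (M2 : INR j < INR (S k)) by (rewrite S_INR; lra).
      apply INR_lt in M1, M2. lia. }
  rewrite (Clim_at_unique _ _ _ _ Hp' B). ring.
Qed.

(** * Ramanujan's master theorem *)

Lemma exp_pow (x : R) (k : nat) : exp x ^ k = exp (INR k * x).
Proof.
  induction k as [|k IH]; [simpl; rewrite Rmult_0_l, exp_0; reflexivity|].
  simpl pow. rewrite IH, <- exp_plus, S_INR. f_equal. ring.
Qed.

Section Ramanujan.

Variables (psi : C -> C) (delta C0 P A : R).
Hypotheses (Hdelta : 0 < delta < 1) (HA : 0 <= A < PI)
  (Hpsi : forall z : C, - delta <= fst z -> ex_Cderive psi z)
  (Hb : forall z : C, - delta <= fst z -> Cmod (psi z) <= C0 * exp (P * fst z + A * Rabs (snd z))).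

Let C0_pos : 0 <= C0.
Proof.
  assert (H := Hb (RtoC 0) ltac:(simpl; lra)). simpl in H.
  rewrite Rabs_R0, !Rmult_0_r, Rplus_0_l, exp_0, Rmult_1_r in H.
  eapply Rle_trans; [apply Cmod_ge_0|exact H].
Qed.

(** The q of the overview. Its values at the integers are arbitrary and only limits are taken
    there. *)
Definition quot (z : C) : C := (psi z / Csin (PI * z))%C.

Let PI_mult (x y : R) : (PI * (x, y))%C = (PI * x, PI * y).
Proof. unfold Cmult, RtoC; simpl. f_equal; ring. Qed.

Let quot_derive (z : C) : - delta <= fst z -> Csin (PI * z) <> RtoC 0 -> ex_Cderive quot z.
Proof.
  intros Hz H0. apply ex_Cderive_div; [exact H0|now apply Hpsi|].
  eexists. apply is_Cderive_Csin_PI.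
Qed.

Let Csin_line (c w : R) : sin (PI * c) <> 0 ->
  Rabs (sin (PI * c)) / 2 * exp (PI * Rabs w) <= Cmod (Csin (PI * (c, w))).
Proof.
  intros Hc. rewrite PI_mult. assert (HPI := PI_RGT_0).
  eapply Rle_trans; [|apply Cmod_Csin_ge_sin].
  rewrite Rabs_mult, (Rabs_pos_eq PI) by lra. lra.
Qed.

Let Csin_line_neq_0 (c w : R) : sin (PI * c) <> 0 -> Csin (PI * (c, w)) <> RtoC 0.
Proof.
  intros Hc. apply Cmod_gt_0. eapply Rlt_le_trans; [|now apply Csin_line].
  apply Rmult_lt_0_compat; [|apply exp_pos].
  assert (H := Rabs_pos_lt _ Hc). lra.
Qed.

Let quot_le (z : C) (m : R) : - delta <= fst z -> 0 < m ->
  m * exp (PI * Rabs (snd z)) <= Cmod (Csin (PI * z)) ->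
  Cmod (quot z) <= C0 / m * exp (P * fst z) * exp (- (PI - A) * Rabs (snd z)).
Proof.
  intros Hz Hm Hs. unfold quot.
  assert (He := exp_pos (PI * Rabs (snd z))).
  assert (Hs0 : 0 < Cmod (Csin (PI * z))) by nra.
  rewrite Cmod_div by now apply Cmod_gt_0.
  apply Rle_div_l; [exact Hs0|].
  eapply Rle_trans; [now apply Hb|].
  apply Rle_trans with (C0 / m * exp (P * fst z) * exp (- (PI - A) * Rabs (snd z)) *
    (m * exp (PI * Rabs (snd z)))).
  - replace (P * fst z + A * Rabs (snd z)) with
      (P * fst z + (- (PI - A) * Rabs (snd z) + PI * Rabs (snd z))) by ring.
    rewrite !exp_plus. apply Req_le. field. lra.
  - apply Rmult_le_compat_l; [|exact Hs].
    repeat apply Rmult_le_pos; try (apply Rlt_le, exp_pos); [exact C0_pos|].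
    apply Rlt_le, Rinv_0_lt_compat, Hm.
Qed.

Let quot_line (c w : R) : - delta <= c -> sin (PI * c) <> 0 ->
  Cmod (quot (c, w)) <= C0 / (Rabs (sin (PI * c)) / 2) * exp (P * c) * exp (- (PI - A) * Rabs w).
Proof.
  intros Hc Hs. apply (quot_le (c, w)); [exact Hc| |now apply Csin_line].
  assert (H := Rabs_pos_lt _ Hs). lra.
Qed.

(** The horizontal sides of a rectangle cross abscissas where sin(pi Re z) = 0, so here the
    hyperbolic sine gives the bound, with the uniform constant 1/4 from height 1 on. *)
Let quot_far (z : C) : - delta <= fst z -> 1 <= Rabs (snd z) ->
  Cmod (quot z) <= C0 / (/ 4) * exp (P * fst z) * exp (- (PI - A) * Rabs (snd z)).
Proof.
  intros Hz Hw. apply quot_le; [exact Hz|lra|].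
  destruct z as [x y]. rewrite PI_mult. simpl in *.
  assert (H3 := PI2_3_2).
  assert (E : Rabs (PI * y) = PI * Rabs y) by (rewrite Rabs_mult, (Rabs_pos_eq PI); lra).
  eapply Rle_trans; [|apply Cmod_Csin_ge_sinh].
  eapply Rle_trans; [|apply Rabs_sinh_ge; rewrite E; nra].
  rewrite E. lra.
Qed.

Let line_M (c : R) : - delta <= c -> sin (PI * c) <> 0 ->
  0 <= C0 / (Rabs (sin (PI * c)) / 2) * exp (P * c).
Proof.
  intros Hc Hs. assert (H := Rabs_pos_lt _ Hs).
  apply Rmult_le_pos; [|apply Rlt_le, exp_pos]. apply Rdiv_le_0_compat; [exact C0_pos|lra].
Qed.

(* [e] may add a pole at [p]: it is entire for [barnes], but not for [mellin]. *)
Lemma quot_shift (e : C -> C) (a b E theta W : R) (p r : C) :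
  - delta <= a -> a < fst p < b -> sin (PI * a) <> 0 -> sin (PI * b) <> 0 ->
  theta < PI - A -> 0 <= E ->
  (forall z : C, a <= fst z <= b -> z <> p -> Csin (PI * z) <> RtoC 0 /\ ex_Cderive e z) ->
  (forall z : C, a <= fst z <= b -> fst z = a \/ fst z = b \/ W <= Rabs (snd z) ->
     Cmod (e z) <= E * exp (theta * Rabs (snd z))) ->
  Clim_at (fun z => (z - p) * (quot z * e z))%C p r ->
  (line_int (fun z => quot z * e z)%C b - line_int (fun z => quot z * e z)%C a = 2 * PI * r)%C.
Proof.
  intros Ha Hp Hsa Hsb Ht HE0 He HE Hr.
  assert (Hf : forall z : C, a <= fst z <= b -> z <> p -> ex_Cderive (fun z => quot z * e z)%C z).
  { intros z Hz Hzp. destruct (He z Hz Hzp). apply ex_Cderive_mult; [apply quot_derive|]; auto; lra. }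
  assert (HL : forall c, c = a \/ c = b -> is_Clim_seq (line_sum (fun z => quot z * e z)%C c)
    (line_int (fun z => quot z * e z)%C c)).
  { intros c Hc.
    assert (Hc0 : - delta <= c) by (destruct Hc; subst; lra).
    assert (Hsc : sin (PI * c) <> 0) by (destruct Hc; subst; assumption).
    apply (line_int_correct _ c (C0 / (Rabs (sin (PI * c)) / 2) * exp (P * c) * E) (PI - A - theta)).
    - lra.
    - apply Rmult_le_pos; [now apply line_M|exact HE0].
    - intros w. apply Hf; [simpl; destruct Hc; subst; lra|].
      apply C_neq_fst. simpl. destruct Hc; subst; lra.
    - intros w. rewrite Cmod_mult.
      replace (- (PI - A - theta) * Rabs w) with (- (PI - A) * Rabs w + theta * Rabs w) by ring.
      rewrite exp_plus.
      eapply Rle_trans; [apply Rmult_le_compat; [apply Cmod_ge_0|apply Cmod_ge_0|now apply quot_line|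
        apply (HE (c, w)); simpl; [destruct Hc; subst; lra|tauto]]|].
      simpl. apply Req_le. ring. }
  set (B := exp (Rabs P * (Rabs a + Rabs b))).
  (* [quot_far] starts at height 1, the bound on [e] at height [W]; [B] bounds e^(P Re z) over the
     strip. *)
  apply (residue_strip (fun z => quot z * e z)%C p r _ _ a b (C0 / (/ 4) * B * E) (PI - A - theta) (Rmax 1 W)); auto.
  - lra.
  - intros z Hz Hw. rewrite Cmod_mult.
    assert (W1 := Rmax_l 1 W). assert (W2 := Rmax_r 1 W).
    replace (- (PI - A - theta) * Rabs (snd z)) with
      (- (PI - A) * Rabs (snd z) + theta * Rabs (snd z)) by ring.
    rewrite exp_plus.
    replace (C0 / / 4 * B * E * (exp (- (PI - A) * Rabs (snd z)) * exp (theta * Rabs (snd z))))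
      with ((C0 / / 4 * B * exp (- (PI - A) * Rabs (snd z))) * (E * exp (theta * Rabs (snd z)))) by ring.
    apply Rmult_le_compat; [apply Cmod_ge_0|apply Cmod_ge_0| |apply HE; [exact Hz|right; right; lra]].
    eapply Rle_trans; [apply quot_far; lra|].
    apply Rmult_le_compat_r; [apply Rlt_le, exp_pos|].
    apply Rmult_le_compat_l; [lra|]. unfold B. apply exp_le.
    eapply Rle_trans; [apply Rle_abs|]. rewrite Rabs_mult.
    apply Rmult_le_compat_l; [apply Rabs_pos|].
    assert (A1 := Rle_abs a). assert (A2 := Rle_abs (- a)). rewrite Rabs_Ropp in A2.
    assert (A3 := Rle_abs b). assert (A4 := Rle_abs (- b)). rewrite Rabs_Ropp in A4.
    apply Rabs_le. assert (A5 := Rabs_pos a). assert (A6 := Rabs_pos b). lra.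
Qed.

Let exp_kernel_le (z y : C) (a b : R) : a <= fst z <= b ->
  Cmod (Cexp ((z + 0) * y)) <= exp ((Rabs a + Rabs b) * Rabs (fst y)) * exp (Rabs (snd y) * Rabs (snd z)).
Proof.
  intros Hz. rewrite Cmod_Cexp, <- exp_plus. apply exp_le. simpl.
  rewrite !Rplus_0_r.
  assert (H1 : fst z * fst y <= (Rabs a + Rabs b) * Rabs (fst y)).
  { eapply Rle_trans; [apply Rle_abs|]. rewrite Rabs_mult.
    apply Rmult_le_compat_r; [apply Rabs_pos|].
    assert (A1 := Rle_abs a). assert (A2 := Rle_abs (- a)). rewrite Rabs_Ropp in A2.
    assert (A3 := Rle_abs b). assert (A4 := Rle_abs (- b)). rewrite Rabs_Ropp in A4.
    apply Rabs_le. assert (A5 := Rabs_pos a). assert (A6 := Rabs_pos b). lra. }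
  assert (H2 : - (snd z * snd y) <= Rabs (snd y) * Rabs (snd z)).
  { eapply Rle_trans; [apply Rle_abs|]. rewrite Rabs_Ropp, Rabs_mult. lra. }
  lra.
Qed.

Let exp_kernel_derive (s y z : C) : ex_Cderive (fun z => Cexp ((z + s) * y))%C z.
Proof.
  apply ex_Cderive_Cexp, ex_Cderive_mult; [|apply ex_Cderive_const].
  apply ex_Cderive_plus; [apply ex_Cderive_id|apply ex_Cderive_const].
Qed.

(* [z + 0] instead of [z] makes this an instance of [is_Cderive_line_int]. *)
Definition barnes (c : R) (y : C) : C := line_int (fun z => quot z * Cexp ((z + 0) * y))%C c.

Lemma barnes_shift (a b : R) (y p r : C) :
  - delta <= a -> a < fst p < b -> sin (PI * a) <> 0 -> sin (PI * b) <> 0 ->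
  Rabs (snd y) < PI - A ->
  (forall z : C, a <= fst z <= b -> z <> p -> Csin (PI * z) <> RtoC 0) ->
  Clim_at (fun z => (z - p) * (quot z * Cexp ((z + 0) * y)))%C p r ->
  (barnes b y - barnes a y = 2 * PI * r)%C.
Proof.
  intros Ha Hp Hsa Hsb Hy Hs Hr.
  apply (quot_shift (fun z => Cexp ((z + 0) * y))%C a b (exp ((Rabs a + Rabs b) * Rabs (fst y))) (Rabs (snd y)) 0 p r); auto.
  apply Rlt_le, exp_pos.
Qed.

Let sin_neg_neq_0 (c : R) : 0 < c < delta -> sin (PI * - c) <> 0.
Proof.
  intros Hc. assert (HPI := PI_RGT_0).
  replace (PI * - c) with (- (PI * c)) by ring. rewrite sin_neg.
  assert (H : 0 < sin (PI * c)) by (apply sin_gt_0; nra). lra.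
Qed.

(** On the lines Re z = k + 1/2 the bound on the quotient thus has a constant independent of k, as
    the passage to infinity requires. *)
Let sin_half (k : nat) : Rabs (sin (PI * (INR k + / 2))) = 1.
Proof.
  replace (PI * (INR k + / 2)) with (PI / 2 + PI * INR k) by field.
  rewrite <- cos_sin. destruct (sin_cos_INR_PI k) as [_ ->]. apply pow_1_abs.
Qed.

Let sin_half_neq_0 (k : nat) : sin (PI * (INR k + / 2)) <> 0.
Proof. intros E. assert (H := sin_half k). rewrite E, Rabs_R0 in H. lra. Qed.

Lemma barnes_indep (c c' : R) (y : C) : 0 < c < delta -> 0 < c' < delta ->
  Rabs (snd y) < PI - A -> barnes (- c) y = barnes (- c') y.
Proof.
  intros Hc Hc' Hy.
  assert (H : forall a b, 0 < a < delta -> 0 < b < a -> barnes (- b) y = barnes (- a) y).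
  { intros a b Ha Hba.
    assert (Hn : forall z, - a <= fst z <= - b -> Csin (PI * z) <> RtoC 0).
    { intros z Hz. apply (Csin_neq_0 0); [simpl; lra|]. apply C_neq_fst. simpl. lra. }
    (* Between the two lines there is no pole; the shift lemma is fed the midpoint, a regular point
       with residue 0. *)
    set (p := (- (a + b) / 2, 0) : C).
    assert (E := barnes_shift (- a) (- b) y p (RtoC 0)).
    rewrite Cmult_0_r in E.
    replace (barnes (- b) y) with ((barnes (- b) y - barnes (- a) y) + barnes (- a) y)%C by ring.
    rewrite E; [ring|lra|simpl; lra|apply sin_neg_neq_0; lra|apply sin_neg_neq_0; lra|exact Hy|now auto|].
    assert (Hd : ex_Cderive (fun z => (z - p) * (quot z * Cexp ((z + 0) * y)))%C p).
    { apply ex_Cderive_mult.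
      - apply ex_Cderive_minus; [apply ex_Cderive_id|apply ex_Cderive_const].
      - apply ex_Cderive_mult; [|apply exp_kernel_derive].
        apply quot_derive; [simpl; lra|]. apply Hn. simpl. lra. }
    apply Clim_at_continuous in Hd. cbv beta in Hd.
    replace (p - p)%C with (RtoC 0) in Hd by ring. rewrite Cmult_0_l in Hd. exact Hd. }
  destruct (Rtotal_order c c') as [L|[->|L]]; [apply H; lra|reflexivity|symmetry; apply H; lra].
Qed.

Definition coef (k : nat) : C := (- (RtoC ((-1) ^ k / PI) * psi (INR k)))%C.

Let quot_pole (k : nat) (y : C) :
  Clim_at (fun z => (z - INR k) * (quot z * Cexp ((z + 0) * y)))%C (RtoC (INR k))
    (- (coef k * Cexp (INR k * y)))%C.
Proof.
  assert (Hk := pos_INR k).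
  assert (H1 := Clim_at_continuous psi (RtoC (INR k)) (Hpsi (RtoC (INR k)) ltac:(simpl; lra))).
  assert (H2 := Clim_at_continuous _ (RtoC (INR k)) (exp_kernel_derive (RtoC 0) y (RtoC (INR k)))).
  assert (H := Clim_at_mult _ _ _ _ _ (Clim_at_mult _ _ _ _ _ (Clim_at_inv_Csin k) H1) H2).
  cbv beta in H. unfold coef.
  replace (- (- (RtoC ((-1) ^ k / PI) * psi (INR k)) * Cexp (INR k * y)))%C with
    (RtoC ((-1) ^ k / PI) * psi (INR k) * Cexp ((INR k + 0) * y))%C.
  - revert H. apply Clim_at_ext with 1; [lra|]. intros z _ _. unfold quot, Cdiv. ring.
  - replace (INR k + 0)%C with (RtoC (INR k)) by ring. ring.
Qed.

Lemma barnes_pole (k : nat) (a : R) (y : C) : - delta <= a -> INR k - 1 < a < INR k ->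
  sin (PI * a) <> 0 -> Rabs (snd y) < PI - A ->
  (barnes (INR k + / 2) y - barnes a y = - (2 * PI * (coef k * Cexp (INR k * y))))%C.
Proof.
  intros Ha Hak Hs Hy.
  rewrite (barnes_shift a (INR k + / 2) y (RtoC (INR k)) (- (coef k * Cexp (INR k * y)))%C); auto.
  - ring.
  - simpl. lra.
  - intros z Hz Hzk. apply (Csin_neq_0 (Z.of_nat k)); rewrite <- INR_IZR_INZ; [lra|exact Hzk].
Qed.

(** Moving the line from -c to 1/2, then one unit at a time, crosses exactly one integer in each
    move; the line n + 1/2 has the n + 1 poles 0, ..., n behind it. *)
Lemma barnes_sum (c : R) (y : C) (n : nat) : 0 < c < delta -> Rabs (snd y) < PI - A ->
  (barnes (INR n + / 2) y - barnes (- c) y =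
   - (2 * PI * Csum (fun k => coef k * Cexp (INR k * y)) n))%C.
Proof.
  intros Hc Hy. induction n as [|n IH].
  - rewrite sum_O. apply barnes_pole; auto; simpl; lra.
  - assert (H := barnes_pole (S n) (INR n + / 2) y). rewrite S_INR in *.
    assert (Hn := pos_INR n).
    specialize (H ltac:(lra) ltac:(lra) ltac:(auto) Hy).
    replace (barnes (INR n + 1 + / 2) y - barnes (- c) y)%C with
      ((barnes (INR n + 1 + / 2) y - barnes (INR n + / 2) y) + (barnes (INR n + / 2) y - barnes (- c) y))%C
      by ring.
    rewrite H, IH, Csum_Sn, S_INR.
    match goal with |- context [sum_n ?a n] => set (S0 := sum_n a n : C) end. ring.
Qed.

Let barnes_bound (c : R) (y : C) (w : R) : - delta <= c -> sin (PI * c) <> 0 ->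
  Cmod (quot (c, w) * Cexp (((c, w) + 0) * y)) <=
  C0 / (Rabs (sin (PI * c)) / 2) * exp (P * c) * exp (c * fst y) *
    exp (- (PI - A - Rabs (snd y)) * Rabs w).
Proof.
  intros Hc Hs. rewrite Cmod_mult, Cmod_Cexp.
  apply Rle_trans with (C0 / (Rabs (sin (PI * c)) / 2) * exp (P * c) * exp (- (PI - A) * Rabs w) *
    (exp (c * fst y) * exp (Rabs (snd y) * Rabs w))).
  - apply Rmult_le_compat; [apply Cmod_ge_0|apply Rlt_le, exp_pos|now apply quot_line|].
    rewrite <- exp_plus. apply exp_le. simpl. rewrite !Rplus_0_r.
    assert (H : - (w * snd y) <= Rabs (snd y) * Rabs w).
    { eapply Rle_trans; [apply Rle_abs|]. rewrite Rabs_Ropp, Rabs_mult. lra. }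
    lra.
  - replace (- (PI - A - Rabs (snd y)) * Rabs w) with
      (- (PI - A) * Rabs w + Rabs (snd y) * Rabs w) by ring.
    rewrite (exp_plus (- (PI - A) * Rabs w)). apply Req_le. ring.
Qed.

Let barnes_line_derive (s y : C) (c w : R) : - delta <= c -> sin (PI * c) <> 0 ->
  ex_Cderive (fun z => quot z * Cexp ((z + s) * y))%C (c, w).
Proof.
  intros Hc Hs. apply ex_Cderive_mult; [|apply exp_kernel_derive].
  apply quot_derive; [exact Hc|now apply Csin_line_neq_0].
Qed.

(** The integral left over along Re z = n + 1/2 is of order e^((P + Re y)(n + 1/2)), with a constant
    independent of n by [sin_half], and tends to 0 when Re y < -P. *)
Lemma barnes_series (c : R) (y : C) : 0 < c < delta -> Rabs (snd y) < PI - A -> fst y < - P ->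
  is_Clim_seq (fun n => Csum (fun k => coef k * Cexp (INR k * y)) n)%C
    (RtoC (/ (2 * PI)) * barnes (- c) y)%C.
Proof.
  intros Hc Hy Hy1. assert (HPI := PI_RGT_0).
  set (kappa := PI - A - Rabs (snd y)). assert (Hk : 0 < kappa) by (unfold kappa; lra).
  apply (is_lim_seq_squeeze_0 _ (fun n => / (2 * PI) * (2 * (C0 / (1 / 2)) / kappa * exp ((P + fst y) * / 2))
    * exp (- (- (P + fst y)) * INR n))).
  - intros n. split; [apply Cmod_ge_0|].
    assert (H := barnes_sum c y n Hc Hy).
    set (S0 := (Csum (fun k => coef k * Cexp (INR k * y)) n)%C : C) in *.
    assert (H2P : RtoC (2 * PI) <> RtoC 0) by (intros E; apply RtoC_inj in E; lra).
    assert (E : (S0 - RtoC (/ (2 * PI)) * barnes (- c) y =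
      - (RtoC (/ (2 * PI)) * barnes (INR n + / 2) y))%C).
    { replace (barnes (INR n + / 2) y) with
        (barnes (- c) y + (barnes (INR n + / 2) y - barnes (- c) y))%C by ring.
      rewrite H, RtoC_inv, RtoC_mult by lra. rewrite RtoC_mult in H2P. field;
      repeat split; intros E; apply RtoC_inj in E; lra. }
    rewrite E, Cmod_opp, Cmod_mult, Cmod_R, Rabs_pos_eq
      by (apply Rlt_le, Rinv_0_lt_compat; lra).
    rewrite Rmult_assoc. apply Rmult_le_compat_l; [apply Rlt_le, Rinv_0_lt_compat; lra|].
    assert (Hn := pos_INR n).
    assert (B := Cmod_line_int_le (fun z => quot z * Cexp ((z + 0) * y))%C (INR n + / 2)
      (C0 / (Rabs (sin (PI * (INR n + / 2))) / 2) * exp (P * (INR n + / 2)) * exp ((INR n + / 2) * fst y))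
      kappa Hk).
    eapply Rle_trans; [apply B|].
    + apply Rmult_le_pos; [|apply Rlt_le, exp_pos]. apply line_M; [lra|auto].
    + intros w. apply barnes_line_derive; [lra|auto].
    + intros w. apply barnes_bound; [lra|auto].
    + rewrite sin_half.
      replace (2 * (C0 / (1 / 2)) / kappa * exp ((P + fst y) * / 2) * exp (- - (P + fst y) * INR n))
        with (2 * (C0 / (1 / 2)) / kappa * (exp ((P + fst y) * / 2) * exp (- - (P + fst y) * INR n))) by ring.
      rewrite <- exp_plus.
      replace (C0 / (1 / 2) * exp (P * (INR n + / 2)) * exp ((INR n + / 2) * fst y)) with
        (C0 / (1 / 2) * (exp (P * (INR n + / 2)) * exp ((INR n + / 2) * fst y))) by ring.
      rewrite <- exp_plus.
      replace (P * (INR n + / 2) + (INR n + / 2) * fst y) with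
        ((P + fst y) * / 2 + - - (P + fst y) * INR n) by ring.
      apply Req_le. field. lra.
  - apply is_lim_seq_mult_0, is_lim_seq_exp_opp. lra.
Qed.

(* F in the variable y = ln x. *)
Definition master (y : C) : C := (RtoC (/ (2 * PI)) * barnes (- (delta / 2)) y)%C.

Let half_delta : 0 < delta / 2 < delta.
Proof. lra. Qed.

Lemma ex_Cderive_master (y : C) : Rabs (snd y) < PI - A -> ex_Cderive master y.
Proof.
  intros Hy. apply ex_Cderive_mult; [apply ex_Cderive_const|].
  assert (Hs := sin_neg_neq_0 _ half_delta).
  eexists. apply (is_Cderive_line_int quot (- (delta / 2))
    (C0 / (Rabs (sin (PI * - (delta / 2))) / 2) * exp (P * - (delta / 2))) (PI - A)); auto.
  - apply line_M; [lra|auto].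
  - intros w. apply quot_derive; [simpl; lra|now apply Csin_line_neq_0].
  - intros w. apply quot_line; [lra|auto].
Qed.

Lemma Cmod_coef_le (k : nat) : Cmod (coef k) <= C0 / PI * exp (P * INR k).
Proof.
  assert (HPI := PI_RGT_0). assert (Hk := pos_INR k).
  unfold coef. rewrite Cmod_opp, Cmod_mult, Cmod_R.
  unfold Rdiv at 1. rewrite Rabs_mult, pow_1_abs, Rabs_pos_eq, Rmult_1_l
    by (apply Rlt_le, Rinv_0_lt_compat; lra).
  assert (H := Hb (RtoC (INR k)) ltac:(simpl; lra)). simpl in H.
  rewrite Rabs_R0, Rmult_0_r, Rplus_0_r in H.
  replace (C0 / PI * exp (P * INR k)) with (/ PI * (C0 * exp (P * INR k))) by (field; lra).
  apply Rmult_le_compat_l; [apply Rlt_le, Rinv_0_lt_compat; lra|exact H].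
Qed.

(** The coefficients are O(e^(Pk)), which makes the radius positive. It may well exceed e^(-P), so
    that [barnes_series] alone does not reach every x below it. *)
Lemma exp_opp_le_CV_radius : Rbar_le (exp (- P)) (CV_radius (fun k => Cmod (coef k))).
Proof.
  apply (CV_radius_bounded (fun k => Cmod (coef k))).
  exists (C0 / PI). intros k.
  rewrite exp_pow, Rabs_pos_eq by (apply Rmult_le_pos; [apply Cmod_ge_0|apply Rlt_le, exp_pos]).
  eapply Rle_trans; [apply Rmult_le_compat_r; [apply Rlt_le, exp_pos|apply Cmod_coef_le]|].
  rewrite Rmult_assoc, <- exp_plus.
  replace (P * INR k + INR k * - P) with 0 by ring. rewrite exp_0. lra.
Qed.

(** For Re z < min(-P, r) both sides are limits of the same partial sums. Their difference is
    holomorphic for Re z < r and |Im z| < pi - A, so it vanishes at y as well. *)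
Lemma master_eq_series (y r : R) : y < r ->
  ex_series (fun k => Cmod (coef k) * exp (INR k * r)) ->
  master (RtoC y) = exp_series coef (RtoC y).
Proof.
  intros Hyr Hr.
  (* Half the distance keeps the closed strip strictly inside the domains of both functions. *)
  set (theta := Rmin (r - y) (PI - A) / 2).
  assert (T1 := Rmin_l (r - y) (PI - A)). assert (T2 := Rmin_r (r - y) (PI - A)).
  assert (T3 : 0 < Rmin (r - y) (PI - A)) by (apply Rmin_pos; lra).
  assert (E : (master (RtoC y) - exp_series coef (RtoC y))%C = RtoC 0).
  { apply (vanish_on_strip (fun z => master z - exp_series coef z)%C y theta (Rmin (- P) r)).
    - unfold theta. lra.
    - intros z Hz1 Hz2. apply ex_Cderive_minus.
      + apply ex_Cderive_master. unfold theta in Hz2. lra.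
      + apply (ex_Cderive_exp_series _ r); [exact Hr|]. unfold theta in Hz1. lra.
    - intros z Hz1 Hz2.
      assert (L1 := Rmin_l (- P) r). assert (L2 := Rmin_r (- P) r).
      assert (B := barnes_series (delta / 2) z half_delta ltac:(unfold theta in Hz2; lra) ltac:(lra)).
      assert (B' := exp_series_correct coef r z Hr ltac:(lra)).
      unfold master. rewrite (is_Clim_seq_unique _ _ _ B B'). ring. }
  replace (master (RtoC y)) with ((master (RtoC y) - exp_series coef (RtoC y)) + exp_series coef (RtoC y))%C
    by ring.
  rewrite E. ring.
Qed.

(* K_c of the header. *)
Definition mellin (c : R) (s y : C) : C :=
  (RtoC (/ (2 * PI)) * line_int (fun z => quot z / (z + s) * Cexp ((z + s) * y)) (- c))%C.

Let shift_neq_0 (c w : R) (s : C) : c <> fst s -> (((- c)%R, w) + s)%C <> RtoC 0.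
Proof. intros H. apply C_neq_fst. simpl. lra. Qed.

Let Cmod_shift_ge (c w : R) (s : C) : Rabs (fst s - c) <= Cmod (((- c)%R, w) + s).
Proof.
  eapply Rle_trans; [|apply Rabs_fst_le_Cmod]. simpl. right. f_equal. ring.
Qed.

Let quot_div_derive (c w : R) (s : C) : 0 < c < delta -> c <> fst s ->
  ex_Cderive (fun z => quot z / (z + s))%C ((- c)%R, w).
Proof.
  intros Hc Hs. apply ex_Cderive_div; [now apply shift_neq_0| |].
  - apply quot_derive; [simpl; lra|]. apply Csin_line_neq_0. now apply sin_neg_neq_0.
  - apply ex_Cderive_plus; [apply ex_Cderive_id|apply ex_Cderive_const].
Qed.

Let quot_div_le (c w : R) (s : C) : 0 < c < delta -> c <> fst s ->
  Cmod (quot ((- c)%R, w) / (((- c)%R, w) + s)) <=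
  C0 / (Rabs (sin (PI * - c)) / 2) * exp (P * - c) / Rabs (fst s - c) * exp (- (PI - A) * Rabs w).
Proof.
  intros Hc Hs. rewrite Cmod_div by now apply shift_neq_0.
  assert (H0 : 0 < Rabs (fst s - c)) by (apply Rabs_pos_lt; lra).
  match goal with |- _ <= ?X / ?Y * ?Z =>
    replace (X / Y * Z) with (X * Z * / Y) by (unfold Rdiv; ring) end.
  apply Rmult_le_compat; [apply Cmod_ge_0| | |].
  - apply Rlt_le, Rinv_0_lt_compat. eapply Rlt_le_trans; [exact H0|apply Cmod_shift_ge].
  - apply quot_line; [lra|now apply sin_neg_neq_0].
  - apply Rinv_le_contravar; [exact H0|apply Cmod_shift_ge].
Qed.

Let mellin_M (c : R) (s : C) : 0 < c < delta -> c <> fst s ->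
  0 <= C0 / (Rabs (sin (PI * - c)) / 2) * exp (P * - c) / Rabs (fst s - c).
Proof.
  intros Hc Hs.
  apply Rdiv_le_0_compat; [|apply Rabs_pos_lt; lra].
  apply line_M; [lra|now apply sin_neg_neq_0].
Qed.

(** Differentiation brings down z + s, which cancels the denominator; e^(sy) leaves the integral,
    and what remains does not depend on c by [barnes_indep]. Hence all admissible c give
    antiderivatives of one function. *)
Lemma is_Cderive_mellin (c : R) (s y : C) : 0 < c < delta -> c <> fst s ->
  Rabs (snd y) < PI - A -> is_Cderive (mellin c s) y (Cexp (s * y) * master y)%C.
Proof.
  intros Hc Hs Hy.
  assert (Hsin := sin_neg_neq_0 c Hc).
  assert (D := is_Cderive_line_int (fun z => quot z / (z + s))%C (- c) _ (PI - A) s y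
    (mellin_M c s Hc Hs) (fun w => quot_div_derive c w s Hc Hs)
    (fun w => quot_div_le c w s Hc Hs) Hy).
  assert (E : line_int (fun z => (z + s) * (quot z / (z + s) * Cexp ((z + s) * y)))%C (- c) =
              (Cexp (s * y) * barnes (- c) y)%C).
  { rewrite (line_int_ext _ (fun z => Cexp (s * y) * (quot z * Cexp ((z + 0) * y)))%C).
    - apply (line_int_mult (fun z => quot z * Cexp ((z + 0) * y))%C (Cexp (s * y)) (- c)
        (C0 / (Rabs (sin (PI * - c)) / 2) * exp (P * - c) * exp (- c * fst y))
        (PI - A - Rabs (snd y))).
      + lra.
      + apply Rmult_le_pos; [|apply Rlt_le, exp_pos]. apply line_M; [lra|exact Hsin].
      + intros w. apply barnes_line_derive; [lra|exact Hsin].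
      + intros w. apply barnes_bound; [lra|exact Hsin].
    - intros w. replace ((((- c)%R, w) + s) * y)%C with (s * y + (((- c)%R, w) + 0) * y)%C by ring.
      rewrite Cexp_plus.
      set (z := (((- c)%R, w) : C)). assert (Hz : (z + s)%C <> RtoC 0) by now apply shift_neq_0.
      generalize (Cexp (s * y)) (Cexp ((z + 0) * y)) (quot z). intros e1 e2 q. field. exact Hz. }
  cbv beta in D. rewrite E, (barnes_indep c (delta / 2) y Hc half_delta Hy) in D.
  unfold master.
  replace (Cexp (s * y) * (RtoC (/ (2 * PI)) * barnes (- (delta / 2)) y))%C with
    (RtoC (/ (2 * PI)) * (Cexp (s * y) * barnes (- (delta / 2)) y))%C by ring.
  apply (is_Cderive_comp (fun w => RtoC (/ (2 * PI)) * w)%C); [apply is_Cderive_linear|exact D].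
Qed.

(** For real y, the modulus of e^((z+s)y) is constant along the line Re z = -c, namely e^((Re s - c)
    y); the sign of Re s - c decides at which end the bound tends to 0. *)
Lemma Cmod_mellin_le (c : R) (s : C) : 0 < c < delta -> c <> fst s ->
  exists M, forall y : R, Cmod (mellin c s (RtoC y)) <= M * exp ((fst s - c) * y).
Proof.
  intros Hc Hs. assert (HPI := PI_RGT_0).
  set (M0 := C0 / (Rabs (sin (PI * - c)) / 2) * exp (P * - c) / Rabs (fst s - c)).
  exists (/ (2 * PI) * (2 * M0 / (PI - A))). intros y.
  unfold mellin. rewrite Cmod_mult, Cmod_R, Rabs_pos_eq by (apply Rlt_le, Rinv_0_lt_compat; lra).
  rewrite Rmult_assoc. apply Rmult_le_compat_l; [apply Rlt_le, Rinv_0_lt_compat; lra|].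
  replace (2 * M0 / (PI - A) * exp ((fst s - c) * y)) with
    (2 * (M0 * exp ((fst s - c) * y)) / (PI - A)) by (field; lra).
  apply Cmod_line_int_le.
  - lra.
  - apply Rmult_le_pos; [now apply mellin_M|apply Rlt_le, exp_pos].
  - intros w. apply ex_Cderive_mult; [now apply quot_div_derive|apply exp_kernel_derive].
  - intros w. rewrite Cmod_mult, Cmod_Cexp.
    replace (M0 * exp ((fst s - c) * y) * exp (- (PI - A) * Rabs w)) with
      (M0 * exp (- (PI - A) * Rabs w) * exp ((fst s - c) * y)) by ring.
    replace (fst ((((- c)%R, w) + s) * y)%C) with ((fst s - c) * y) by (simpl; ring).
    apply Rmult_le_compat_r; [apply Rlt_le, exp_pos|]. now apply quot_div_le.
Qed.

(** Between the lines -c2 and -c1 the sine has no zero, so the only pole is that of 1 / (z + s) at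
    -s, where the exponential equals 1. *)
Lemma mellin_diff (c1 c2 : R) (s : C) (y : R) : 0 < c1 -> c1 < fst s < c2 -> c2 < delta ->
  (mellin c1 s y - mellin c2 s y)%C = quot (- s)%C.
Proof.
  intros Hc1 Hs Hc2. assert (HPI := PI_RGT_0).
  assert (Hn : forall z, - c2 <= fst z <= - c1 -> Csin (PI * z) <> RtoC 0).
  { intros z Hz. apply (Csin_neq_0 0); [simpl; lra|]. apply C_neq_fst. simpl. lra. }
  (* A lower bound for |z + s| on both lines and at heights beyond |Im s| + 1, which are the places
     where [quot_shift] wants [e] bounded. As y is real, [e] does not grow with the height, hence
     theta = 0. *)
  set (m := Rmin 1 (Rmin (fst s - c1) (c2 - fst s))).
  assert (m0 : 0 < m) by (unfold m; repeat apply Rmin_pos; lra).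
  assert (m1 : m <= 1) by apply Rmin_l.
  assert (m2 : m <= fst s - c1) by (eapply Rle_trans; [apply Rmin_r|apply Rmin_l]).
  assert (m3 : m <= c2 - fst s) by (eapply Rle_trans; [apply Rmin_r|apply Rmin_r]).
  set (e := fun z => (/ (z + s) * Cexp ((z + s) * y))%C).
  assert (He : forall z, z <> (- s)%C -> (z + s)%C <> RtoC 0).
  { intros z Hz E. apply Hz. replace z with ((z + s) - s)%C by ring. rewrite E. ring. }
  assert (H := quot_shift e (- c2) (- c1) (/ m * exp ((c2 + Rabs (fst s)) * Rabs y)) 0 (Rabs (snd s) + 1)
    (- s)%C (quot (- s))%C).
  assert (E : forall c, line_int (fun z => quot z / (z + s) * Cexp ((z + s) * y))%C (- c) =
                line_int (fun z => quot z * e z)%C (- c)).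
  { intros c. apply line_int_ext. intros w. unfold e, Cdiv. ring. }
  unfold mellin. rewrite !E.
  replace (RtoC (/ (2 * PI)) * line_int (fun z => quot z * e z) (- c1) -
    RtoC (/ (2 * PI)) * line_int (fun z => quot z * e z) (- c2))%C with
    (RtoC (/ (2 * PI)) * (line_int (fun z => quot z * e z) (- c1) - line_int (fun z => quot z * e z) (- c2)))%C
    by ring.
  rewrite H; clear H.
  - rewrite RtoC_inv, RtoC_mult by lra. field;
    repeat split; intros E'; apply RtoC_inj in E'; lra.
  - lra.
  - simpl. lra.
  - apply sin_neg_neq_0. lra.
  - apply sin_neg_neq_0. lra.
  - lra.
  - apply Rmult_le_pos; [apply Rlt_le, Rinv_0_lt_compat, m0|apply Rlt_le, exp_pos].
  - intros z Hz Hzs. split; [now apply Hn|].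
    apply ex_Cderive_mult; [|apply exp_kernel_derive].
    apply (ex_Cderive_comp (fun w => / w)%C (fun z => z + s)%C).
    + eexists. now apply is_Cderive_inv, He.
    + apply ex_Cderive_plus; [apply ex_Cderive_id|apply ex_Cderive_const].
  - intros z Hz Hcase. rewrite Rmult_0_l, exp_0, Rmult_1_r.
    assert (Hm : m <= Cmod (z + s)).
    { assert (A1 := Rabs_fst_le_Cmod (z + s)). assert (A2 := Rabs_snd_le_Cmod (z + s)). simpl in A1, A2.
      destruct Hcase as [Hcase|[Hcase|Hcase]].
      - rewrite Hcase in A1. assert (A3 := Rle_abs (- (- c2 + fst s))). rewrite Rabs_Ropp in A3. lra.
      - rewrite Hcase in A1. assert (A3 := Rle_abs (- c1 + fst s)). lra.
      - assert (A3 := Rabs_triang (snd z + snd s) (- snd s)). rewrite Rabs_Ropp in A3.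
        replace (snd z + snd s + - snd s) with (snd z) in A3 by ring. lra. }
    unfold e. rewrite Cmod_mult, Cmod_inv, Cmod_Cexp by (apply Cmod_gt_0; lra).
    apply Rmult_le_compat; [apply Rlt_le, Rinv_0_lt_compat; lra|apply Rlt_le, exp_pos|
      apply Rinv_le_contravar; lra|].
    apply exp_le. replace (fst ((z + s) * y)%C) with ((fst z + fst s) * y) by (simpl; ring).
    eapply Rle_trans; [apply Rle_abs|]. rewrite Rabs_mult.
    apply Rmult_le_compat_r; [apply Rabs_pos|].
    eapply Rle_trans; [apply Rabs_triang|]. apply Rplus_le_compat_r.
    apply Rabs_le. lra.
  - assert (H1 := Clim_at_continuous _ (- s)%C (quot_derive (- s)%C ltac:(simpl; lra) (Hn (- s)%C ltac:(simpl; lra)))).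
    assert (H2 := Clim_at_continuous _ (- s)%C (exp_kernel_derive s (RtoC y) (- s)%C)).
    assert (H := Clim_at_mult _ _ _ _ _ H1 H2). cbv beta in H.
    replace (- s + s)%C with (RtoC 0) in H by ring.
    rewrite Cmult_0_l, Cexp_0, Cmult_1_r in H.
    revert H. apply Clim_at_ext with 1; [lra|].
    intros z Hz _. unfold e.
    generalize (quot z) (Cexp ((z + s) * y)). intros q x. field.
    now apply He.
Qed.

End Ramanujan.

(** * Return to the half-line x = e^y *)

Lemma is_series_of_Clim_seq (a : nat -> C) (l : C) :
  is_Clim_seq (fun n => Csum a n) l -> is_series (K := C_AbsRing) (V := C_NormedModule) a l.
Proof.
  intros H Q HQ. apply locally_Cmod in HQ. destruct HQ as (e & He & HQ).
  apply is_lim_seq_spec in H. destruct (H (mkposreal _ He)) as [N HN].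
  exists N. intros n Hn. apply HQ. specialize (HN n Hn). simpl in HN.
  rewrite Rminus_0_r in HN. eapply Rle_lt_trans; [apply Rle_abs|exact HN].
Qed.

Lemma Cexp_INR_ln (x : R) (k : nat) : 0 < x ->
  Cexp (INR k * RtoC (ln x)) = (RtoC x ^ k)%C.
Proof.
  intros Hx. rewrite <- RtoC_mult, Cexp_RtoC, <- RtoC_pow. f_equal.
  rewrite <- exp_pow. now rewrite exp_ln.
Qed.

(** The factor 1/x is the derivative of ln x, as the chain rule yields it when an antiderivative in
    y is composed with the logarithm. *)
Lemma RCpow_minus_1 (x : R) (s : C) : 0 < x ->
  RCpow x (s - 1) = (/ RtoC x * Cexp (s * RtoC (ln x)))%C.
Proof.
  intros Hx. unfold RCpow.
  assert (Hx0 : RtoC x <> RtoC 0) by (intros E; apply RtoC_inj in E; lra).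
  assert (E : Cexp (s * RtoC (ln x)) = (Cexp ((s - 1) * RtoC (ln x)) * RtoC x)%C).
  { rewrite <- (exp_ln x) at 3 by exact Hx. rewrite <- Cexp_RtoC, <- Cexp_plus. f_equal. ring. }
  rewrite E. field. exact Hx0.
Qed.

(** Near a positive real number the argument is close to 0, so [Clog] takes values in the strip
    where G is differentiable. *)
Lemma analytic_at_comp_Clog (G : C -> C) (kappa x : R) : 0 < kappa -> 0 < x ->
  (forall y, Rabs (snd y) < kappa -> ex_Cderive G y) ->
  analytic_at (fun z => G (Clog z)) (RtoC x).
Proof.
  intros Hk Hx HG.
  destruct (Clog_continuous (RtoC x) Hx kappa Hk) as (d & Hd & H).
  apply locally_Cmod. exists (Rmin d x). split; [now apply Rmin_pos|].
  intros z Hz. assert (L1 := Rmin_l d x). assert (L2 := Rmin_r d x).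
  assert (Hz0 : 0 < fst z).
  { assert (A := Rabs_fst_le_Cmod (z - RtoC x)). simpl in A.
    assert (B : Rabs (fst z + - x) < x) by lra. apply Rabs_lt_between in B. lra. }
  apply (ex_Cderive_comp G Clog); [|eexists; now apply is_Cderive_Clog].
  apply HG. specialize (H z ltac:(lra)).
  rewrite (Clog_RtoC x Hx) in H.
  assert (A := Rabs_snd_le_Cmod (Clog z - RtoC (ln x))).
  replace (snd (Clog z - RtoC (ln x))%C) with (snd (Clog z)) in A by (simpl; ring). lra.
Qed.

Lemma Rbar_lt_dense (x : R) (rho : Rbar) : Rbar_lt x rho ->
  exists x' : R, x < x' /\ Rbar_lt x' rho.
Proof.
  destruct rho as [r| |]; simpl; intros H; [|exists (x + 1); split; [lra|exact I]|contradiction].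
  exists ((x + r) / 2). lra.
Qed.

Lemma exp_lt_eps (M k eps : R) : 0 < k -> 0 < eps ->
  exists T, forall t, t < T -> M * exp (k * t) < eps.
Proof.
  intros Hk He.
  assert (Hq : 0 < eps / (Rabs M + 1)).
  { apply Rdiv_lt_0_compat; [exact He|]. assert (H := Rabs_pos M). lra. }
  exists (ln (eps / (Rabs M + 1)) / k). intros t Ht.
  apply Rlt_div_r in Ht; [|exact Hk].
  apply exp_increasing in Ht. rewrite exp_ln in Ht by exact Hq. rewrite Rmult_comm in Ht.
  assert (H := exp_pos (k * t)). assert (H1 := Rle_abs M). assert (H2 := Rabs_pos M).
  apply Rlt_div_r in Ht; [|lra]. nra.
Qed.

(** Since K1 = K2 + l, the integral from a to b is K1(ln b) - K1(ln a) = l + K2(ln b) - K1(ln a).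
    The term in a tends to 0 at 0 and the term in b tends to 0 at infinity: each antiderivative is
    used only at the end where it decays. *)
Lemma is_RInt_gen_antiderivative (f : R -> C) (K1 K2 : R -> C) (k1 k2 M1 M2 : R) (l : C) :
  0 < k1 -> 0 < k2 ->
  (forall x, 0 < x -> is_derive (V := C_R_NormedModule) (fun t => K1 (ln t)) x (f x)) ->
  (forall x, 0 < x -> Ccontinuous f x) ->
  (forall y, (K1 y - K2 y)%C = l) ->
  (forall y, Cmod (K1 y) <= M1 * exp (k1 * y)) ->
  (forall y, Cmod (K2 y) <= M2 * exp (- k2 * y)) ->
  is_RInt_gen (V := C_R_NormedModule) f (at_right 0) (Rbar_locally p_infty) l.
Proof.
  intros Hk1 Hk2 HD Hc Hl HM1 HM2 Q HQ.
  apply locally_Cmod in HQ. destruct HQ as (e & He & HQ).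
  destruct (exp_lt_eps M1 k1 (e / 2) Hk1 ltac:(lra)) as [T1 HT1].
  destruct (exp_lt_eps M2 k2 (e / 2) Hk2 ltac:(lra)) as [T2 HT2].
  exists (fun a => 0 < a /\ a < exp T1) (fun b => exp (- T2) < b).
  - exists (mkposreal _ (exp_pos T1)). intros a Ha H0. split; [exact H0|].
    change (Rabs (a - 0) < exp T1) in Ha. rewrite Rminus_0_r in Ha.
    eapply Rle_lt_trans; [apply Rle_abs|exact Ha].
  - now exists (exp (- T2)).
  - intros a b [Ha Ha1] Hb. simpl.
    assert (Hb0 : 0 < b) by (assert (H := exp_pos (- T2)); lra).
    assert (Hmin : 0 < Rmin a b) by now apply Rmin_pos.
    exists (K1 (ln b) - K1 (ln a))%C. split.
    + apply (is_RInt_derive (V := C_R_CompleteNormedModule) (fun t => K1 (ln t)));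
        intros x Hx; [apply HD|apply Hc]; lra.
    + apply HQ.
      replace (K1 (ln b) - K1 (ln a) - l)%C with (K2 (ln b) - K1 (ln a))%C
        by (rewrite <- (Hl (ln b)); ring).
      assert (A1 : ln a < T1) by (rewrite <- (ln_exp T1); now apply ln_increasing).
      assert (A2 : - ln b < T2).
      { assert (A3 : - T2 < ln b) by (rewrite <- (ln_exp (- T2)); apply ln_increasing; [apply exp_pos|exact Hb]).
        lra. }
      specialize (HT1 _ A1). specialize (HT2 _ A2).
      replace (k2 * - ln b) with (- k2 * ln b) in HT2 by ring.
      specialize (HM1 (ln a)). specialize (HM2 (ln b)).
      unfold Cminus. eapply Rle_lt_trans; [apply Cmod_triangle|]. rewrite Cmod_opp. lra.
Qed.

Lemma ramanujan_master (psi : C -> C) (delta C0 P A : R) (Hdelta : 0 < delta < 1)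
  (HA : 0 <= A < PI) (Hpsi : forall z : C, - delta <= fst z -> ex_Cderive psi z)
  (Hb : forall z : C, - delta <= fst z ->
     Cmod (psi z) <= C0 * exp (P * fst z + A * Rabs (snd z))) :
  exists F : C -> C, power_series_on_half_line (coef psi) F /\
    forall s : C, 0 < Re s < delta ->
      is_RInt_gen (V := C_R_NormedModule)
        (fun x : R => (RCpow x (s - 1) * F (RtoC x))%C)
        (at_right 0) (Rbar_locally p_infty) (quot psi (- s))%C.
Proof.
  assert (Hmd := ex_Cderive_master psi delta C0 P A Hdelta Hpsi Hb).
  assert (HFx : forall x : R, 0 < x -> master psi delta (Clog (RtoC x)) = master psi delta (RtoC (ln x))).
  { intros x Hx. now rewrite Clog_RtoC. }
  assert (Han : forall x : R, 0 < x -> analytic_at (fun z => master psi delta (Clog z)) (RtoC x)).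
  { intros x Hx. apply (analytic_at_comp_Clog (master psi delta) (PI - A)); auto; lra. }
  (* Only values near the positive half-line matter, and there [Clog] is the logarithm. *)
  exists (fun z => master psi delta (Clog z)). split; [split; [|split]|].
  - eapply Rbar_lt_le_trans; [|apply (exp_opp_le_CV_radius psi delta C0 P A); auto]. apply exp_pos.
  - intros x Hx Hrho. rewrite HFx by exact Hx.
    (* [master_eq_series] needs absolute convergence strictly to the right of ln x, hence an
       intermediate point below the radius. *)
    destruct (Rbar_lt_dense _ _ Hrho) as (x' & Hx' & Hrho').
    assert (Hr : ex_series (fun k => Cmod (coef psi k) * exp (INR k * ln x'))).
    { rewrite <- (Rabs_pos_eq x') in Hrho' by lra.
      apply CV_disk_inside in Hrho'. revert Hrho'. apply ex_series_ext. intros k.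
      rewrite Rabs_mult, <- RPow_abs, (Rabs_pos_eq x'), (Rabs_pos_eq (Cmod _)) by (try apply Cmod_ge_0; lra).
      now rewrite <- exp_pow, exp_ln by lra. }
    assert (Hln : ln x < ln x') by (now apply ln_increasing).
    rewrite (master_eq_series psi delta C0 P A Hdelta HA Hpsi Hb (ln x) (ln x') Hln Hr).
    apply is_series_of_Clim_seq.
    assert (Hs := exp_series_correct (coef psi) (ln x') (RtoC (ln x)) Hr ltac:(simpl; lra)).
    revert Hs. apply is_Clim_seq_ext. intros n.
    apply (sum_n_ext (G := C_AbelianMonoid)). intros k. now rewrite Cexp_INR_ln.
  - exact Han.
  - intros s Hs. change (0 < fst s < delta) in Hs.
    (* Any c1 in (0, Re s) and c2 in (Re s, delta) would do; the midpoints are taken. *)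
    set (c1 := fst s / 2). set (c2 := (fst s + delta) / 2).
    assert (Hc1 : 0 < c1 < delta) by (unfold c1; lra).
    assert (Hc2 : 0 < c2 < delta) by (unfold c2; lra).
    assert (Hc1s : c1 <> fst s) by (unfold c1; lra).
    assert (Hc2s : c2 <> fst s) by (unfold c2; lra).
    destruct (Cmod_mellin_le psi delta C0 P A Hdelta HA Hpsi Hb c1 s Hc1 Hc1s) as [M1 HM1].
    destruct (Cmod_mellin_le psi delta C0 P A Hdelta HA Hpsi Hb c2 s Hc2 Hc2s) as [M2 HM2].
    apply (is_RInt_gen_antiderivative _ (fun y => mellin psi c1 s (RtoC y)) (fun y => mellin psi c2 s (RtoC y))
      (fst s - c1) (c2 - fst s) M1 M2).
    + unfold c1. lra.
    + unfold c2. lra.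
    + intros x Hx. rewrite RCpow_minus_1, HFx by exact Hx.
      assert (D := is_Cderive_mellin psi delta C0 P A Hdelta HA Hpsi Hb c1 s (RtoC (ln x)) Hc1 Hc1s
        ltac:(simpl; rewrite Rabs_R0; lra)).
      assert (D1 : is_derive (V := C_R_NormedModule) (fun y : R => mellin psi c1 s (0 + 1 * RtoC y)%C) (ln x)
        (1 * (Cexp (s * RtoC (ln x)) * master psi delta (RtoC (ln x))))%C).
      { apply is_derive_path. replace (0 + 1 * RtoC (ln x))%C with (RtoC (ln x)) by ring. exact D. }
      assert (D2 := is_derive_comp (V := C_R_NormedModule) _ ln x _ (/ x) D1 (is_derive_ln x Hx)).
      assert (E : (/ RtoC x * Cexp (s * RtoC (ln x)) * master psi delta (RtoC (ln x)))%C =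
        scal (V := C_R_NormedModule) (/ x) (1 * (Cexp (s * RtoC (ln x)) * master psi delta (RtoC (ln x))))%C).
      { rewrite Cmult_1_l, <- Cmult_assoc, <- RtoC_inv by lra.
        generalize (Cexp (s * RtoC (ln x)) * master psi delta (RtoC (ln x)))%C. intros [u v].
        unfold Cmult, RtoC; simpl.
        change (scal (V := C_R_NormedModule) (/ x) (u, v)) with ((/ x * u, / x * v)).
        f_equal; ring. }
      rewrite E. revert D2. apply is_derive_ext. intros t.
      f_equal. ring.
    + intros x Hx.
      (* Near x the integrand is the restriction to the real axis of a function with a complex
         derivative at x, which yields its continuity. *)
      assert (Hd : ex_Cderive (fun z => Cexp ((s - 1) * Clog z) * master psi delta (Clog z))%C (RtoC x)).
      { apply ex_Cderive_mult; [|now apply analytic_at_ex_Cderive, Han].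
        apply ex_Cderive_Cexp, ex_Cderive_mult; [apply ex_Cderive_const|].
        eexists. now apply is_Cderive_Clog. }
      assert (Hcont := Ccontinuous_horizontal _ 0 x Hd).
      revert Hcont. apply (continuous_ext_loc (T := R_UniformSpace) (U := C_UniformSpace)).
      exists (mkposreal x Hx). intros t Ht.
      change (Rabs (t - x) < x) in Ht. apply Rabs_lt_between in Ht.
      unfold RCpow. change ((t, 0) : C) with (RtoC t). now rewrite Clog_RtoC by lra.
    + intros y. apply (mellin_diff psi delta C0 P A); auto; unfold c1, c2; lra.
    + exact HM1.
    + intros y. replace (- (c2 - fst s)) with (fst s - c2) by ring. apply HM2.
Qed.

Theorem theorem2 (delta C0 P A L : R) (g h phi : C -> C)
  (Hdelta : 0 < delta < 1)
  (Hg : forall z : C, half_plane delta z -> analytic_at g z)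
  (Hh : meromorphic h)
  (Hpoles : forall k : nat, simple_pole_at h (- RtoC (INR k))%C)
  (Hphi : removes_singularities h phi)
  (HA : A < PI)
  (Hgrowth : growth_condition delta C0 P A g phi)
  (Hlim : is_lim_seq
    (fun k : nat =>
       Rpower (Cmod (Residue h (- RtoC (INR k)) / phi (RtoC (INR k)))%C) (1 / INR k))
    (Finite L))
  (HL : 1 <= L) :
  exists F : C -> C,
    power_series_on_half_line
      (fun k : nat => (Residue h (- RtoC (INR k)) * g (RtoC (INR k)))%C) F /\
    forall s : C, 0 < Re s < delta ->
      is_RInt_gen (V := C_R_NormedModule)
        (fun x : R => (RCpow x (s - 1) * F (RtoC x))%C)
        (at_right 0) (Rbar_locally p_infty)
        (h s * g (- s))%C.
Proof.
  assert (HPI := PI_RGT_0).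
  set (psi := fun z => (phi z * g z)%C).
  assert (Hres : forall k, (Residue h (- RtoC (INR k)) * g (RtoC (INR k)))%C = coef psi k).
  { intros k. rewrite (Residue_eq_phi h phi k (Hpoles k) Hphi). unfold coef, psi. ring. }
  (* The residue of h at 0 is not 0, so phi(0) <> 0 and the strict growth bound at 0 forces its
     right side to be positive. The sign is needed at the zeros of phi, where the growth condition
     is silent and 0 must still lie below the bound. *)
  assert (HC0 : 0 <= C0).
  { destruct (Hgrowth (RtoC (INR 0)) ltac:(unfold half_plane; simpl; lra)) as [_ H].
    assert (H0 : phi (RtoC (INR 0)) <> RtoC 0).
    { intros E. destruct (Residue_simple_pole h _ (Hpoles 0%nat)) as [_ N]. apply N.
      rewrite (Residue_eq_phi h phi 0 (Hpoles 0%nat) Hphi), E. ring. }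
    specialize (H H0). apply Cmod_gt_0 in H0.
    apply Rlt_div_r in H; [|exact H0].
    assert (B := Cmod_ge_0 (g (RtoC (INR 0)))).
    match type of H with _ < C0 * exp ?u => assert (He := exp_pos u); nra end. }
  (* A may be negative; replacing it by max(A, 0) weakens the bound and stays below pi. *)
  destruct (ramanujan_master psi delta C0 P (Rmax A 0) Hdelta) as (F & HF & HI).
  - split; [apply Rmax_r|apply Rmax_lub_lt; lra].
  - intros z Hz. apply ex_Cderive_mult; apply analytic_at_ex_Cderive; [now apply Hgrowth|now apply Hg].
  - intros z Hz. destruct (Hgrowth z Hz) as [_ H]. unfold psi. rewrite Cmod_mult.
    apply Rle_trans with (C0 * exp (P * fst z + A * Rabs (snd z))).
    + destruct (Ceq_dec (phi z) (RtoC 0)) as [E|E].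
      * rewrite E, Cmod_0, Rmult_0_l. apply Rmult_le_pos; [exact HC0|apply Rlt_le, exp_pos].
      * specialize (H E). apply Cmod_gt_0 in E. apply Rlt_div_r in H; [|exact E].
        rewrite Rmult_comm. now apply Rlt_le.
    + apply Rmult_le_compat_l; [exact HC0|]. apply exp_le. apply Rplus_le_compat_l.
      apply Rmult_le_compat_r; [apply Rabs_pos|apply Rmax_l].
  - exists F. split.
    + destruct HF as (H1 & H2 & H3).
      assert (E : CV_radius (fun k => Cmod (Residue h (- RtoC (INR k)) * g (RtoC (INR k)))%C) =
                  CV_radius (fun k => Cmod (coef psi k))).
      { apply CV_radius_ext. intros k. now rewrite Hres. }
      split; [|split]; [now rewrite E| |exact H3].
      rewrite E. intros x Hx Hrho.
      apply (is_series_ext (V := C_NormedModule) (fun k => coef psi k * RtoC x ^ k)%C); [|now apply H2].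
      intros k. now rewrite Hres.
    + intros s Hs. change (0 < fst s < delta) in Hs.
      (* Off the non-negative integers phi(-s) = sin(-pi s) h(s), and the sine cancels against the
         denominator of [quot]. *)
      replace (h s * g (- s))%C with (quot psi (- s))%C; [now apply HI|].
      unfold quot, psi. destruct Hphi as [Hphi _]. rewrite Hphi.
      * replace (- - s)%C with s by ring. field.
        apply (Csin_neq_0 0); [simpl; lra|]. apply C_neq_fst. simpl. lra.
      * intros k. apply C_neq_fst. simpl. assert (Hk := pos_INR k). lra.
Qed.
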